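(* Let $n,d,m\ge 1$ be integers, let $\Omega\subset \mathbb{C}^n\subset\mathbb{C}\mathbb{P}^n$ be a nonempty connected open set, let $f\colon\Omega\to \mathbb{C}^d\subset \mathbb{C}\mathbb{P}^d$ be a minimally embedded holomorphic mapping, and let $a,b,c$ be positive integers without a common prime factor. Let $\omega_{n,f, c/b}=\omega_n+(c/b) f^*\omega_d$ be the $c/b$-modification of the Fubini-Study metric $\omega_n$ induced by $f$. Assume that there is a minimally embedded holomorphic mapping $h\colon \Omega\to \mathbb{C}^m\subset \mathbb{C}\mathbb{P}^m$ such that $\omega_{n,f,c/b}=(a/b)h^*\omega_m$ on $\Omega$ or, equivalently, $$\omega_{n}=\frac{a}{b}h^*\omega_m-\frac{c}{b}f^*\omega_d.$$ If $(1,f)^{\otimes c}$ has rank $e+1$ (i.e., its components span a complex vector space of dimension $e+1$), then $$cd\leq e\leq \sum_{k=1}^c\binom{d+k-1}{k}$$ and the following hold: (i) If $e\leq n$ and $b=1$, then the following two inequalities hold: $$n(e+1)-\frac{e(e-1)}{2}\leq \sum_{k=1}^a\binom{m+k-1}{k},\qquad am\leq n(e+1)+e.$$ (ii) If $e\geq n$ or $b\geq 2$, then $$\frac{n(n+3)}{2}\leq \sum_{k=1}^a\binom{m+k-1}{k}.$$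
   Context: $\omega_N$ denotes the $(1,1)$-form associated with the Fubini-Study metric on $\mathbb{C}\mathbb{P}^N$; in affine coordinates $w=(w_1,\ldots,w_N)\in\mathbb{C}^N\subset\mathbb{C}\mathbb{P}^N$ (the affine chart $w\mapsto[1:w]$), $$\omega_N=\frac{\sqrt{-1}}{2\pi}\,\partial\bar\partial\log\Big(1+\sum_{i=1}^N|w_i|^2\Big).$$ For a holomorphic mapping $\phi=(\phi_1,\ldots,\phi_N)\colon\Omega\to\mathbb{C}^N\subset\mathbb{C}\mathbb{P}^N$ on an open set $\Omega\subset\mathbb{C}^n$, $\phi^*\omega_N=\frac{\sqrt{-1}}{2\pi}\partial\bar\partial\log(1+\sum_{i=1}^N|\phi_i(z)|^2)$. The mapping $\phi$ is called minimally embedded if its image $\phi(\Omega)$ is not contained in a proper projective linear subspace of $\mathbb{C}\mathbb{P}^N$; equivalently, $1,\phi_1,\ldots,\phi_N$ are linearly independent over $\mathbb{C}$. For holomorphic mappings $\phi=(\phi_1,\ldots,\phi_p)$ and $\psi=(\psi_1,\ldots,\psi_q)$ on $\Omega$, the tensor product $\phi\otimes\psi$ is the mapping $\Omega\to\mathbb{C}^{pq}$ whose components are the products $\phi_i\psi_j$, $1\le i\le p$, $1\le j\le q$, in some predetermined ordering of the pairs $(i,j)$; $\phi^{\otimes k}$ is the tensor product of $\phi$ with itself $k$ times (so $\phi^{\otimes 1}=\phi$). Here $(1,f)=(1,f_1,\ldots,f_d)\colon\Omega\to\mathbb{C}^{d+1}$. The rank of $(1,f)^{\otimes c}$ is the dimension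 over $\mathbb{C}$ of the vector space of holomorphic functions on $\Omega$ spanned by its components. *)

(* Defs.v *)
From HB Require Import structures.
From mathcomp Require Import all_boot all_order all_algebra.
From mathcomp Require Import complex.
From mathcomp Require Import boolp classical_sets reals topology normedtype.
From mathcomp Require Import derive exp trigo.

Set Implicit Arguments.
Unset Strict Implicit.
Unset Printing Implicit Defensive.

Import Order.TTheory GRing.Theory Num.Theory.
Import numFieldNormedType.Exports.

Local Open Scope classical_set_scope.
Local Open Scope complex_scope.
Local Open Scope ring_scope.

(** Only [R[i]^o] inherits a normed-module structure (over the field [R[i]]);
    matrices over [R[i]] get their topology from this copy. *)
HB.instance Definition _ (R : realType) := NormedModule.copy R[i] R[i]^o.

(** The space C^n is ['rV[R[i]]_n].  A (1,1)-form
    [\sum_(j, k) A_jk dz_j /\ dzbar_k] is given by its coefficient matrix [A],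
    which depends on the base point. *)
Definition form11 (R : realType) (n : nat) := 'rV[R[i]]_n -> 'M[R[i]]_n.

(** Derivative at [z] of a complex-valued function in the direction [v], along
    the real line [t |-> z + t v]. *)
Definition real_dderiv (R : realType) (n : nat) (F : 'rV[R[i]]_n -> R[i])
    (v z : 'rV[R[i]]_n) : R[i] :=
  derive1 (fun t : R => complex.Re (F (z + t%:C *: v))) 0 +i*
  derive1 (fun t : R => complex.Im (F (z + t%:C *: v))) 0.

(** Wirtinger derivatives, with [z_j = x_j + i y_j]:
    d/dz_j    = 1/2 (d/dx_j - i d/dy_j),
    d/dzbar_j = 1/2 (d/dx_j + i d/dy_j). *)
Definition dz (R : realType) (n : nat) (j : 'I_n) (F : 'rV[R[i]]_n -> R[i])
    (z : 'rV[R[i]]_n) : R[i] :=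
  (real_dderiv F (delta_mx 0 j) z
   - 'i * real_dderiv F ('i *: delta_mx 0 j) z) / 2%:R.

Definition dzbar (R : realType) (n : nat) (j : 'I_n) (F : 'rV[R[i]]_n -> R[i])
    (z : 'rV[R[i]]_n) : R[i] :=
  (real_dderiv F (delta_mx 0 j) z
   + 'i * real_dderiv F ('i *: delta_mx 0 j) z) / 2%:R.

Definition ddbar (R : realType) (n : nat) (u : 'rV[R[i]]_n -> R) : form11 R n :=
  fun z => \matrix_(j, k) dz j (dzbar k (fun w => (u w)%:C)) z.

(** The Fubini-Study form of CP^N in the affine chart [w |-> [1 : w]]. *)
Definition fubini_study (R : realType) (N : nat) : form11 R N :=
  fun w => ('i / (2%:R * pi)%:C) *:
    ddbar (fun v => ln (1 + \sum_(k < N) ComplexField.Normc.normc (v 0 k) ^+ 2)) w.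

(** Pullback by a holomorphic map [phi].  The library's Jacobian acts on row
    vectors, so that [jacobian phi z j k] is the derivative of [phi_k] with
    respect to [z_j]; since [phi] is holomorphic,
    [phi^* dw_k = \sum_j (jacobian phi z j k) dz_j], and [phi^* dwbar_k] is its
    conjugate. *)
Definition pullback (R : realType) (n N : nat) (phi : 'rV[R[i]]_n -> 'rV[R[i]]_N)
    (omega : form11 R N) : form11 R n :=
  fun z => jacobian phi z *m omega (phi z) *m (map_mx conjc (jacobian phi z))^T.

(** The [lambda]-modification of the Fubini-Study metric induced by [f]. *)
Definition fs_modification (R : realType) (n d : nat)
    (f : 'rV[R[i]]_n -> 'rV[R[i]]_d) (lambda : R) : form11 R n :=
  fun z => fubini_study z + lambda%:C *: pullback f (@fubini_study R d) z.

(** Differentiability is over the field [R[i]]. *)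
Definition holomorphic_on (R : realType) (n N : nat) (Omega : set 'rV[R[i]]_n)
    (phi : 'rV[R[i]]_n -> 'rV[R[i]]_N) : Prop :=
  forall z, Omega z -> differentiable phi z.

(** The map [(1, phi)]: homogeneous coordinates of [phi z] in CP^N. *)
Definition with_one (R : realType) (T : Type) (N : nat) (phi : T -> 'rV[R[i]]_N) :
    T -> 'rV[R[i]]_(1 + N) :=
  fun z => row_mx 1%:M (phi z).

(** Projective linear subspaces of CP^N are the projectivizations of the linear
    subspaces of C^(N+1). *)
Definition minimally_embedded (R : realType) (T : Type) (N : nat) (Omega : set T)
    (phi : T -> 'rV[R[i]]_N) : Prop :=
  ~ exists V : {vspace 'rV[R[i]]_(1 + N)},
      V != fullv /\ forall z, Omega z -> with_one phi z \in V.

(** [mxvec] lists the pairs [(i, j)] in row-major order. *)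
Definition tensor (K : comPzRingType) (T : Type) (p q : nat)
    (phi : T -> 'rV[K]_p) (psi : T -> 'rV[K]_q) : T -> 'rV[K]_(p * q) :=
  fun z => mxvec (\matrix_(i, j) (phi z 0 i * psi z 0 j)).

(** [tensor_pow phi 1] is [phi]; the nested match follows the reduction of
    [p ^ k], for which [p ^ 1] is [p] and not [p * 1]. *)
Fixpoint tensor_pow (K : comPzRingType) (T : Type) (p : nat) (phi : T -> 'rV[K]_p)
    (k : nat) {struct k} : T -> 'rV[K]_(p ^ k) :=
  match k return T -> 'rV[K]_(p ^ k) with
  | 0 => fun _ => const_mx 1
  | k1.+1 =>
    match k1 return (T -> 'rV[K]_(p ^ k1)) -> T -> 'rV[K]_(p ^ k1.+1) with
    | 0 => fun _ => phi
    | k2.+1 => fun psi => tensor phi psi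
    end (tensor_pow phi k1)
  end.

(** The functions whose restriction to [Omega] is a linear combination of the
    components of [phi]. *)
Definition comp_span (K : comPzRingType) (T : Type) (p : nat) (Omega : set T)
    (phi : T -> 'rV[K]_p) : set (T -> K) :=
  [set F | exists c : 'cV[K]_p, forall z, Omega z -> F z = (phi z *m c) 0 0].

Definition comp_free (K : comPzRingType) (T : Type) (p : nat) (Omega : set T)
    (phi : T -> 'rV[K]_p) : Prop :=
  forall c : 'cV[K]_p, (forall z, Omega z -> (phi z *m c) 0 0 = 0) -> c = 0.

(** The components of [phi] span a vector space of functions on [Omega] of
    dimension [r]: it has a basis of [r] functions, the components of [B]. *)
Definition has_rank (K : comPzRingType) (T : Type) (p : nat) (Omega : set T)
    (phi : T -> 'rV[K]_p) (r : nat) : Prop :=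
  exists B : T -> 'rV[K]_r,
    comp_free Omega B /\ comp_span Omega B = comp_span Omega phi.

(* Main.v *)
Require Import Defs.
From HB Require Import structures.
From mathcomp Require Import all_boot all_order all_algebra.
From mathcomp Require Import complex.
From mathcomp Require Import boolp classical_sets reals topology normedtype.
From mathcomp Require Import derive exp trigo.
From mathcomp Require Import constructive_ereal realfun.
From mathcomp Require Import measure lebesgue_measure lebesgue_integral ftc.
From mathcomp Require Import ring lra zify.

(** Write [K1(z, w) = (1 + <z, w>)^b (1 + <f z, f w>)^c] and
    [K2(z, w) = (1 + <h z, h w>)^a].  The metric identity says that
    [log K1(z, z) - log K2(z, z)] is pluriharmonic.  Its polarization near a
    point [p], first on complex lines through [p] and then in [C^n], gives
    Calabi's rigidity [K1(z, w) = t g(z) conj(g(w)) K2(z, w)].  As [K1] and [K2]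
    are the Gram kernels of [P = (1, z)^b (x) (1, f)^c] and [H = (1, h)^a], for
    points [q_i] near [p] the families [P(q_i)] and [H(q_i)] have the same rank,
    and the theorem follows from bounds on both ranks.

    Upper bounds count monomials.  For [c d + 1 <= rank (1, f)^c], products of
    linear forms vanish at all but one of suitable points.  For
    [(n + 1)(e + 1) - e(e + 1)/2 <= rank ((1, z) (x) Y)], where
    [Y = (Y_0, ..., Y_e)] is free, choose points [t_i] with [Y_j(t_i)] the
    Kronecker symbol: a linear syzygy [L . Y = 0], [L] affine, is determined by
    the [e(e + 1)/2] values [L_j(t_i)], [i < j].

    All maps are merely complex differentiable, and are only ever restricted to
    complex lines.  The one-variable facts needed are that derivatives are again
    differentiable and that zeros propagate; both come from Goursat's theorem
    and Cauchy's formula on squares. *)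

Set Implicit Arguments.
Unset Strict Implicit.
Unset Printing Implicit Defensive.

Import Order.TTheory GRing.Theory Num.Theory.
Import numFieldNormedType.Exports.

Local Open Scope classical_set_scope.
Local Open Scope complex_scope.
Local Open Scope ring_scope.

(** The factorization of kernels holds only on a small polydisc around [p], whereas independence is
    assumed on [Omega]; the identity theorem carries independence over to the polydisc. Ranks are
    taken of matrices of values, not of function spaces, because Gram kernels control the linear
    relations between values at points, and for suitable points such a matrix has the rank of the
    family.

    A hypothesis on second derivatives can be integrated on a complex line by one-variable calculus;
    polarizing the resulting diagonal identity in [C^n] then avoids solving a [ddbar] equation in
    several variables.

    In each inequality relating [a], [m] to [n], one side of [rank P = rank H] is bounded below and
    the other above. For [b = 1] the rank of [P] is at most [(n + 1)(e + 1)], and that of [H]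
    reaches [a m + 1]. For (ii) it suffices to find [n + 1] independent functions [Y] with
    [(1, z) (x) Y] in the span of [P]: the affine functions if [b >= 2], and [n + 1] of the [e + 1]
    basis functions of [(1, f)^c] if [b = 1] and [e >= n]. *)

Local Notation nc := ComplexField.Normc.normc.
(* [ring_scope] would otherwise read [x^*] as [Num.conj]. *)
Local Notation "x ^*" := (conjc x) : ring_scope.

(** * Complex differentiability *)

Section ComplexNorm.
Variable R : realType.
Local Notation C := R[i].
Implicit Types (z w l : C) (g : C -> C).

Lemma normcE_nc z : `|z| = (nc z)%:C. Proof. by []. Qed.

Lemma nc_ge0 z : 0 <= nc z.
Proof. by case: z => a b; exact: sqrtr_ge0. Qed.

Lemma nc_eq0 z : (nc z == 0) = (z == 0).
Proof.
apply/eqP/eqP => [/ComplexField.Normc.eq0_normc//|->].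
exact: ComplexField.Normc.normc0.
Qed.

Lemma nc0 : nc (0 : C) = 0. Proof. exact: ComplexField.Normc.normc0. Qed.

Lemma nc_gt0 z : (0 < nc z) = (z != 0).
Proof. by rewrite lt_def nc_eq0 nc_ge0 andbT. Qed.

Lemma ncM z w : nc (z * w) = nc z * nc w.
Proof. exact: ComplexField.Normc.normcM. Qed.

Lemma ncV z : nc z^-1 = (nc z)^-1.
Proof. exact: ComplexField.Normc.normcV. Qed.

Lemma ncX z n : nc (z ^+ n) = nc z ^+ n.
Proof.
elim: n => [|n IH]; first by rewrite !expr0; exact: ComplexField.Normc.normc1.
by rewrite !exprS ncM IH.
Qed.

Lemma ncN z : nc (- z) = nc z.
Proof. exact: normcN. Qed.

Lemma ncD z w : nc (z + w) <= nc z + nc w.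
Proof. exact: le_normcD. Qed.

Lemma ncB z w : nc (z - w) <= nc z + nc w.
Proof. by rewrite -(ncN w); exact: ncD. Qed.

Lemma ncBC z w : nc (z - w) = nc (w - z).
Proof. by rewrite -ncN opprB. Qed.

Lemma ncC (x : R) : nc x%:C = `|x|.
Proof. by rewrite /= expr0n addr0 sqrtr_sqr. Qed.

Lemma nci : nc ('i : C) = 1.
Proof. by rewrite /= expr0n expr1n add0r sqrtr1. Qed.

Lemma ncJ z : nc z^* = nc z.
Proof. by case: z => a b; rewrite /= sqrrN. Qed.

Lemma Re_le_nc z : `|complex.Re z| <= nc z.
Proof.
case: z => a b /=; rewrite -sqrtr_sqr ler_sqrt ?lerDl ?sqr_ge0//.
by rewrite addr_ge0 ?sqr_ge0.
Qed.

Lemma Im_le_nc z : `|complex.Im z| <= nc z.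
Proof.
case: z => a b /=; rewrite -sqrtr_sqr ler_sqrt ?lerDr ?sqr_ge0//.
by rewrite addr_ge0 ?sqr_ge0.
Qed.

Lemma nc_le_ReIm z : nc z <= `|complex.Re z| + `|complex.Im z|.
Proof.
rewrite [X in nc X]complexE; apply: le_trans (ncD _ _) _.
by rewrite ncM nci mul1r !ncC.
Qed.

Lemma ltcR_pos (e : C) : 0 < e -> exists2 r : R, 0 < r & e = r%:C.
Proof.
case: e => r s; rewrite ltcE /= => /andP[/eqP -> r0]; by exists r.
Qed.

(** The limit of difference quotients with the division cleared: [w = 0] need not be excluded, and
    error terms combine by the triangle inequality. *)
Definition cder g z l := forall e : R, 0 < e -> exists2 d : R, 0 < d &
  forall w, nc w < d -> nc (g (z + w) - g z - l * w) <= e * nc w.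

Lemma lim_cder g z l :
  (fun h : C => h^-1 *: ((g \o shift z) (h *: 1) - g z)) @ 0^' --> l -> cder g z l.
Proof.
move=> lim e e0; have /cvgrPdist_le /(_ e%:C) := lim.
rewrite ltcR => /(_ e0) /nbhs_ballP[d /ltcR_pos[r r0 ->]] H.
exists r => // w wr; have [->|w0] := eqVneq w 0.
  by rewrite nc0 mulr0 addr0 mulr0 subrr subr0 nc0.
have := H w; rewrite /ball /= sub0r normrN !normcE_nc ltcR => /(_ wr w0).
rewrite lecR => Hw; have nw : 0 < nc w by rewrite nc_gt0.
rewrite -(ler_pM2r nw) -ncM -ncN in Hw; apply: le_trans Hw.
rewrite le_eqVlt; apply/orP; left; apply/eqP; congr nc.
rewrite /GRing.scale /= mulr1 mulrBl opprB /shift /=; congr (_ - _).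
by rewrite mulrAC mulVf // mul1r [w + z]addrC.
Qed.

(** Bridge to the library derivative over [R[i]], from which the rules for sums, products and
    inverses are imported. *)
Lemma cderP g z l : cder g z l <-> is_derive z (1 : C) g l.
Proof.
split=> [gl|[gd <-]]; last by apply: lim_cder; exact: gd.
have lim : (fun h : C => h^-1 *: ((g \o shift z) (h *: 1) - g z)) @ 0^' --> l.
  apply/cvgrPdist_le => e /ltcR_pos[r r0 ->].
  have [d d0 H] := gl r r0.
  apply/nbhs_ballP; exists d%:C => /=; first by rewrite ltcR.
  move=> w; rewrite /ball /= sub0r normrN normcE_nc ltcR => wd w0.
  have := H _ wd; rewrite normcE_nc lecR /= /shift /= => Hw.
  have nw : 0 < nc w by rewrite nc_gt0.
  rewrite -(ler_pM2r nw) -ncM -ncN; apply: le_trans Hw.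
  rewrite le_eqVlt; apply/orP; left; apply/eqP; congr nc.
  rewrite /GRing.scale /= mulr1 mulrBl opprB; congr (_ - _).
  by rewrite mulrAC mulVf // mul1r [w + z]addrC.
have h1 : derivable g z 1 by exact: (cvgP l).
have h2 : derive g z 1 = l by apply: (cvg_lim (@norm_hausdorff _ C)); exact: lim.
exact: (DeriveDef h1 h2).
Qed.

Lemma cder_unique g z l l' : cder g z l -> cder g z l' -> l = l'.
Proof. by move=> /cderP[_ <-] /cderP[_ <-]. Qed.

Lemma cder_eq g1 g2 z l (d : R) : 0 < d ->
  (forall w, nc (w - z) < d -> g1 w = g2 w) -> cder g1 z l -> cder g2 z l.
Proof.
move=> d0 g12 H e e0; have [d' d'0 {}H] := H e e0.
exists (Num.min d d'); first by rewrite lt_min d0.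
move=> w; rewrite lt_min => /andP[wd wd'].
rewrite -!g12 ?subrr ?nc0 //; first exact: H.
by rewrite addrC addKr.
Qed.

Lemma cder_cst (k : C) z : cder (fun=> k) z 0.
Proof.
move=> e e0; exists 1 => // w _.
by rewrite subrr mul0r subrr nc0 mulr_ge0 ?nc_ge0 // ltW.
Qed.

Lemma cder_affine a b z : cder (fun w => a + b * w) z b.
Proof.
move=> e e0; exists 1 => // w _.
have -> : a + b * (z + w) - (a + b * z) - b * w = 0 by ring.
by rewrite nc0 mulr_ge0 ?nc_ge0 // ltW.
Qed.

Lemma cder_id z : cder id z 1.
Proof.
by apply: cder_eq (cder_affine 0 1 z) => // w _; rewrite add0r mul1r.
Qed.

Lemma cderD g h z l m : cder g z l -> cder h z m ->
  cder (fun w => g w + h w) z (l + m).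
Proof. by move=> /cderP ? /cderP ?; apply/cderP; exact: is_deriveD. Qed.

Lemma cderB g h z l m : cder g z l -> cder h z m ->
  cder (fun w => g w - h w) z (l - m).
Proof. by move=> /cderP ? /cderP ?; apply/cderP; exact: is_deriveB. Qed.

Lemma cderM g h z l m : cder g z l -> cder h z m ->
  cder (fun w => g w * h w) z (g z * m + h z * l).
Proof. by move=> /cderP ? /cderP ?; apply/cderP; exact: is_deriveM. Qed.

Lemma cderZ k g z l : cder g z l -> cder (fun w => k * g w) z (k * l).
Proof.
move=> gl; have := cderM (cder_cst k z) gl.
by rewrite mulr0 addr0.
Qed.

Lemma cderV g z l : g z != 0 -> cder g z l ->
  cder (fun w => (g w)^-1) z (- (g z)^-2 * l).
Proof.
move=> gz0 /cderP gl; apply/cderP.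
split; first by apply: derivableV.
by rewrite deriveV //; case: gl => _ <-.
Qed.

Lemma cder_sum (I : Type) (s : seq I) (g : I -> C -> C) (l : I -> C) z :
  (forall i, cder (g i) z (l i)) ->
  cder (fun w => \sum_(i <- s) g i w) z (\sum_(i <- s) l i).
Proof.
move=> gl; elim: s => [|i s IH].
  rewrite big_nil; under [X in cder X]funext do rewrite big_nil.
  exact: cder_cst.
rewrite big_cons; under [X in cder X]funext do rewrite big_cons.
exact: (cderD (gl i) IH).
Qed.

Lemma cderX g z l n : cder g z l ->
  cder (fun w => g w ^+ n) z (n%:R * g z ^+ n.-1 * l).
Proof.
move=> gl; elim: n => [|n IH].
  by rewrite !mul0r; under [X in cder X]funext do rewrite expr0; exact: cder_cst.
under [X in cder X]funext do rewrite exprS.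
have -> : n.+1%:R * g z ^+ n.+1.-1 * l =
    g z * (n%:R * g z ^+ n.-1 * l) + g z ^+ n * l.
  rewrite -natr1 /=; case: n {IH} => [|n] /=; first by rewrite !expr0; ring.
  rewrite exprS; ring.
exact: (cderM gl IH).
Qed.

Lemma cder_comp_affine g a b z l : cder g (a + b * z) l ->
  cder (fun w => g (a + b * w)) z (b * l).
Proof.
move=> H e e0; have [->|b0] := eqVneq b 0.
  exists 1 => // w _; rewrite !mul0r !subrr nc0.
  by rewrite mulr_ge0 ?nc_ge0 // ltW.
have nb : 0 < nc b by rewrite nc_gt0.
have [d d0 {}H] := H (e / nc b) (divr_gt0 e0 nb).
exists (d / nc b); first exact: divr_gt0.
move=> w; rewrite ltr_pdivlMr // mulrC -ncM => /H.
by rewrite ncM [e / _ * _]mulrA divfK ?gt_eqF // mulrDr addrA [l * _]mulrCA mulrA.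
Qed.

(** Conjugating both argument and value turns [l * w^*] back into a complex linear increment. This
    opens the conjugated variable of a kernel to one-variable arguments. *)
Lemma cder_conj g z l : cder g z^* l -> cder (fun w => (g w^*)^*) z l^*.
Proof.
move=> H e e0; have [d d0 {}H] := H e e0.
exists d => // w wd; have := H w^*; rewrite ncJ => /(_ wd) H1.
suff -> : (g (z + w)^*)^* - (g z^*)^* - l^* * w =
  (g (z^* + w^*) - g z^* - l * w^*)^* by rewrite ncJ.
by rewrite !rmorphB rmorphM /= conjcK -rmorphD.
Qed.

Lemma cder_cont g z l : cder g z l -> forall e : R, 0 < e -> exists2 d : R, 0 < d &
  forall w, nc (w - z) < d -> nc (g w - g z) < e.
Proof.
move=> H e e0; have [d d0 {}H] := H 1 ltr01.
have k0 : 0 < 1 + nc l by rewrite ltr_pwDl ?nc_ge0.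
exists (Num.min d (e / (1 + nc l))); first by rewrite lt_min d0 divr_gt0.
move=> w; rewrite lt_min => /andP[wd we].
have := H _ wd; rewrite mul1r [z + _]addrC subrK => Hw.
have -> : g w - g z = (g w - g z - l * (w - z)) + l * (w - z) by ring.
apply: le_lt_trans (ncD _ _) _; rewrite ncM.
rewrite ltr_pdivlMr // in we.
apply: le_lt_trans we; rewrite [_ * (1 + _)]mulrDr mulr1 [nc l * _]mulrC.
exact: lerD.
Qed.

End ComplexNorm.

(** * Integrals of complex-valued functions *)

Section ComplexIntegral.
Variable R : realType.
Local Notation C := R[i].
Local Notation mu := (@lebesgue_measure R).
Implicit Types (g h : R -> C) (a b c : R).

Definition rint (f : R -> R) a b := \int[mu]_(x in `[a, b]) f x.

Definition cint g a b : C :=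
  rint (fun x => complex.Re (g x)) a b +i* rint (fun x => complex.Im (g x)) a b.

(** The nearby point [y] is not confined to the interval: the integrands are restrictions of
    functions continuous in the plane. *)
Definition pcont g a b := forall x, a <= x <= b -> forall e : R, 0 < e ->
  exists2 d : R, 0 < d & forall y, `|y - x| < d -> nc (g y - g x) < e.

(** [p] stands for the real or the imaginary part, both 1-Lipschitz. *)
Lemma integrable_comp (p : C -> R) g a b :
  (forall z w, `|p z - p w| <= nc (z - w)) -> pcont g a b ->
  mu.-integrable `[a, b] (EFin \o (p \o g)).
Proof.
move=> hp gc; apply: continuous_compact_integrable.
  exact: segment_compact.
apply: continuous_in_subspaceT => x; rewrite inE /= in_itv /= => xab.
apply/cvgrPdist_lt => e e0; have [d d0 H] := gc x xab e e0.
apply/nbhs_ballP; exists d => //= y; rewrite /ball /= distrC => /H.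
by apply: le_lt_trans; rewrite distrC; exact: hp.
Qed.

Lemma ReB_le_nc (z w : C) : `|complex.Re z - complex.Re w| <= nc (z - w).
Proof. by apply: le_trans (Re_le_nc _); rewrite raddfB. Qed.

Lemma ImB_le_nc (z w : C) : `|complex.Im z - complex.Im w| <= nc (z - w).
Proof. by apply: le_trans (Im_le_nc _); rewrite raddfB. Qed.

Let integrableRe g a b (gc : pcont g a b) := integrable_comp ReB_le_nc gc.
Let integrableIm g a b (gc : pcont g a b) := integrable_comp ImB_le_nc gc.

Lemma eq_cint g h a b : (forall x, a <= x <= b -> g x = h x) ->
  cint g a b = cint h a b.
Proof.
move=> gh; congr (_ +i* _); apply: eq_Rintegral => x;
  by rewrite inE /= in_itv /= => /gh ->.
Qed.

Lemma cintD g h a b : pcont g a b -> pcont h a b ->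
  cint (fun x => g x + h x) a b = cint g a b + cint h a b.
Proof.
move=> gc hc; rewrite /cint /rint.
have E1 x : complex.Re (g x + h x) = complex.Re (g x) + complex.Re (h x).
  by rewrite raddfD.
have E2 x : complex.Im (g x + h x) = complex.Im (g x) + complex.Im (h x).
  by rewrite raddfD.
under eq_Rintegral do rewrite E1.
rewrite RintegralD //; [|exact: integrableRe|exact: integrableRe].
under [X in _ +i* X]eq_Rintegral do rewrite E2.
by rewrite RintegralD //; exact: integrableIm.
Qed.

Lemma cintZ (k : C) g a b : pcont g a b ->
  cint (fun x => k * g x) a b = k * cint g a b.
Proof.
move=> gc; rewrite /cint /rint; case: k => p q.
have E1 x : complex.Re ((p +i* q) * g x) =
  p * complex.Re (g x) - q * complex.Im (g x) by case: (g x).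
have E2 x : complex.Im ((p +i* q) * g x) =
  p * complex.Im (g x) + q * complex.Re (g x) by case: (g x).
have iZ f r : mu.-integrable `[a, b] (EFin \o f) ->
    mu.-integrable `[a, b] (EFin \o (fun x => r * f x)).
  move=> fi; have mI : measurable (`[a, b] : set (measurableTypeR R)) by [].
  exact: (integrableZl mI r fi).
under eq_Rintegral do rewrite E1.
under [X in _ +i* X]eq_Rintegral do rewrite E2.
rewrite RintegralB // ?RintegralD // ?RintegralZl //;
  by [exact: integrableRe|exact: integrableIm
     |apply: iZ; exact: integrableRe|apply: iZ; exact: integrableIm].
Qed.

Lemma rint_chasles (f : R -> R) a b c : a <= b -> b <= c ->
  mu.-integrable `[a, c] (EFin \o f) -> rint f a c = rint f a b + rint f b c.
Proof.
move=> ab bc fi; rewrite /rint.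
have ibc : mu.-integrable `]b, c] (EFin \o f).
  apply: integrableS fi => //; apply: subset_itv; rewrite !bnd_simp //.
have := Rintegral_itvB fi; move=> /(_ b); rewrite !bnd_simp => /(_ ab bc) H.
rewrite -[X in _ = _ + X](Rintegral_itv_obnd_cbnd ibc) -H; ring.
Qed.

Lemma cint_chasles g a b c : a <= b -> b <= c -> pcont g a c ->
  cint g a c = cint g a b + cint g b c.
Proof.
move=> ab bc gc; rewrite /cint.
by rewrite (rint_chasles ab bc (integrableRe gc)) (rint_chasles ab bc (integrableIm gc)).
Qed.

Lemma rint_cst (r : R) a b : a <= b -> rint (fun=> r) a b = r * (b - a).
Proof.
move=> ab; rewrite /rint Rintegral_cst //= lebesgue_measure_itv /= lte_fin.
by case: ltP => // ba; rewrite (@le_anti _ _ a b) ?ab ?ba // subrr.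
Qed.

Lemma rint_le (f1 f2 : R -> R) a b : mu.-integrable `[a, b] (EFin \o f1) ->
  mu.-integrable `[a, b] (EFin \o f2) ->
  (forall x, a <= x <= b -> f1 x <= f2 x) -> rint f1 a b <= rint f2 a b.
Proof.
by move=> i1 i2 H; apply: le_Rintegral => // x /=; rewrite in_itv; exact: H.
Qed.

Lemma integrable_cst_itv (r : R) a b : mu.-integrable `[a, b] (EFin \o (fun=> r)).
Proof.
apply: (@integrable_comp (@complex.Re R) (fun=> r%:C) a b ReB_le_nc).
by move=> x _ e e0; exists 1 => // y _; rewrite subrr nc0.
Qed.

Lemma rint_abs_le (f : R -> R) (M : R) a b : a <= b ->
  mu.-integrable `[a, b] (EFin \o f) ->
  (forall x, a <= x <= b -> `|f x| <= M) -> `|rint f a b| <= M * (b - a).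
Proof.
move=> ab fi H; rewrite ler_norml; apply/andP; split.
  rewrite -mulNr -rint_cst //; apply: rint_le => //.
    exact: integrable_cst_itv.
  by move=> x /H; rewrite ler_norml => /andP[].
rewrite -rint_cst //; apply: rint_le => //.
  exact: integrable_cst_itv.
by move=> x /H; rewrite ler_norml => /andP[].
Qed.

(** Real and imaginary parts are bounded separately, hence the factor 2; it leads to the 4 of
    [rectint_le] and the 16 of [sqint_le]. *)
Lemma cint_le g (M : R) a b : a <= b -> pcont g a b ->
  (forall x, a <= x <= b -> nc (g x) <= M) -> nc (cint g a b) <= 2 * M * (b - a).
Proof.
move=> ab gc H; apply: le_trans (nc_le_ReIm _) _ => /=.
have -> : 2 * M * (b - a) = M * (b - a) + M * (b - a) by ring.
apply: lerD; apply: rint_abs_le => //.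
- exact: integrableRe.
- by move=> x /H; apply: le_trans; exact: Re_le_nc.
- exact: integrableIm.
- by move=> x /H; apply: le_trans; exact: Im_le_nc.
Qed.

(** This lower bound will keep the integral of [1 / (z - a)] away from 0. *)
Lemma Im_cint_ge g (m : R) a b : a <= b -> pcont g a b ->
  (forall x, a <= x <= b -> m <= complex.Im (g x)) ->
  m * (b - a) <= complex.Im (cint g a b).
Proof.
move=> ab gc H; rewrite -rint_cst //=; apply: rint_le => //.
  exact: integrable_cst_itv.
exact: integrableIm.
Qed.

Lemma pcont_affine (k l : C) a b : pcont (fun x => k + l * x%:C) a b.
Proof.
move=> x _ e e0.
have k0 : 0 < 1 + nc l by rewrite ltr_pwDl ?nc_ge0.
exists (e / (1 + nc l)); first by rewrite divr_gt0.
move=> y; rewrite ltr_pdivlMr // => H.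
have -> : k + l * y%:C - (k + l * x%:C) = l * (y - x)%:C.
  by rewrite rmorphB /=; ring.
rewrite ncM ncC; apply: le_lt_trans H.
by rewrite mulrC ler_wpM2l // lerDr.
Qed.

Lemma rint_id a b : a <= b -> rint id a b = (b ^+ 2 - a ^+ 2) / 2.
Proof.
rewrite le_eqVlt => /predU1P[->|ab].
  by rewrite /rint set_itv1 Rintegral_set1 subrr mul0r.
have der (x : R) : is_derive x (1 : R) (fun x : R => x ^+ 2 / 2) x.
  have -> : (fun x : R => x ^+ 2 / 2) = (2^-1 \*: (@GRing.exp R ^~ 2%N)).
    by apply: funext => y; rewrite mulrC.
  by apply: is_derive_eq; rewrite /GRing.scale /= mulr1; field.
suff H : (\int[mu]_(x in `[a, b]) (x%:E) = (b ^+ 2 / 2)%:E - (a ^+ 2 / 2)%:E)%E.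
  by rewrite /rint /Rintegral H /= mulrBl.
have cF (x : R) : {for x, continuous (fun x : R => x ^+ 2 / 2)}.
  by apply: differentiable_continuous; apply/derivable1_diffP; case: (der x).
apply: (@continuous_FTC2 _ id (fun x => x ^+ 2 / 2)) => //=.
- by apply: continuous_subspaceT => x; exact: cvg_id.
- split; first by move=> x _.
  + by apply: cvg_at_right_filter; exact: cF.
  + by apply: cvg_at_left_filter; exact: cF.
- by move=> x _; rewrite derive1E; case: (der x).
Qed.

Lemma cint_cst (k : C) a b : a <= b -> cint (fun=> k) a b = k * (b - a)%:C.
Proof.
by move=> ab; rewrite /cint !rint_cst //; case: k => p q; simpc.
Qed.

Lemma cint_affine (k l : C) a b : a <= b ->
  cint (fun x => k + l * x%:C) a b =
  k * (b - a)%:C + l * ((b ^+ 2 - a ^+ 2) / 2)%:C.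
Proof.
move=> ab.
have pc : pcont (fun x => x%:C) a b.
  have := @pcont_affine 0 1 a b; congr (pcont _ a b).
  by apply: funext => x; rewrite add0r mul1r.
rewrite cintD.
- rewrite cint_cst // cintZ //; congr (_ + _ * _).
  by rewrite /cint rint_id // rint_cst // mul0r.
- by have := @pcont_affine k 0 a b; congr (pcont _ a b); apply: funext => x; rewrite mul0r addr0.
- by have := @pcont_affine 0 l a b; congr (pcont _ a b); apply: funext => x; rewrite add0r.
Qed.

End ComplexIntegral.

(** * Goursat's theorem *)

Section Goursat.
Variable R : realType.
Local Notation C := R[i].
Implicit Types (f g : C -> C) (x y : R) (z w : C).

Definition ccont f z := forall e : R, 0 < e -> exists2 d : R, 0 < d &
  forall w, nc (w - z) < d -> nc (f w - f z) < e.

Definition in_rect x1 x2 y1 y2 z :=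
  (x1 <= complex.Re z <= x2) && (y1 <= complex.Im z <= y2).

Definition on_bdry x1 x2 y1 y2 z := in_rect x1 x2 y1 y2 z &&
  [|| complex.Re z == x1, complex.Re z == x2, complex.Im z == y1 | complex.Im z == y2].

(** Counterclockwise contour integral; the factor ['i] is [dz = i dy] on the vertical sides. *)
Definition rectint f x1 x2 y1 y2 : C :=
  cint (fun x => f (x +i* y1)) x1 x2 - cint (fun x => f (x +i* y2)) x1 x2 +
  'i * (cint (fun y => f (x2 +i* y)) y1 y2 - cint (fun y => f (x1 +i* y)) y1 y2).

Lemma pcont_horizontal f x1 x2 y :
  (forall x, x1 <= x <= x2 -> ccont f (x +i* y)) ->
  pcont (fun x => f (x +i* y)) x1 x2.
Proof.
move=> fc x xx e e0; have [d d0 H] := fc x xx e e0; exists d => // w wd.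
by apply: H; simpc; rewrite -[_ +i* 0]/((w - x)%:C) ncC.
Qed.

Lemma pcont_vertical f x y1 y2 :
  (forall y, y1 <= y <= y2 -> ccont f (x +i* y)) ->
  pcont (fun y => f (x +i* y)) y1 y2.
Proof.
move=> fc y yy e e0; have [d d0 H] := fc y yy e e0; exists d => // w wd.
apply: H; simpc; have -> : 0 +i* (w - y) = 'i * (w - y)%:C :> C by simpc.
by rewrite ncM nci mul1r ncC.
Qed.

Lemma bdry_pcont f x1 x2 y1 y2 : x1 <= x2 -> y1 <= y2 ->
  (forall z, on_bdry x1 x2 y1 y2 z -> ccont f z) ->
  [/\ pcont (fun x => f (x +i* y1)) x1 x2, pcont (fun x => f (x +i* y2)) x1 x2,
      pcont (fun y => f (x2 +i* y)) y1 y2 & pcont (fun y => f (x1 +i* y)) y1 y2].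
Proof.
move=> xx yy H; split;
  by [apply: pcont_horizontal => x hx; apply: H;
      rewrite /on_bdry /in_rect /= hx lexx yy eqxx ?orbT
     |apply: pcont_vertical => y hy; apply: H;
      rewrite /on_bdry /in_rect /= hy lexx xx eqxx ?orbT].
Qed.

Lemma eq_rectint f g x1 x2 y1 y2 : x1 <= x2 -> y1 <= y2 ->
  (forall z, on_bdry x1 x2 y1 y2 z -> f z = g z) ->
  rectint f x1 x2 y1 y2 = rectint g x1 x2 y1 y2.
Proof.
move=> xx yy H; rewrite /rectint; congr (_ - _ + _ * (_ - _)); apply: eq_cint => t ht;
  by apply: H; rewrite /on_bdry /in_rect /= ht lexx ?xx ?yy eqxx ?orbT.
Qed.

Lemma rectintD f g x1 x2 y1 y2 : x1 <= x2 -> y1 <= y2 ->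
  (forall z, on_bdry x1 x2 y1 y2 z -> ccont f z) ->
  (forall z, on_bdry x1 x2 y1 y2 z -> ccont g z) ->
  rectint (fun z => f z + g z) x1 x2 y1 y2 =
  rectint f x1 x2 y1 y2 + rectint g x1 x2 y1 y2.
Proof.
move=> xx yy /(bdry_pcont xx yy)[? ? ? ?] /(bdry_pcont xx yy)[? ? ? ?].
rewrite /rectint !cintD //; ring.
Qed.

Lemma rectintZ (k : C) f x1 x2 y1 y2 : x1 <= x2 -> y1 <= y2 ->
  (forall z, on_bdry x1 x2 y1 y2 z -> ccont f z) ->
  rectint (fun z => k * f z) x1 x2 y1 y2 = k * rectint f x1 x2 y1 y2.
Proof.
move=> xx yy /(bdry_pcont xx yy)[? ? ? ?].
rewrite /rectint !cintZ //; ring.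
Qed.

Lemma rectint_le f (M : R) x1 x2 y1 y2 : x1 <= x2 -> y1 <= y2 ->
  (forall z, on_bdry x1 x2 y1 y2 z -> ccont f z) ->
  (forall z, on_bdry x1 x2 y1 y2 z -> nc (f z) <= M) ->
  nc (rectint f x1 x2 y1 y2) <= 4 * M * (x2 - x1 + (y2 - y1)).
Proof.
move=> xx yy /(bdry_pcont xx yy)[h1 h2 h3 h4] H; rewrite /rectint.
apply: le_trans (ncD _ _) _; rewrite ncM nci mul1r.
have -> : 4 * M * (x2 - x1 + (y2 - y1)) =
  (2 * M * (x2 - x1) + 2 * M * (x2 - x1)) + (2 * M * (y2 - y1) + 2 * M * (y2 - y1)).
  by ring.
by apply: lerD; apply: le_trans (ncB _ _) _; apply: lerD; apply: cint_le => // t ht;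
  apply: H; rewrite /on_bdry /in_rect /= ht lexx ?xx ?yy eqxx ?orbT.
Qed.

Lemma rectint_cutx f x1 m x2 y1 y2 : x1 <= m -> m <= x2 -> y1 <= y2 ->
  (forall z, in_rect x1 x2 y1 y2 z -> ccont f z) ->
  rectint f x1 x2 y1 y2 = rectint f x1 m y1 y2 + rectint f m x2 y1 y2.
Proof.
move=> x1m mx2 yy fc.
have bc z : on_bdry x1 x2 y1 y2 z -> ccont f z by case/andP => /fc.
have [h1 h2 _ _] := bdry_pcont (le_trans x1m mx2) yy bc.
rewrite /rectint (cint_chasles x1m mx2 h1) (cint_chasles x1m mx2 h2); ring.
Qed.

Lemma rectint_cuty f x1 x2 y1 m y2 : x1 <= x2 -> y1 <= m -> m <= y2 ->
  (forall z, in_rect x1 x2 y1 y2 z -> ccont f z) ->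
  rectint f x1 x2 y1 y2 = rectint f x1 x2 y1 m + rectint f x1 x2 m y2.
Proof.
move=> xx y1m my2 fc.
have bc z : on_bdry x1 x2 y1 y2 z -> ccont f z by case/andP => /fc.
have [_ _ h1 h2] := bdry_pcont xx (le_trans y1m my2) bc.
rewrite /rectint (cint_chasles y1m my2 h1) (cint_chasles y1m my2 h2); ring.
Qed.

Lemma ReImE x y : x +i* y = x%:C + 'i * y%:C.
Proof. by simpc. Qed.

(** Follows by computing the four sides, before any form of Cauchy's theorem; the proof of Goursat's
    theorem subtracts the tangent map with it. *)
Lemma rectint_affine (k l : C) x1 x2 y1 y2 : x1 <= x2 -> y1 <= y2 ->
  rectint (fun z => k + l * z) x1 x2 y1 y2 = 0.
Proof.
move=> xx yy; rewrite /rectint.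
have E y a b : a <= b -> cint (fun x => k + l * (x +i* y)) a b =
    (k + l * 'i * y%:C) * (b - a)%:C + l * ((b ^+ 2 - a ^+ 2) / 2)%:C.
  by move=> ab; rewrite -cint_affine //; apply: eq_cint => x _; rewrite ReImE; ring.
have F x a b : a <= b -> cint (fun y => k + l * (x +i* y)) a b =
    (k + l * x%:C) * (b - a)%:C + (l * 'i) * ((b ^+ 2 - a ^+ 2) / 2)%:C.
  by move=> ab; rewrite -cint_affine //; apply: eq_cint => y _; rewrite ReImE; ring.
rewrite !E // !F // !rmorphB /=; ring.
Qed.

Lemma cder_ccont f z l : cder f z l -> ccont f z.
Proof. exact: cder_cont. Qed.

Lemma nc_rect x1 x2 y1 y2 z w : in_rect x1 x2 y1 y2 z -> in_rect x1 x2 y1 y2 w ->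
  nc (z - w) <= (x2 - x1) + (y2 - y1).
Proof.
move=> /andP[/andP[? ?] /andP[? ?]] /andP[/andP[? ?] /andP[? ?]].
apply: le_trans (nc_le_ReIm _) _; rewrite !raddfB /=.
by apply: lerD; rewrite ler_norml; apply/andP; split; lra.
Qed.

(** Cutting at both midpoints writes the integral as a sum of four, one of which carries at least a
    quarter of its modulus; [(x, y)] is the lower left corner of that piece. *)
Lemma goursat_step f x1 x2 y1 y2 : x1 <= x2 -> y1 <= y2 ->
  (forall z, in_rect x1 x2 y1 y2 z -> ccont f z) ->
  exists x y, [/\ x1 <= x, x + (x2 - x1) / 2 <= x2, y1 <= y, y + (y2 - y1) / 2 <= y2 &
    nc (rectint f x1 x2 y1 y2) <=
    4 * nc (rectint f x (x + (x2 - x1) / 2) y (y + (y2 - y1) / 2))].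
Proof.
move=> xx yy fc.
set mx := x1 + (x2 - x1) / 2; set my := y1 + (y2 - y1) / 2.
have [a1 a2] : x1 <= mx /\ mx <= x2 by rewrite /mx; split; lra.
have [b1 b2] : y1 <= my /\ my <= y2 by rewrite /my; split; lra.
have ex : mx + (x2 - x1) / 2 = x2 by rewrite /mx; field.
have ey : my + (y2 - y1) / 2 = y2 by rewrite /my; field.
have fcl z : in_rect x1 mx y1 y2 z -> ccont f z.
  by move=> /andP[/andP[? ?] ?]; apply: fc; rewrite /in_rect; lra.
have fcr z : in_rect mx x2 y1 y2 z -> ccont f z.
  by move=> /andP[/andP[? ?] ?]; apply: fc; rewrite /in_rect; lra.
have E := rectint_cutx a1 a2 yy fc.
rewrite (rectint_cuty a1 b1 b2 fcl) (rectint_cuty a2 b1 b2 fcr) in E.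
set J := nc (rectint f x1 x2 y1 y2).
set q1 := nc (rectint f x1 mx y1 my); set q2 := nc (rectint f x1 mx my y2).
set q3 := nc (rectint f mx x2 y1 my); set q4 := nc (rectint f mx x2 my y2).
have le4 : J <= q1 + q2 + (q3 + q4).
  rewrite /J E; apply: le_trans (ncD _ _) _; apply: lerD; exact: ncD.
have [h1|h1] := leP J (4 * q1).
  by exists x1, y1; split.
have [h2|h2] := leP J (4 * q2).
  by exists x1, my; rewrite ey; split.
have [h3|h3] := leP J (4 * q3).
  by exists mx, y1; rewrite ex; split.
exists mx, my; rewrite ex ey; split => //.
rewrite -/q4; lra.
Qed.

(** Bisection: the nested rectangles shrink to a point, where differentiability bounds the [n]-th
    integral by [e] times the square of the size, and the square exactly compensates the loss
    [4 ^ n]. *)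
Theorem goursat f x1 x2 y1 y2 : x1 <= x2 -> y1 <= y2 ->
  (forall z, in_rect x1 x2 y1 y2 z -> exists l, cder f z l) ->
  rectint f x1 x2 y1 y2 = 0.
Proof.
move=> xx yy fd.
have fc z : in_rect x1 x2 y1 y2 z -> ccont f z.
  by move=> /fd[l]; exact: cder_ccont.
pose W n := (x2 - x1) / 2 ^+ n; pose H n := (y2 - y1) / 2 ^+ n.
have p2 n : 0 < 2 ^+ n :> R by exact: exprn_gt0.
have W0 n : 0 <= W n by rewrite divr_ge0 ?subr_ge0 // ltW.
have H0 n : 0 <= H n by rewrite divr_ge0 ?subr_ge0 // ltW.
pose valid n (p : R * R) := [/\ x1 <= p.1, p.1 + W n <= x2, y1 <= p.2 & p.2 + H n <= y2].
pose K n (p : R * R) := nc (rectint f p.1 (p.1 + W n) p.2 (p.2 + H n)).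
pose rel n (p q : R * R) := [/\ p.1 <= q.1, q.1 + W n.+1 <= p.1 + W n, p.2 <= q.2,
  q.2 + H n.+1 <= p.2 + H n & K n p <= 4 * K n.+1 q].
have [nxt nxtP] : {nx : nat * (R * R) -> R * R &
    forall np, valid np.1 np.2 -> rel np.1 np.2 (nx np)}.
  apply: (@choice _ _ (fun np q => valid np.1 np.2 -> rel np.1 np.2 q)) => -[n [x y]] /=.
  (* The pair [(0, 0)] is a dummy successor of invalid rectangles, which the sequence [s] never
     meets. *)
  have [[/= v1 v2 v3 v4]|] := pselect (valid n (x, y)); last by exists (0, 0).
  have [||z /andP[/andP[? ?] /andP[? ?]]|x' [y' [r1 r2 r3 r4 r5]]] :=
    @goursat_step f x (x + W n) y (y + H n).
  - by rewrite lerDl.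
  - by rewrite lerDl.
  - by apply: fc; rewrite /in_rect; apply/andP; split; apply/andP; split; lra.
  have eW : W n.+1 = (x + W n - x) / 2 by rewrite /W exprS; field; rewrite gt_eqF.
  have eH : H n.+1 = (y + H n - y) / 2 by rewrite /H exprS; field; rewrite gt_eqF.
  by exists (x', y') => _; split => //=; rewrite ?eW ?eH // /K /= eW eH.
pose fix s n := if n is k.+1 then nxt (k, s k) else (x1, y1).
have sv n : valid n (s n).
  elim: n => [|n IH].
    by split => //=; rewrite /W /H expr0 divr1; lra.
  have [r1 r2 r3 r4 _] := nxtP (n, s n) IH; case: IH => v1 v2 v3 v4.
  by split => /=; [exact: le_trans r1|exact: le_trans v2|exact: le_trans r3|exact: le_trans v4].
have sr n : rel n (s n) (s n.+1) by exact: (nxtP (n, s n) (sv n)).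
have mono n k : [/\ (s n).1 <= (s (n + k)%N).1, (s (n + k)%N).1 + W (n + k)%N <= (s n).1 + W n,
    (s n).2 <= (s (n + k)%N).2 & (s (n + k)%N).2 + H (n + k)%N <= (s n).2 + H n].
  elim: k => [|k [i1 i2 i3 i4]]; first by rewrite addn0.
  rewrite addnS; have [r1 r2 r3 r4 _] := sr (n + k)%N.
  by split; [exact: le_trans r1|exact: le_trans i2|exact: le_trans r3|exact: le_trans i4].
(* Every left end lies below every right end, so the supremum of the left ends belongs to all
   intervals; likewise vertically. *)
have cross n k : (s k).1 <= (s n).1 + W n /\ (s k).2 <= (s n).2 + H n.
  have [nk|/ltnW kn] := leqP n k.
    have [_ h1 _ h2] := mono n (k - n)%N; rewrite subnKC // in h1 h2.
    by split; [apply: le_trans h1|apply: le_trans h2]; rewrite lerDl.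
  have [h1 _ h2 _] := mono k (n - k)%N; rewrite subnKC // in h1 h2.
  by split; [apply: le_trans h1 _|apply: le_trans h2 _]; rewrite lerDl.
have Kn n : K 0%N (s 0%N) <= 4 ^+ n * K n (s n).
  elim: n => [|n IH]; first by rewrite expr0 mul1r.
  apply: le_trans IH _; rewrite exprSr -mulrA ler_wpM2l ?exprn_ge0 //.
  by have [] := sr n.
have supP (u v : nat -> R) : (forall n k, u k <= v n) ->
    exists c, forall n, u n <= c <= v n.
  move=> uv; exists (sup (range u)) => n; apply/andP; split.
    apply: sup_upper_bound; last by exists n.
    by split; [exists (u 0%N), 0%N|exists (v 0%N) => _ [k _ <-]].
  apply: ge_sup; first by exists (u 0%N), 0%N.
  by move=> _ [k _ <-].
have [cx cxP] := supP (fun n => (s n).1) (fun n => (s n).1 + W n) (fun n k => (cross n k).1).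
have [cy cyP] := supP (fun n => (s n).2) (fun n => (s n).2 + H n) (fun n k => (cross n k).2).
have cin n : in_rect (s n).1 ((s n).1 + W n) (s n).2 ((s n).2 + H n) (cx +i* cy).
  by rewrite /in_rect /= cxP cyP.
have [l cl] : exists l, cder f (cx +i* cy) l.
  apply: fd; rewrite /in_rect /=; have := (cxP 0%N, cyP 0%N) => -[] /=.
  by rewrite /W /H expr0 !divr1 => /andP[? ?] /andP[? ?]; lra.
set D := (x2 - x1) + (y2 - y1).
have D0 : 0 <= D by rewrite addr_ge0 ?subr_ge0.
have WH n : W n + H n = D / 2 ^+ n by rewrite -mulrDl.
have small e : 0 < e -> K 0%N (s 0%N) <= 4 * e * D ^+ 2.
  move=> e0; have [d d0 {}cl] := cl e e0.
  have [n Dn] : exists n, D / 2 ^+ n < d.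
    exists (Num.truncn (D / d)).+1; rewrite ltr_pdivrMr // mulrC -ltr_pdivrMr //.
    apply: lt_trans (truncnS_gt _) _.
    by rewrite -natrX ltr_nat ltn_expl.
  apply: le_trans (Kn n) _.
  set S := rectint f (s n).1 ((s n).1 + W n) (s n).2 ((s n).2 + H n).
  pose r z := f z - (f (cx +i* cy) - l * (cx +i* cy) + l * z).
  have xW : (s n).1 <= (s n).1 + W n by rewrite lerDl.
  have yH : (s n).2 <= (s n).2 + H n by rewrite lerDl.
  have inr z : on_bdry (s n).1 ((s n).1 + W n) (s n).2 ((s n).2 + H n) z ->
      in_rect x1 x2 y1 y2 z.
    case/andP => /andP[/andP[? ?] /andP[? ?]] _; have [? ? ? ?] := sv n.
    by rewrite /in_rect; lra.
  have rc z : on_bdry (s n).1 ((s n).1 + W n) (s n).2 ((s n).2 + H n) z -> ccont r z.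
    move=> /inr /fd[m fm]; apply: cder_ccont; apply: cderB fm _; exact: cder_affine.
  have SE : S = rectint r (s n).1 ((s n).1 + W n) (s n).2 ((s n).2 + H n).
    rewrite -[RHS](addr0) -(rectint_affine (f (cx +i* cy) - l * (cx +i* cy)) l xW yH).
    rewrite -rectintD //; last first.
      by move=> z _; apply: cder_ccont; exact: cder_affine.
    by apply: eq_rectint => // z _; rewrite /r subrK.
  have rb z : on_bdry (s n).1 ((s n).1 + W n) (s n).2 ((s n).2 + H n) z ->
      nc (r z) <= e * (D / 2 ^+ n).
    move=> /andP[zin _]; have zc := nc_rect zin (cin n).
    have {}zc : nc (z - (cx +i* cy)) <= D / 2 ^+ n.
      by apply: le_trans zc _; rewrite -WH; lra.
    have := cl (z - (cx +i* cy)) (le_lt_trans zc Dn).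
    rewrite [X in f X]addrC subrK => h.
    apply: (@le_trans _ _ (e * nc (z - (cx +i* cy)))); last by rewrite ler_pM2l.
    by apply: le_trans h; rewrite le_eqVlt; apply/orP; left; apply/eqP; congr nc; rewrite /r; ring.
  have := rectint_le xW yH rc rb; rewrite -SE -/(K n (s n)) => h.
  have {h} : K n (s n) <= 4 * (e * (D / 2 ^+ n)) * (D / 2 ^+ n).
    by apply: le_trans h _; rewrite -WH; lra.
  rewrite -(ler_pM2l (exprn_gt0 n (ltr0n R 4))) => h; apply: le_trans h _.
  have -> : 4 ^+ n = (2 ^+ n) ^+ 2 :> R by rewrite -exprM mulnC exprM; congr (_ ^+ n); ring.
  by rewrite le_eqVlt; apply/orP; left; apply/eqP; field; rewrite gt_eqF.
apply/eqP; rewrite -nc_eq0; apply/eqP.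
have -> : nc (rectint f x1 x2 y1 y2) = K 0%N (s 0%N).
  by rewrite /K /= /W /H expr0 !divr1 !subrKC.
apply/le_anti; rewrite nc_ge0 andbT leNgt; apply/negP => K0.
set k := K 0%N (s 0%N) in K0 small.
(* With [e = k / (8 (D ^ 2 + 1))] the bound [4 e D ^ 2] drops below [k / 2]; the 1 avoids division
   by 0 for a degenerate rectangle. *)
have q0 : 0 < 8 * (D ^+ 2 + 1) by rewrite mulr_gt0 // ltr_pwDr // sqr_ge0.
have := small (k / (8 * (D ^+ 2 + 1))) (divr_gt0 K0 q0).
rewrite leNgt => /negP; apply.
have -> : 4 * (k / (8 * (D ^+ 2 + 1))) * D ^+ 2 = k * (D ^+ 2 / (2 * (D ^+ 2 + 1))).
  field; rewrite gt_eqF //; rewrite ltr_pwDr // sqr_ge0 //.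
rewrite gtr_pMr // ltr_pdivrMr ?mulr_gt0 ?ltr_pwDr ?sqr_ge0 // mul1r.
have := sqr_ge0 D; lra.
Qed.

End Goursat.

(** * Cauchy's formula *)

Section Cauchy.
Variable R : realType.
Local Notation C := R[i].
Implicit Types (f g : C -> C) (x y r : R) (z w a : C).

Definition sqint f a r :=
  rectint f (complex.Re a - r) (complex.Re a + r) (complex.Im a - r) (complex.Im a + r).

Definition in_sq a r := in_rect (complex.Re a - r) (complex.Re a + r)
  (complex.Im a - r) (complex.Im a + r).

Definition bd_sq a r := on_bdry (complex.Re a - r) (complex.Re a + r)
  (complex.Im a - r) (complex.Im a + r).

Lemma in_sq_nc a r z : in_sq a r z -> nc (z - a) <= 2 * r.
Proof.
move=> /andP[/andP[? ?] /andP[? ?]].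
apply: le_trans (nc_le_ReIm _) _; rewrite !raddfB /=.
have -> : 2 * r = r + r by ring.
by apply: lerD; rewrite ler_norml; apply/andP; split; lra.
Qed.

Lemma bd_sq_nc a r z : 0 < r -> bd_sq a r z -> r <= nc (z - a).
Proof.
move=> r0 /andP[_ /or4P[] /eqP E].
- apply: le_trans (Re_le_nc _); rewrite raddfB /= E -(normrN (_ - _)) !opprB.
  by rewrite addrC subrK (gtr0_norm r0).
- by apply: le_trans (Re_le_nc _); rewrite raddfB /= E [_ + r]addrC addrK (gtr0_norm r0).
- by apply: le_trans (Im_le_nc _); rewrite raddfB /= E -(normrN (_ - _)) !opprB addrC subrK (gtr0_norm r0).
- by apply: le_trans (Im_le_nc _); rewrite raddfB /= E [_ + r]addrC addrK (gtr0_norm r0).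
Qed.

Lemma cder_kernel a z n : z != a ->
  exists l, cder (fun w => (w - a) ^- n) z l.
Proof.
move=> za; eexists; apply: cderV; last first.
  by apply: cderX; apply: cderB (cder_id z) (cder_cst a z).
by rewrite expf_neq0 // subr_eq0.
Qed.

(* Of the pieces cut out by the lines through the sides of a small square
   centered at [a], only that square can contribute to the integral. *)
Lemma sqint_quotient f a0 a r : 0 < r -> nc (a - a0) < r ->
  (forall z, in_sq a0 r z -> exists l, cder f z l) ->
  sqint (fun z => (f z - f a) / (z - a)) a0 r = 0.
Proof.
move=> r0 ar fd.
have := le_lt_trans (Re_le_nc _) ar; have := le_lt_trans (Im_le_nc _) ar.
rewrite !raddfB /= !ltr_norml => /andP[i1 i2] /andP[j1 j2].
have [l fl] : exists l, cder f a l by apply: fd; rewrite /in_sq /in_rect; lra.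
(* With the value [l] at [a] the quotient is continuous, as the cutting lemmas require on the pieces
   containing [a]. *)
pose g z := if z == a then l else (f z - f a) / (z - a).
rewrite /sqint.
set x1 := _ - r; set x2 := complex.Re a0 + r; set y1 := complex.Im a0 - r.
set y2 := complex.Im a0 + r.
have xx : x1 <= x2 by rewrite /x1 /x2; lra.
have yy : y1 <= y2 by rewrite /y1 /y2; lra.
transitivity (rectint g x1 x2 y1 y2).
  apply: eq_rectint => // z zb; rewrite /g; case: eqVneq => // za; exfalso.
  by have := bd_sq_nc r0 zb; rewrite za leNgt ar.
have gd z : in_rect x1 x2 y1 y2 z -> z != a -> exists m, cder g z m.
  move=> /fd[m fm] za; have [k hk] := cder_kernel 1 za.
  eexists; apply: (@cder_eq _ (fun w => (f w - f a) * (w - a) ^- 1) _ _ _ (nc (z - a))).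
  - by rewrite nc_gt0 subr_eq0.
  - move=> w wz; rewrite /g expr1; case: eqVneq => // wa.
    by move: wz; rewrite wa ncBC ltxx.
  - apply: cderM hk; apply: cderB fm (cder_cst _ _).
have ga e : 0 < e -> exists2 d : R, 0 < d & forall w, nc (w - a) < d -> nc (g w - l) < e.
  move=> e0; have [d d0 H] := fl (e / 2) (divr_gt0 e0 (ltr0n _ 2)); exists d => // w wd.
  rewrite /g; case: eqVneq => [_|wa]; first by rewrite subrr nc0.
  have wa0 : w - a != 0 by rewrite subr_eq0.
  have -> : (f w - f a) / (w - a) - l = (f w - f a - l * (w - a)) / (w - a).
    by field.
  have := H _ wd; rewrite [X in f X]addrC subrK => h.
  rewrite ncM ncV ltr_pdivrMr ?nc_gt0 //; apply: le_lt_trans h _.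
  by rewrite ltr_pM2r ?nc_gt0 //; lra.
have gc z : in_rect x1 x2 y1 y2 z -> ccont g z.
  move=> zr; have [->|za] := eqVneq z a; last by have [m] := gd z zr za; exact: cder_ccont.
  by rewrite /ccont {2}/g eqxx; exact: ga.
have [d d0 gl] := ga 1 ltr01.
(* Half-sides [e <= s] keep the central square inside the given one and, since [2 e < d], inside the
   disc where [g] is within 1 of [l]. *)
pose s := Num.min (d / 4) (Num.min (Num.min (x2 - complex.Re a) (complex.Re a - x1))
  (Num.min (y2 - complex.Im a) (complex.Im a - y1))).
have s0 : 0 < s by rewrite /s /x1 /x2 /y1 /y2 !lt_min; lra.
have small e : 0 < e -> e <= s -> nc (rectint g x1 x2 y1 y2) <= 16 * (nc l + 1) * e.
  move=> e0; rewrite /s !le_min => /andP[ed /andP[/andP[e2 e1] /andP[e4 e3]]].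
  set u1 := complex.Re a - e; set u2 := complex.Re a + e.
  set v1 := complex.Im a - e; set v2 := complex.Im a + e.
  have [a1 a2 a3] : [/\ x1 <= u1, u1 <= u2 & u2 <= x2] by rewrite /u1 /u2; split; lra.
  have [b1 b2 b3] : [/\ y1 <= v1, v1 <= v2 & v2 <= y2] by rewrite /v1 /v2; split; lra.
  have sub X1 X2 Y1 Y2 : x1 <= X1 -> X2 <= x2 -> y1 <= Y1 -> Y2 <= y2 ->
      forall z, in_rect X1 X2 Y1 Y2 z -> in_rect x1 x2 y1 y2 z.
    by move=> ? ? ? ? z; rewrite /in_rect; lra.
  have subc X1 X2 Y1 Y2 : x1 <= X1 -> X2 <= x2 -> y1 <= Y1 -> Y2 <= y2 ->
      forall z, in_rect X1 X2 Y1 Y2 z -> ccont g z.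
    by move=> ? ? ? ? z zr; apply: gc; apply: sub zr.
  have zero X1 X2 Y1 Y2 : x1 <= X1 -> X1 <= X2 -> X2 <= x2 -> y1 <= Y1 -> Y1 <= Y2 ->
      Y2 <= y2 -> ~~ in_rect X1 X2 Y1 Y2 a -> rectint g X1 X2 Y1 Y2 = 0.
    move=> h1 h2 h3 k1 k2 k3 na; apply: goursat => // z zr.
    apply: gd; first exact: sub zr.
    by apply: contraNneq na => <-.
  rewrite (@rectint_cutx _ g x1 u1) //; last by lra.
  rewrite [X in X + _]zero ?add0r //; [|lra|rewrite /in_rect /u1; lra].
  rewrite (@rectint_cutx _ g u1 u2) //; last by apply: subc => //; lra.
  rewrite [X in _ + X]zero ?addr0 //; [|lra|rewrite /in_rect /u2; lra].
  rewrite (@rectint_cuty _ g u1 u2 y1 v1) //; [|lra|by apply: subc => //; lra].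
  rewrite [X in X + _]zero ?add0r //; [|lra|rewrite /in_rect /v1; lra].
  rewrite (@rectint_cuty _ g u1 u2 v1 v2) //; last by apply: subc => //; lra.
  rewrite [X in _ + X]zero ?addr0 //; [|lra|rewrite /in_rect /v2; lra].
  have -> : 16 * (nc l + 1) * e = 4 * (nc l + 1) * (u2 - u1 + (v2 - v1)).
    by rewrite /u1 /u2 /v1 /v2; ring.
  apply: rectint_le => // z /andP[zr _]; first by apply: gc; apply: sub zr => //; lra.
  have -> : g z = l + (g z - l) by ring.
  apply: le_trans (ncD _ _) _; rewrite lerD2l; apply/ltW/gl.
  by have := @in_sq_nc a e z zr; lra.
apply/eqP; rewrite -nc_eq0; apply/eqP/le_anti; rewrite nc_ge0 andbT leNgt.
apply/negP => J0; set J := nc _ in J0 small.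
have k0 : 0 < 16 * (nc l + 1) by have := nc_ge0 l; lra.
set m := Num.min s (J / (2 * (16 * (nc l + 1)))).
have m0 : 0 < m by rewrite lt_min s0 divr_gt0 // mulr_gt0.
have ms : m <= s by rewrite ge_min lexx.
have := small m m0 ms; rewrite leNgt => /negP; apply.
apply: (@le_lt_trans _ _ (16 * (nc l + 1) * (J / (2 * (16 * (nc l + 1)))))).
  by rewrite ler_pM2l // ge_min lexx orbT.
have -> : 16 * (nc l + 1) * (J / (2 * (16 * (nc l + 1)))) = J / 2.
  by field; rewrite gt_eqF //; have := nc_ge0 l; lra.
lra.
Qed.

Lemma bd_sq_neq a0 a r z : 0 < r -> nc (a - a0) < r -> bd_sq a0 r z -> z != a.
Proof.
move=> r0 ar zb; apply/eqP => za.
by have := bd_sq_nc r0 zb; rewrite za leNgt ar.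
Qed.

Lemma sqint_le f (M : R) a r : 0 < r ->
  (forall z, bd_sq a r z -> exists l, cder f z l) ->
  (forall z, bd_sq a r z -> nc (f z) <= M) -> nc (sqint f a r) <= 16 * M * r.
Proof.
move=> r0 fd fM.
have -> : 16 * M * r = 4 * M * ((complex.Re a + r) - (complex.Re a - r) +
  ((complex.Im a + r) - (complex.Im a - r))) by ring.
apply: rectint_le => //; try lra.
by move=> z /fd[l]; exact: cder_ccont.
Qed.

Lemma sqintD f g a r : 0 < r ->
  (forall z, bd_sq a r z -> exists l, cder f z l) ->
  (forall z, bd_sq a r z -> exists l, cder g z l) ->
  sqint (fun z => f z + g z) a r = sqint f a r + sqint g a r.
Proof.
move=> r0 fd gd; apply: rectintD; try lra; move=> z zb.
  by have [l] := fd z zb; exact: cder_ccont.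
by have [l] := gd z zb; exact: cder_ccont.
Qed.

Lemma sqintZ (k : C) f a r : 0 < r ->
  (forall z, bd_sq a r z -> exists l, cder f z l) ->
  sqint (fun z => k * f z) a r = k * sqint f a r.
Proof.
move=> r0 fd; apply: rectintZ; try lra; move=> z zb.
by have [l] := fd z zb; exact: cder_ccont.
Qed.

Lemma eq_sqint f g a r : 0 < r -> (forall z, bd_sq a r z -> f z = g z) ->
  sqint f a r = sqint g a r.
Proof. by move=> r0 H; apply: eq_rectint => //; lra. Qed.

Lemma ex_cderM f g z : (exists l, cder f z l) -> (exists l, cder g z l) ->
  exists l, cder (fun w => f w * g w) z l.
Proof. by move=> [l fl] [m gm]; eexists; exact: cderM fl gm. Qed.

(** Without the factor [1 / (2 i pi)]: the integral of the constant 1 with [n = 1] plays the role of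
    [2 i pi]. *)
Definition cauchyint f a0 r n a := sqint (fun z => f z * (z - a) ^- n) a0 r.

(** Split the quotient [(f z - f a) / (z - a)], whose integral vanishes. The integral of the bare
    kernel is kept as a function of [a] instead of being evaluated. *)
Lemma cauchy_formula f a0 a r : 0 < r -> nc (a - a0) < r ->
  (forall z, in_sq a0 r z -> exists l, cder f z l) ->
  f a * cauchyint (fun=> 1) a0 r 1 a = cauchyint f a0 r 1 a.
Proof.
move=> r0 ar fd; rewrite /cauchyint.
have fb z : bd_sq a0 r z -> exists l, cder f z l by case/andP => /fd.
have kd z : bd_sq a0 r z -> exists l, cder (fun w => (w - a) ^- 1) z l.
  by move=> zb; apply: cder_kernel; exact: bd_sq_neq zb.
have cd k z : bd_sq a0 r z -> exists l, cder (fun w => k * (w - a) ^- 1) z l.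
  by move=> /kd[l hl]; eexists; apply: cderZ hl.
have /esym := sqint_quotient r0 ar fd.
rewrite (@eq_sqint _ (fun z => f z * (z - a) ^- 1 + (- f a) * (1 * (z - a) ^- 1))) //; last first.
  by move=> z _; rewrite expr1; ring.
rewrite sqintD //; first last.
- by move=> z zb; have [l hl] := cd 1 z zb; eexists; apply: cderZ hl.
- by move=> z zb; apply: ex_cderM; [exact: fb|exact: kd].
rewrite (sqintZ (- f a) r0 (cd 1)).
by move=> /eqP; rewrite mulNr eq_sym subr_eq0 => /eqP <-.
Qed.

(** On each side the integrand, multiplied by the direction of that side, has imaginary part
    [r / (r ^ 2 + t ^ 2) >= 1 / (2 r)], so a side of length [2 r] contributes at least 1. *)
Lemma cauchyint1_center a r : 0 < r -> 4 <= complex.Im (cauchyint (fun=> 1) a r 1 a).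
Proof.
move=> r0; pose f z : C := 1 * (z - a) ^- 1.
rewrite -[cauchyint _ _ _ _ _]/(sqint f a r) /sqint /rectint.
have fc z : bd_sq a r z -> ccont f z.
  move=> zb; have [|l hl] := @cder_kernel a z 1; last first.
    by apply: (@cder_ccont _ _ _ (1 * l)); apply: cderZ.
  by apply: (@bd_sq_neq a a r) => //; rewrite subrr nc0.
have xx : complex.Re a - r <= complex.Re a + r by lra.
have yy : complex.Im a - r <= complex.Im a + r by lra.
have [h1 h2 h3 h4] := bdry_pcont xx yy fc.
have fE u v : f (u +i* v) = ((u - complex.Re a) +i* (v - complex.Im a))^-1.
  by rewrite /f mul1r expr1; case: (a) => p q; simpc.
have r20 : 0 < r ^+ 2 by rewrite exprn_gt0.
have key (t : R) : - r <= t <= r -> (2 * r)^-1 <= r / (r ^+ 2 + t ^+ 2).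
  move=> /andP[t1 t2].
  have p : 0 < r ^+ 2 + t ^+ 2 by rewrite ltr_pwDl ?sqr_ge0.
  rewrite ler_pdivlMr // -(ler_pM2l (mulr_gt0 (ltr0n R 2) r0)) mulrA mulfV ?mul1r; last first.
    by rewrite gt_eqF // mulr_gt0.
  nra.
have bound (k : C) (g : R -> C) c : pcont g (c - r) (c + r) ->
    (forall t, c - r <= t <= c + r -> complex.Im (k * g t) = r / (r ^+ 2 + (t - c) ^+ 2)) ->
    1 <= complex.Im (k * cint g (c - r) (c + r)).
  move=> gc gE; rewrite -cintZ //.
  have kc : pcont (fun x => k * g x) (c - r) (c + r).
    move=> x xr e e0; have k0 : 0 < 1 + nc k by rewrite ltr_pwDl ?nc_ge0.
    have [d d0 H] := gc x xr (e / (1 + nc k)) (divr_gt0 e0 k0).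
    exists d => // y /H; rewrite ltr_pdivlMr // -mulrBr ncM; apply: le_lt_trans.
    by rewrite mulrC ler_wpM2l ?nc_ge0 // lerDr.
  have -> : 1 = (2 * r)^-1 * ((c + r) - (c - r)) :> R by field; rewrite gt_eqF.
  apply: Im_cint_ge => //; first by lra.
  by move=> t ht; rewrite gE // key //; lra.
(* The factors 1, -1, ['i] and [- 'i] are the directions of the four sides, so that [bound] applies
   to each term. *)
have -> : forall p q s u : C, complex.Im (p - q + 'i * (s - u)) =
   complex.Im (1 * p) + complex.Im (-1 * q) + (complex.Im ('i * s) + complex.Im (- 'i * u)).
  move=> [p1 p2] [q1 q2] [s1 s2] [u1 u2] /=; ring.
have -> : 4 = (1 + 1) + (1 + 1) :> R by ring.
apply: lerD; apply: lerD; apply: bound => // t ht; rewrite fE /=.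
- have p : (t - complex.Re a) ^+ 2 + r ^+ 2 != 0.
    by rewrite gt_eqF // ltr_wpDl ?sqr_ge0.
  have e1 : complex.Im a - r - complex.Im a = - r by ring.
  by rewrite e1 ?sqrrN [r ^+ 2 + _]addrC; set D := _ + r ^+ 2 in p *; clearbody D; field.
- have p : (t - complex.Re a) ^+ 2 + r ^+ 2 != 0.
    by rewrite gt_eqF // ltr_wpDl ?sqr_ge0.
  have e1 : complex.Im a + r - complex.Im a = r by ring.
  by rewrite e1 ?sqrrN [r ^+ 2 + _]addrC; set D := _ + r ^+ 2 in p *; clearbody D; field.
- have p : (t - complex.Im a) ^+ 2 + r ^+ 2 != 0.
    by rewrite gt_eqF // ltr_wpDl ?sqr_ge0.
  have e1 : complex.Re a + r - complex.Re a = r by ring.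
  by rewrite e1 ?sqrrN [r ^+ 2 + _]addrC; set D := _ + r ^+ 2 in p *; clearbody D; field.
- have p : (t - complex.Im a) ^+ 2 + r ^+ 2 != 0.
    by rewrite gt_eqF // ltr_wpDl ?sqr_ge0.
  have e1 : complex.Re a - r - complex.Re a = - r by ring.
  by rewrite e1 ?sqrrN [r ^+ 2 + _]addrC; set D := _ + r ^+ 2 in p *; clearbody D; field.
Qed.

Lemma cauchyint1_center_gt0 a r : 0 < r -> 4 <= nc (cauchyint (fun=> 1) a r 1 a).
Proof.
move=> r0; apply: le_trans (cauchyint1_center a r0) _.
exact: le_trans (ler_norm _) (Im_le_nc _).
Qed.

End Cauchy.

(** * Differentiating Cauchy integrals *)

Section CauchyConsequences.
Variable R : realType.
Local Notation C := R[i].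
Implicit Types (f g : C -> C) (x y r : R) (z w a : C).

Lemma pcont_bounded (g : R -> C) (a b : R) : a <= b -> pcont g a b ->
  exists M, forall x, a <= x <= b -> nc (g x) <= M.
Proof.
move=> ab gc.
have [|c _ H] := @EVT_max R (fun x => nc (g x)) a b ab.
  apply: continuous_in_subspaceT => x; rewrite inE /= in_itv /= => xab.
  apply/cvgrPdist_lt => e e0; have [d d0 H] := gc x xab e e0.
  apply/nbhs_ballP; exists d => //= y; rewrite /ball /= distrC => /H; apply: le_lt_trans.
  have h u v : nc u - nc v <= nc (u - v) :> R.
    by rewrite lerBlDr -[u in X in X <= _](subrK v); exact: ncD.
  by rewrite ler_norml; apply/andP; split;
    [rewrite lerNl opprB; exact: h|rewrite ncBC; exact: h].
by exists (nc (g c)) => x xab; apply: H; rewrite in_itv.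
Qed.

Lemma bd_sq_bounded f a r : 0 < r ->
  (forall z, bd_sq a r z -> exists l, cder f z l) ->
  exists2 M, 0 <= M & forall z, bd_sq a r z -> nc (f z) <= M.
Proof.
move=> r0 fd.
have fc z : bd_sq a r z -> ccont f z by move=> /fd[l]; exact: cder_ccont.
have xx : complex.Re a - r <= complex.Re a + r by lra.
have yy : complex.Im a - r <= complex.Im a + r by lra.
have [h1 h2 h3 h4] := bdry_pcont xx yy fc.
have [M1 H1] := pcont_bounded xx h1; have [M2 H2] := pcont_bounded xx h2.
have [M3 H3] := pcont_bounded yy h3; have [M4 H4] := pcont_bounded yy h4.
exists (`|M1| + `|M2| + `|M3| + `|M4|); first by rewrite !addr_ge0.
move=> [u v] /andP[/andP[/= hu hv]].
have := ler_norm M1; have := ler_norm M2; have := ler_norm M3; have := ler_norm M4.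
have := normr_ge0 M1; have := normr_ge0 M2; have := normr_ge0 M3; have := normr_ge0 M4.
move=> ? ? ? ? ? ? ? ? /or4P[] /eqP E.
- by have := H4 v hv; rewrite -E => h; apply: le_trans h _; lra.
- by have := H3 v hv; rewrite -E => h; apply: le_trans h _; lra.
- by have := H1 u hu; rewrite -E => h; apply: le_trans h _; lra.
- by have := H2 u hu; rewrite -E => h; apply: le_trans h _; lra.
Qed.

(** First-order Taylor remainder of [(u - h) ^- n] at [h = 0]. *)
Definition kernel_rem n (u h : C) : C := (u - h) ^- n - u ^- n - n%:R * h * u ^- n.+1.

(** The remainder for [n = 1] is exactly [h ^ 2 / (u ^ 2 (u - h))], and the case [n = 2] reduces to
    it. As [nc (u - h) >= rho / 2], the constants are [7 / 2 = 2 + 1 + 1 / 2] and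
    [8 = 7 / 2 * 2 + 1]. *)
Lemma kernel_rem_le n (rho : R) : (n = 1 \/ n = 2)%N -> 0 < rho ->
  exists2 B, 0 <= B & forall u h : C, rho <= nc u -> nc h <= rho / 2 ->
  nc (kernel_rem n u h) <= B * nc h ^+ 2.
Proof.
move=> n12 p0.
have aux (u h : C) : rho <= nc u -> nc h <= rho / 2 ->
  [/\ u != 0, u - h != 0, nc u^-1 <= rho^-1 & nc (u - h)^-1 <= 2 * rho^-1].
  move=> up hp.
  have u0 : 0 < nc u by exact: lt_le_trans up.
  have uh : rho / 2 <= nc (u - h).
    have := ncD (u - h) h; rewrite subrK; lra.
  have uh0 : 0 < nc (u - h) by apply: lt_le_trans uh; lra.
  split; [by rewrite -nc_gt0|by rewrite -nc_gt0| |].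
    by rewrite ncV lef_pV2.
  have -> : 2 * rho^-1 = (rho / 2)^-1 by rewrite invfM invrK mulrC.
  by rewrite ncV lef_pV2 // posrE; lra.
have i0 : 0 <= rho^-1 by rewrite invr_ge0 ltW.
have E1 u h : rho <= nc u -> nc h <= rho / 2 ->
    nc (kernel_rem 1 u h) <= 2 * rho^-1 ^+ 3 * nc h ^+ 2.
  move=> up hp; have [u0 uh0 b1 b2] := aux u h up hp.
  have -> : kernel_rem 1 u h = u^-1 ^+ 2 * (u - h)^-1 * h ^+ 2.
    by rewrite /kernel_rem; field; rewrite u0 uh0.
  rewrite [nc (_ * h ^+ 2)]ncM [nc (_ * (u - h)^-1)]ncM !ncX ler_wpM2r ?sqr_ge0 //.
  have -> : 2 * rho^-1 ^+ 3 = rho^-1 ^+ 2 * (2 * rho^-1) by ring.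
  by apply: ler_pM; rewrite ?exprn_ge0 ?nc_ge0 // lerXn2r ?nnegrE ?nc_ge0.
case: n12 => ->.
  by exists (2 * rho^-1 ^+ 3) => //; rewrite mulr_ge0 ?exprn_ge0.
exists (8 * rho^-1 ^+ 4); first by rewrite mulr_ge0 ?exprn_ge0.
move=> u h up hp; have [u0 uh0 b1 b2] := aux u h up hp.
have -> : kernel_rem 2 u h = ((u - h)^-1 + (u^-1 + h * (u^-1) ^+ 2)) * kernel_rem 1 u h +
    (u^-1) ^+ 4 * h ^+ 2.
  by rewrite /kernel_rem; field; rewrite u0 uh0.
apply: le_trans (ncD _ _) _; rewrite [nc (_ * kernel_rem _ _ _)]ncM [nc (_ * h ^+ 2)]ncM !ncX.
have b3 : nc ((u - h)^-1 + (u^-1 + h * (u^-1) ^+ 2)) <= 7 / 2 * rho^-1.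
  apply: le_trans (ncD _ _) _.
  have -> : 7 / 2 * rho^-1 = 2 * rho^-1 + (rho^-1 + rho / 2 * rho^-1 ^+ 2).
    by field; rewrite gt_eqF.
  apply: lerD => //; apply: le_trans (ncD _ _) _; apply: lerD => //.
  rewrite ncM ncX; apply: ler_pM; rewrite ?exprn_ge0 ?nc_ge0 //.
  by rewrite lerXn2r ?nnegrE ?nc_ge0.
have b4 : nc u^-1 ^+ 4 <= rho^-1 ^+ 4 by rewrite lerXn2r ?nnegrE ?nc_ge0.
have -> : 8 * rho^-1 ^+ 4 * nc h ^+ 2 =
  7 / 2 * rho^-1 * (2 * rho^-1 ^+ 3 * nc h ^+ 2) + rho^-1 ^+ 4 * nc h ^+ 2 by field; rewrite gt_eqF.
apply: lerD; last by rewrite ler_wpM2r ?sqr_ge0.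
by apply: ler_pM; rewrite ?nc_ge0 //; exact: E1.
Qed.

(** Differentiation under the integral sign: the error is the integral of
    [f z * kernel_rem n (z - a) h], quadratic in [h] uniformly on the boundary. The exponents 1 and
    2 are those met when Cauchy's formula is differentiated twice. *)
Lemma cder_cauchyint f a0 r n a : (n = 1 \/ n = 2)%N -> 0 < r -> nc (a - a0) < r ->
  (forall z, bd_sq a0 r z -> exists l, cder f z l) ->
  cder (cauchyint f a0 r n) a (n%:R * cauchyint f a0 r n.+1 a).
Proof.
move=> n12 r0 ar fd e e0.
have [M M0 fM] := bd_sq_bounded r0 fd.
set rho := r - nc (a - a0).
have p0 : 0 < rho by rewrite subr_gt0.
have [B B0 HB] := kernel_rem_le n12 p0.
have K0 : 0 < 16 * (M * B) * r + 1 by rewrite ltr_wpDl // !mulr_ge0 // ltW.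
(* [rho / 2] keeps [a + h] off the boundary and within the range of [kernel_rem_le]; the second
   bound turns the quadratic error into [e * nc h]. *)
exists (Num.min (rho / 2) (e / (16 * (M * B) * r + 1))).
  by rewrite lt_min !divr_gt0.
move=> h; rewrite lt_min => /andP[h1 h2].
have bz z : bd_sq a0 r z -> rho <= nc (z - a).
  move=> /(bd_sq_nc r0) zb; have -> : z - a = (z - a0) - (a - a0) by ring.
  rewrite /rho; have := ncD (z - a0 - (a - a0)) (a - a0); rewrite subrK; lra.
have za z : bd_sq a0 r z -> z != a by exact: bd_sq_neq.
have zah z : bd_sq a0 r z -> z != a + h.
  apply: bd_sq_neq => //; rewrite addrAC; apply: le_lt_trans (ncD _ _) _.
  rewrite /rho in h1; have := nc_ge0 h; lra.
have k1 m z : bd_sq a0 r z -> exists l, cder (fun w => f w * (w - a) ^- m) z l.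
  by move=> zb; apply: ex_cderM; [exact: fd|apply: cder_kernel; exact: za].
have k2 m z : bd_sq a0 r z -> exists l, cder (fun w => f w * (w - (a + h)) ^- m) z l.
  by move=> zb; apply: ex_cderM; [exact: fd|apply: cder_kernel; exact: zah].
have exZ k g z : (exists l, cder g z l) -> exists l, cder (fun w => k * g w) z l.
  by move=> [l gl]; eexists; apply: cderZ gl.
have exD g1 g2 z : (exists l, cder g1 z l) -> (exists l, cder g2 z l) ->
    exists l, cder (fun w => g1 w + g2 w) z l.
  by move=> [l gl] [m gm]; eexists; exact: cderD gl gm.
have E z : f z * (z - (a + h)) ^- n + ((-1) * (f z * (z - a) ^- n) +
    (- (n%:R * h)) * (f z * (z - a) ^- n.+1)) = f z * kernel_rem n (z - a) h.
  have e1 : z - a - h = z - (a + h) by ring.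
  by rewrite /kernel_rem e1; ring.
have -> : cauchyint f a0 r n (a + h) - cauchyint f a0 r n a -
    n%:R * cauchyint f a0 r n.+1 a * h = sqint (fun z => f z * kernel_rem n (z - a) h) a0 r.
  rewrite -(funext E) sqintD //; first last.
  - by move=> z zb; apply: exD; apply: exZ; exact: k1.
  - by move=> z zb; exact: k2.
  rewrite sqintD //; first last.
  - by move=> z zb; apply: exZ; exact: k1.
  - by move=> z zb; apply: exZ; exact: k1.
  rewrite (sqintZ (-1) r0 (k1 n)) (sqintZ (- (n%:R * h)) r0 (k1 n.+1)) /cauchyint.
  move: (sqint _ _ _) (sqint _ _ _) (sqint _ _ _) => I1 I2 I3; ring.
apply: (@le_trans _ _ (16 * (M * (B * nc h ^+ 2)) * r)).
  apply: sqint_le => // z zb.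
    rewrite -(funext E); apply: (exD); first exact: k2.
    by apply: exD; apply: exZ; exact: k1.
  rewrite ncM; apply: ler_pM; rewrite ?nc_ge0 //; first exact: fM.
  by apply: HB; [exact: bz|exact: ltW].
have -> : 16 * (M * (B * nc h ^+ 2)) * r = (16 * (M * B) * r) * nc h * nc h by ring.
apply: ler_wpM2r; first exact: nc_ge0.
rewrite ltr_pdivlMr // in h2; apply: ltW; apply: le_lt_trans h2.
by rewrite mulrC ler_wpM2l ?nc_ge0 // lerDl.
Qed.

(* In Cauchy's formula [f a * oint dz / (z - a) = oint f z / (z - a) dz] both
   integrals are twice differentiable in [a]. *)
Theorem cder_deriv f f' a0 (rho : R) : 0 < rho ->
  (forall z, nc (z - a0) < rho -> cder f z (f' z)) -> exists l, cder f' a0 l.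
Proof.
move=> p0 fd; pose r := rho / 4.
have r0 : 0 < r by rewrite /r; lra.
have fin z : in_sq a0 r z -> exists l, cder f z l.
  move=> /in_sq_nc zr; exists (f' z); apply: fd; rewrite /r in zr; lra.
have fb z : bd_sq a0 r z -> exists l, cder f z l by case/andP => /fin.
have ob z : bd_sq a0 r z -> exists l, cder (fun=> 1) z l.
  by move=> _; exists 0; exact: cder_cst.
pose om := cauchyint (fun=> 1) a0 r; pose N := cauchyint f a0 r.
have near0 : nc (a0 - a0) < r by rewrite subrr nc0.
have om0 : 0 < nc (om 1%N a0).
  by apply: lt_le_trans (cauchyint1_center_gt0 a0 r0); rewrite ltr0n.
have [d d0 hd] := cder_cont (cder_cauchyint (or_introl (erefl _)) r0 near0 ob) om0.
have om_neq a : nc (a - a0) < d -> om 1%N a != 0.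
  move=> /hd; rewrite -/(om 1%N) => h; apply: contraTneq h => ->.
  by rewrite sub0r ncN ltxx.
have [l1 N2d] : exists l, cder (N 2%N) a0 l.
  by eexists; exact: (cder_cauchyint (or_intror (erefl _)) r0 near0 fb).
have [l2 o2d] : exists l, cder (om 2%N) a0 l.
  by eexists; exact: (cder_cauchyint (or_intror (erefl _)) r0 near0 ob).
have o1d := cder_cauchyint (or_introl (erefl _)) r0 near0 ob.
have fd0 : cder f a0 (f' a0) by apply: fd; rewrite subrr nc0.
(* Differentiating [f * om 1 = N 1] once gives [f' = (N 2 - f * om 2) / om 1] near [a0], and this
   right-hand side is differentiable at [a0]. *)
have := cderM (cderB N2d (cderM fd0 o2d)) (cderV (om_neq _ _) o1d).
rewrite subrr nc0 => /(_ d0) H; eexists.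
apply: (@cder_eq _ _ _ _ _ (Num.min d r)) H; first by rewrite lt_min d0.
move=> a; rewrite lt_min => /andP[ad ar].
have oa := om_neq a ad; apply: (mulIf oa); rewrite mulfVK //.
have arho : nc (a - a0) < rho by rewrite /r in ar; lra.
have pd := cderM (fd a arho) (cder_cauchyint (or_introl (erefl _)) r0 ar ob).
have nd := cder_cauchyint (or_introl (erefl _)) r0 ar fb.
have [e e0 he] : exists2 e : R, 0 < e & forall w, nc (w - a) < e -> nc (w - a0) < r.
  exists (r - nc (a - a0)); first by rewrite subr_gt0.
  move=> w; have := ncD (w - a) (a - a0); rewrite addrA subrK; lra.
have pd' := cder_eq e0 (fun w hw => cauchy_formula r0 (he w hw) fin) pd.
have := cder_unique pd' nd; rewrite !mul1r -/(om 2%N a) -/(om 1%N a) -/(N 2%N a) => <-.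
ring.
Qed.

End CauchyConsequences.

(** * The identity theorem in one variable *)

Section Identity.
Variable R : realType.
Local Notation C := R[i].
Implicit Types (f g : C -> C) (x y r : R) (z w a q : C).

(* Divide [f] by high powers of [z - q] and apply Cauchy's formula at [a]. *)
Lemma local_identity f a q (rho eta : R) : 0 < rho -> 0 < eta ->
  (forall z, nc (z - a) < rho -> exists l, cder f z l) ->
  (forall z, nc (z - q) < eta -> f z = 0) -> nc (a - q) < rho / 16 -> f a = 0.
Proof.
move=> p0 e0 fd fq aq; have [->|naq] := eqVneq a q.
  by apply: fq; rewrite subrr nc0.
(* The square of half-side [rho / 4] fits in the disc. Then [nc (a - q) < r / 4], while boundary
   points are at distance at least [r / 2] from [q], so dividing by [(z - q) ^+ k] gains a factor
   [2 ^ k]. *)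
pose r := rho / 4; have r0 : 0 < r by rewrite /r; lra.
have {}fd z : in_sq a r z -> exists l, cder f z l.
  by move=> /in_sq_nc zr; apply: fd; rewrite /r in zr; lra.
pose g k z := f z * (z - q) ^- k.
have gd k z : in_sq a r z -> exists l, cder (g k) z l.
  (* At [q] itself the quotient is differentiable because [f] vanishes in a neighbourhood. *)
  move=> /fd fz; have [->|zq] := eqVneq z q.
    exists 0; apply: cder_eq e0 _ (cder_cst 0 q) => w /fq fw.
    by rewrite /g fw mul0r.
  by apply: ex_cderM fz _; exact: cder_kernel.
have bnd z : bd_sq a r z -> [/\ r <= nc (z - a), r / 2 <= nc (z - q) & z != q].
  move=> zb; have h1 := bd_sq_nc r0 zb.
  have h2 : r / 2 <= nc (z - q).
    have := ncD (z - q) (q - a); rewrite addrA subrK [nc (q - a)]ncBC /r in h1 aq *; lra.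
  by split=> //; rewrite -subr_eq0 -nc_gt0; apply: lt_le_trans h2; lra.
have fb z : bd_sq a r z -> exists l, cder f z l by case/andP => /fd.
have [M M0 fM] := bd_sq_bounded r0 fb.
have naa : nc (a - a) < r by rewrite subrr nc0.
have key k : nc (f a) * 4 <= 16 * M * (nc (a - q) / (r / 2)) ^+ k.
  have := cauchy_formula r0 naa (gd k).
  have om := cauchyint1_center_gt0 a r0.
  move=> /(congr1 (@nc R)); rewrite ncM => E.
  have le1 : nc (cauchyint (g k) a r 1 a) <= 16 * (M * (r / 2) ^- k * r^-1) * r.
    apply: sqint_le => // z zb; have [h1 h2 h3] := bnd z zb.
      apply: ex_cderM; first by apply: gd; case/andP: zb.
      by apply: cder_kernel; rewrite -subr_eq0 -nc_gt0; exact: lt_le_trans h1.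
    rewrite /g [nc (_ * (z - a) ^- 1)]ncM [nc (f z * _)]ncM !ncV !ncX expr1.
    have rh : 0 < r / 2 by lra.
    apply: ler_pM; rewrite ?mulr_ge0 ?invr_ge0 ?exprn_ge0 ?nc_ge0 //; last first.
      by rewrite lef_pV2 // posrE; exact: lt_le_trans h1.
    apply: ler_pM; rewrite ?invr_ge0 ?exprn_ge0 ?nc_ge0 //; first exact: fM.
    rewrite lef_pV2 ?posrE ?exprn_gt0 //; last exact: lt_le_trans h2.
    by rewrite lerXn2r ?nnegrE ?nc_ge0 // ltW.
  have aq0 : 0 < nc (a - q) by rewrite nc_gt0 subr_eq0.
  have fa : nc (f a) = nc (g k a) * nc (a - q) ^+ k.
    by rewrite /g ncM ncV ncX mulfVK // expf_neq0 // gt_eqF.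
  rewrite fa mulrAC expr_div_n mulrA [X in _ <= X]mulrAC ler_wpM2r ?exprn_ge0 ?nc_ge0 //.
  apply: (@le_trans _ _ (nc (g k a) * nc (cauchyint (fun=> 1) a r 1 a))).
    by rewrite ler_wpM2l ?nc_ge0.
  rewrite E; apply: le_trans le1 _; rewrite le_eqVlt; apply/orP; left; apply/eqP.
  by field; rewrite !gt_eqF // exprn_gt0 //; lra.
apply/eqP; rewrite -nc_eq0; apply/eqP/le_anti; rewrite nc_ge0 andbT leNgt; apply/negP => f0.
pose t := nc (a - q) / (r / 2).
have t0 : 0 <= t by rewrite divr_ge0 ?nc_ge0 //; lra.
have t1 : t <= 1 / 2 by rewrite ler_pdivrMr; rewrite /r in aq *; lra.
have pw k : t ^+ k <= 2 ^- k.
  by rewrite -exprVn lerXn2r ?nnegrE //; lra.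
have M1 : 0 < 16 * M + 1 by lra.
pose k := (Num.truncn ((16 * M + 1) / (nc (f a) * 4))).+1.
have hk : (16 * M + 1) / (nc (f a) * 4) < 2 ^+ k.
  apply: lt_trans (truncnS_gt _) _.
  by rewrite -natrX ltr_nat ltn_expl.
have := key k; rewrite -/t leNgt => /negP; apply.
apply: (@le_lt_trans _ _ ((16 * M + 1) * 2 ^- k)).
  apply: ler_pM; rewrite ?exprn_ge0 //; lra.
have f4 : 0 < nc (f a) * 4 by rewrite mulr_gt0.
by rewrite ltr_pdivrMr ?exprn_gt0 // [X in _ < X]mulrC -ltr_pdivrMr.
Qed.

(* March from [q] to [p] along a segment, with steps of uniform size. *)
Lemma disc_identity f q p (rho eta : R) : 0 < eta -> nc q < rho -> nc p < rho ->
  (forall z, nc z < rho -> exists l, cder f z l) ->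
  (forall z, nc (z - q) < eta -> f z = 0) -> f p = 0.
Proof.
move=> e0 qr pr fd fq.
pose s := Num.max (nc q) (nc p); have sr : s < rho by rewrite /s gt_max qr pr.
pose d := rho - s; have d0 : 0 < d by rewrite subr_gt0.
(* A step and a radius of [d / 64] add up to [(d / 2) / 16], the distance that [local_identity]
   bridges on discs of radius [d / 2]. *)
have dp : 0 < d / 64 by lra.
pose N := (Num.truncn (nc (p - q) / (d / 64))).+1.
have N0 : 0 < N%:R :> R by rewrite ltr0n.
have hN : nc (p - q) / N%:R < d / 64.
  by rewrite ltr_pdivrMr // mulrC -ltr_pdivrMr //; exact: truncnS_gt.
pose z (k : nat) : C := q + (k%:R / N%:R) * (p - q).
have zin k : (k <= N)%N -> nc (z k) <= s.
  move=> kN; have k1 : k%:R / N%:R <= 1 :> R by rewrite ler_pdivrMr // mul1r ler_nat.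
  have k0 : 0 <= k%:R / N%:R :> R by rewrite divr_ge0.
  have -> : z k = (1 - k%:R / N%:R)%:C * q + (k%:R / N%:R)%:C * p.
    by rewrite /z !rmorphB rmorph1 !rmorphM /= fmorphV /= !rmorph_nat; ring.
  apply: le_trans (ncD _ _) _; rewrite !ncM !ncC ger0_norm ?subr_ge0 // ger0_norm //.
  have h1 : nc q <= s by rewrite /s le_max lexx.
  have h2 : nc p <= s by rewrite /s le_max lexx orbT.
  have -> : s = (1 - k%:R / N%:R) * s + (k%:R / N%:R) * s by ring.
  by apply: lerD; rewrite ler_wpM2l // subr_ge0.
have zs k : nc (z k.+1 - z k) < d / 64.
  have -> : z k.+1 - z k = (N%:R^-1)%:C * (p - q).
    by rewrite /z fmorphV /= rmorph_nat -natr1; ring.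
  by rewrite ncM ncC ger0_norm ?invr_ge0 // mulrC.
have claim k : (k <= N)%N -> exists2 eps : R, 0 < eps & forall w, nc (w - z k) < eps -> f w = 0.
  elim: k => [_|k IH kN].
    by exists eta => // w; rewrite /z mul0r mul0r addr0; exact: fq.
  have [eps eps0 H] := IH (ltnW kN).
  exists (d / 64) => // w wz; apply: (@local_identity _ w (z k) (d / 2) eps) => //.
  - by lra.
  - move=> v vw; apply: fd.
    have h1 := ncD (v - w) (w - z k.+1); have h2 := ncD (v - z k.+1) (z k.+1).
    have h3 := zin k.+1 kN; rewrite addrA subrK in h1; rewrite subrK in h2.
    rewrite /d in d0 wz vw *; lra.
  - have h1 := ncD (w - z k.+1) (z k.+1 - z k); rewrite addrA subrK in h1.
    by have := zs k; lra.
have [eps eps0 H] := claim N (leqnn N).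
apply: H; have -> : p - z N = 0; last by rewrite nc0.
by rewrite /z divff ?mul1r ?pnatr_eq0 //; ring.
Qed.

Lemma upper_identity g (rho : R) : 0 < rho ->
  (forall z, nc z < rho -> exists l, cder g z l) ->
  (forall x, `|x| < rho -> g x%:C = 0) ->
  forall z, nc z < rho -> 0 <= complex.Im z -> g z = 0.
Proof.
move=> r0 gd gx z zr z0.
(* Since [g] vanishes on the real axis, so does [g'] there, and extending by 0
   below the axis keeps complex differentiability. *)
pose h w := if 0 <= complex.Im w then g w else 0.
suff : h z = 0 by rewrite /h z0.
have hd w : nc w < rho -> exists l, cder h w l.
  move=> wr; have [w0|w0|w0] := ltgtP (complex.Im w) 0.
  - exists 0; apply: (@cder_eq _ (fun=> 0) _ _ _ (- complex.Im w)); first by rewrite oppr_gt0.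
      move=> v vw; rewrite /h; case: ifP => // v0.
      exfalso; have := le_lt_trans (Im_le_nc _) vw; rewrite raddfB /= ltr_norml => /andP[_]; lra.
    exact: cder_cst.
  - have [l gl] := gd w wr; exists l; apply: (@cder_eq _ g _ _ _ (complex.Im w)) => //.
    move=> v vw; rewrite /h; case: leP => // v0.
    exfalso; have := le_lt_trans (Im_le_nc _) vw; rewrite raddfB /= ltr_norml => /andP[]; lra.
  - have [l gl] := gd w wr; exists 0.
    have wE : w = (complex.Re w)%:C by rewrite [LHS]complexE w0 mulr0 addr0.
    have gw : g w = 0.
      by rewrite wE gx // -ncC -wE.
    have l0 : l = 0.
      apply/eqP; rewrite -nc_eq0; apply/eqP/le_anti; rewrite nc_ge0 andbT leNgt.
      apply/negP => l0; have [d d0 H] := gl (nc l / 2) (divr_gt0 l0 (ltr0n _ 2)).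
      pose t := Num.min (d / 2) ((rho - nc w) / 2).
      have t0 : 0 < t by rewrite lt_min !divr_gt0 // subr_gt0.
      have td : t < d.
        apply: (@le_lt_trans _ _ (d / 2)); [by rewrite ge_min lexx|lra].
      have tr : nc w + t < rho.
        have : t <= (rho - nc w) / 2 by rewrite ge_min lexx orbT.
        lra.
      have := H t%:C; rewrite ncC gtr0_norm // => /(_ td).
      have -> : g (w + t%:C) = 0.
        rewrite wE -rmorphD gx //; apply: le_lt_trans tr.
        rewrite [X in nc X]wE ncC -[X in _ <= _ + X](gtr0_norm t0).
        exact: ler_normD.
      rewrite gw subrr sub0r ncN ncM ncC gtr0_norm // ler_pM2r //; lra.
    move=> e e0; have [d d0 H] := gl e e0; exists d => // v vd.
    have -> : h w = 0 by rewrite /h gw if_same.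
    rewrite subr0 mul0r subr0 /h; case: ifP => _.
      by have := H v vd; rewrite gw l0 subr0 mul0r subr0.
    by rewrite nc0 mulr_ge0 ?nc_ge0 // ltW.
(* The disc of radius [rho / 2] around [q] lies in the lower half-plane, where [h] is 0. *)
pose q : C := - ('i * (rho / 2)%:C).
have q_nc : nc q = rho / 2 by rewrite ncN ncM nci mul1r ncC gtr0_norm //; lra.
apply: (@disc_identity h q z rho (rho / 2)) => //; [lra|by rewrite q_nc; lra|].
move=> w wq; rewrite /h; case: ifP => // w0.
exfalso; have := le_lt_trans (Im_le_nc _) wq.
by rewrite raddfB raddfN /= mul0r add0r mul1r opprK ger0_norm; lra.
Qed.

(** The map [z |-> - z] preserves the real axis and exchanges the two half-discs. *)
Theorem real_identity g (rho : R) : 0 < rho ->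
  (forall z, nc z < rho -> exists l, cder g z l) ->
  (forall x, `|x| < rho -> g x%:C = 0) ->
  forall z, nc z < rho -> g z = 0.
Proof.
move=> r0 gd gx z zr; have [z0|z0] := leP 0 (complex.Im z).
  exact: (upper_identity r0 gd gx).
have -> : g z = (fun w => g (0 + (-1) * w)) (- z).
  by rewrite /= add0r mulN1r opprK.
have zr' : nc (- z) < rho by rewrite ncN.
have z0' : 0 <= complex.Im (- z) by rewrite raddfN oppr_ge0 ltW.
apply: (@upper_identity (fun w => g (0 + (-1) * w)) rho) => //.
  move=> w wr; have [|l gl] := gd (0 + (-1) * w); first by rewrite add0r mulN1r ncN.
  by exists (-1 * l); exact: cder_comp_affine.
by move=> x xr; rewrite add0r mulN1r -rmorphN /= gx // normrN.
Qed.

(** Mean value inequality along the segment from 0 to [z]: the set of parameters [t] with increment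
    at most [e t nc z] contains its supremum, and reaches beyond it unless this is 1. Then [e] is
    arbitrary. *)
Lemma cder0_cst g (rho : R) :
  (forall z, nc z < rho -> cder g z 0) -> forall z, nc z < rho -> g z = g 0.
Proof.
move=> gd z zr.
have r0 : 0 < rho by exact: le_lt_trans (nc_ge0 z) zr.
have step (e : R) : 0 < e -> nc (g z - g 0) <= e * nc z.
  move=> e0.
  pose S := [set t : R | 0 <= t <= 1 /\ nc (g (t%:C * z) - g 0) <= e * (t * nc z)].
  have S0 : S 0 by split; rewrite ?lexx ?ler01 // rmorph0 mul0r subrr nc0 mul0r mulr0.
  have Sb : has_sup S by split; [exists 0|exists 1 => t [/andP[]]].
  pose c := sup S.
  have c0 : 0 <= c by exact: sup_upper_bound.
  have c1 : c <= 1 by apply: ge_sup; [exists 0|move=> t [/andP[]]].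
  have cz : nc (c%:C * z) < rho.
    by rewrite ncM ncC ger0_norm //; apply: le_lt_trans zr; rewrite ler_piMl ?nc_ge0.
  have [d d0 H] := gd _ cz e e0.
  have z1 : 0 < 1 + nc z by have := nc_ge0 z; lra.
  have near (t : R) : `|t - c| < d / (1 + nc z) ->
      nc (g (t%:C * z) - g (c%:C * z)) <= e * (`|t - c| * nc z).
    rewrite ltr_pdivlMr // => tc.
    have := H ((t - c)%:C * z); rewrite ncM ncC mul0r subr0.
    have -> : c%:C * z + (t - c)%:C * z = t%:C * z by rewrite -mulrDl -rmorphD subrKC.
    by apply; apply: le_lt_trans tc; rewrite ler_wpM2l // lerDr.
  have dz0 : 0 < d / (1 + nc z) by rewrite divr_gt0.
  have Sc : S c.
    split; first by rewrite c0.
    have [t [t01 tS] tc] := sup_adherent dz0 Sb.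
    have tle : t <= c by apply: sup_upper_bound.
    have tc' : c - t < d / (1 + nc z) by rewrite -/c in tc; lra.
    have := near t; rewrite ler0_norm ?subr_le0 // opprB => /(_ tc') h.
    have -> : g (c%:C * z) - g 0 = (g (t%:C * z) - g 0) - (g (t%:C * z) - g (c%:C * z)) by ring.
    apply: le_trans (ncB _ _) _.
    have -> : e * (c * nc z) = e * (t * nc z) + e * ((c - t) * nc z) by ring.
    exact: lerD.
  have c1' : c = 1.
    apply/le_anti; rewrite c1 leNgt; apply/negP => lt1.
    pose t := Num.min 1 (c + d / (1 + nc z) / 2).
    have ct : c < t by rewrite lt_min lt1; lra.
    have td : t - c < d / (1 + nc z).
      have : t <= c + d / (1 + nc z) / 2 by rewrite ge_min lexx orbT.
      lra.
    have : S t.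
      split; first by rewrite ge_min lexx andbT; lra.
      have := near t; rewrite gtr0_norm ?subr_gt0 // => /(_ td) h.
      case: Sc => _ h'.
      have -> : g (t%:C * z) - g 0 = (g (t%:C * z) - g (c%:C * z)) + (g (c%:C * z) - g 0) by ring.
      apply: le_trans (ncD _ _) _.
      have -> : e * (t * nc z) = e * ((t - c) * nc z) + e * (c * nc z) by ring.
      exact: lerD.
    by move=> St; have := sup_upper_bound Sb St; rewrite leNgt ct.
  by case: Sc => _; rewrite c1' rmorph1 !mul1r.
apply/eqP; rewrite -subr_eq0 -nc_eq0; apply/eqP/le_anti; rewrite nc_ge0 andbT leNgt.
apply/negP => h0; set D := nc _ in h0 step.
have z1 : 0 < 1 + nc z by have := nc_ge0 z; lra.
have := step (D / 2 / (1 + nc z)) (divr_gt0 (divr_gt0 h0 (ltr0n _ 2)) z1).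
rewrite mulrAC ler_pdivlMr // => h; have := nc_ge0 z; nra.
Qed.

End Identity.

(** * Several variables and polarization *)

Section SeveralVariables.
Variable R : realType.
Local Notation C := R[i].

(** A polydisc with a real radius; library balls of matrices over [R[i]] have their radii in
    [R[i]]. *)
Definition box n (p : 'rV[C]_n) (r : R) : set 'rV[C]_n :=
  [set z | forall j, nc (z 0 j - p 0 j) < r].

Lemma box_center n (p : 'rV[C]_n) r : 0 < r -> box p r p.
Proof. by move=> r0 j; rewrite subrr nc0. Qed.

Lemma box_le n (p : 'rV[C]_n) (r s : R) : r <= s -> box p r `<=` box p s.
Proof. by move=> rs z zp j; exact: lt_le_trans (zp j) rs. Qed.

Lemma box_sub n (p q : 'rV[C]_n) (r s t : R) : box p r q -> r + s <= t -> box q s `<=` box p t.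
Proof.
move=> pq rst z qz j; apply: lt_le_trans rst.
have -> : z 0 j - p 0 j = (q 0 j - p 0 j) + (z 0 j - q 0 j) by ring.
apply: le_lt_trans (ncD _ _) _; apply: ltrD; [exact: pq|exact: qz].
Qed.

Lemma nbhs_boxP n (p : 'rV[C]_n) (A : set 'rV[C]_n) :
  nbhs p A <-> exists2 r : R, 0 < r & box p r `<=` A.
Proof.
split=> [/nbhs_ballP[e /ltcR_pos[r r0 ->] H]|[r r0 H]].
  exists r => // z zp; apply: H; rewrite /ball /= /mx_ball; split; first by rewrite ltcR.
  move=> i j.
  rewrite (ord1 i) -ball_normE /= normcE_nc ltcR ncBC; exact: zp.
apply/nbhs_ballP; exists r%:C => /=; first by rewrite ltcR.
move=> z [_ pz]; apply: H => j; have := pz 0 j.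
by rewrite -ball_normE /= normcE_nc ltcR ncBC.
Qed.

Lemma open_boxP n (Om : set 'rV[C]_n) p : open Om -> Om p ->
  exists2 r : R, 0 < r & box p r `<=` Om.
Proof. by move=> oO Op; apply/nbhs_boxP; apply: open_nbhs_nbhs. Qed.

Lemma open_box n (p : 'rV[C]_n) r : open (box p r).
Proof.
rewrite openE => q pq; apply/nbhs_boxP.
pose s := \big[Num.max/0]_j nc (q 0 j - p 0 j).
have [r0|r0] := leP r 0.
  case: n p q pq @s => [|n] p q pq s.
    by exists 1 => // z _ [].
  by have := le_lt_trans (nc_ge0 _) (pq ord0); rewrite ltNge r0.
have sr : s < r.
  by rewrite /s; elim/big_ind: _ => // x y xr yr; rewrite gt_max xr yr.
exists (r - s); first by rewrite subr_gt0.
move=> z qz j; have -> : z 0 j - p 0 j = (q 0 j - p 0 j) + (z 0 j - q 0 j) by ring.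
apply: le_lt_trans (ncD _ _) _.
have h1 : nc (q 0 j - p 0 j) <= s by exact: (le_bigmax_cond _ (fun j => nc (q 0 j - p 0 j))).
have := qz j; lra.
Qed.

Lemma box_line n (p : 'rV[C]_n) (r : R) (a b : 'rV[C]_n) (s : C) (t : R) :
  box p r a -> (forall j, nc (b 0 j) < t) -> 0 < t -> box p (r + nc s * t) (a + s *: b).
Proof.
move=> pa bt t0 j; rewrite !mxE addrAC; apply: le_lt_trans (ncD _ _) _.
by apply: ltr_leD; [exact: pa|rewrite ncM; apply: ler_pM; rewrite ?nc_ge0 // ltW].
Qed.

(* Differentiability along complex lines suffices throughout, so that no joint
   continuity or differentiability has to be carried along. *)
Definition gholo n (Om : set 'rV[C]_n) (F : 'rV[C]_n -> C) :=
  forall q v s, Om (q + s *: v) -> exists l, cder (fun t => F (q + t *: v)) s l.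

Lemma gholo_sub n (Om Om' : set 'rV[C]_n) F : Om' `<=` Om -> gholo Om F -> gholo Om' F.
Proof. by move=> sub H q v s /sub; exact: H. Qed.

Lemma gholo_cst n (Om : set 'rV[C]_n) k : gholo Om (fun=> k).
Proof. by move=> q v s _; exists 0; exact: cder_cst. Qed.

Lemma gholo_coord n (Om : set 'rV[C]_n) j : gholo Om (fun z => z 0 j).
Proof.
move=> q v s _; exists (v 0 j).
under [X in cder X]funext => t do rewrite !mxE mulrC.
exact: cder_affine.
Qed.

Lemma gholoD n (Om : set 'rV[C]_n) F G : gholo Om F -> gholo Om G ->
  gholo Om (fun z => F z + G z).
Proof.
move=> HF HG q v s Oq; have [l fl] := HF q v s Oq; have [m gm] := HG q v s Oq.
by eexists; exact: cderD fl gm.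
Qed.

Lemma gholoM n (Om : set 'rV[C]_n) F G : gholo Om F -> gholo Om G ->
  gholo Om (fun z => F z * G z).
Proof. by move=> HF HG q v s Oq; apply: ex_cderM; [exact: HF|exact: HG]. Qed.

Lemma gholo_sum n (Om : set 'rV[C]_n) (I : Type) (s : seq I) (F : I -> 'rV[C]_n -> C) :
  (forall i, gholo Om (F i)) -> gholo Om (fun z => \sum_(i <- s) F i z).
Proof.
move=> HF; elim: s => [|i s IH].
  by under [X in gholo _ X]funext do rewrite big_nil; exact: gholo_cst.
by under [X in gholo _ X]funext do rewrite big_cons; exact: (gholoD (HF i) IH).
Qed.

Lemma gholo_prod n (Om : set 'rV[C]_n) (I : Type) (s : seq I) (F : I -> 'rV[C]_n -> C) :
  (forall i, gholo Om (F i)) -> gholo Om (fun z => \prod_(i <- s) F i z).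
Proof.
move=> HF; elim: s => [|i s IH].
  by under [X in gholo _ X]funext do rewrite big_nil; exact: gholo_cst.
by under [X in gholo _ X]funext do rewrite big_cons; exact: (gholoM (HF i) IH).
Qed.

Lemma gholo_mulmx n (Om : set 'rV[C]_n) N M (F : 'rV[C]_n -> 'rV[C]_N) (A : 'M[C]_(N, M)) k :
  (forall i, gholo Om (fun z => F z 0 i)) -> gholo Om (fun z => (F z *m A) 0 k).
Proof.
move=> HF; under [X in gholo _ X]funext do rewrite mxE.
apply: (@gholo_sum _ _ _ _ (fun i z => F z 0 i * A i k)) => i.
exact: (gholoM (HF i) (@gholo_cst _ Om (A i k))).
Qed.

Lemma differentiable_line n N (phi : 'rV[C]_n -> 'rV[C]_N) (q v : 'rV[C]_n) (s : C) k :
  differentiable phi (q + s *: v) ->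
  cder (fun t => phi (q + t *: v) 0 k) s (('d phi (q + s *: v) v : 'rV_N) 0 k).
Proof.
move=> df.
have dv : derivable phi (q + s *: v) v by exact: diff_derivable.
have lim : (fun h : C => h^-1 *: ((phi \o shift (q + s *: v)) (h *: v) - phi (q + s *: v))) @ 0^' -->
    ('d phi (q + s *: v) v : 'rV_N).
  by rewrite -deriveE //; exact: dv.
have limk : (fun h : C => (h^-1 *: ((phi \o shift (q + s *: v)) (h *: v) - phi (q + s *: v)) : 'rV[C]_N) 0 k)
    @ 0^' --> ('d phi (q + s *: v) v : 'rV_N) 0 k.
  apply: (@continuous_cvg _ _ _ _ _ _ (fun x : 'rV[C]_N => x 0 k)); last exact: lim.
  exact: coord_continuous.
have {}limk : (fun h : C => h^-1 *: (((fun t => phi (q + t *: v) 0 k) \o shift s) (h *: 1) -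
    phi (q + s *: v) 0 k)) @ 0^' --> ('d phi (q + s *: v) v : 'rV_N) 0 k.
  apply: cvg_trans limk; apply: near_eq_cvg; near=> h.
  have e : q + (h *: 1 + s) *: v = h *: v + (q + s *: v).
    by rewrite -[h *: 1]/(h * 1) mulr1 scalerDl addrCA.
  by rewrite /= !mxE /shift /= e.
exact: lim_cder.
Unshelve. all: by end_near. Qed.

Lemma holo_gholo n N (Om : set 'rV[C]_n) (phi : 'rV[C]_n -> 'rV[C]_N) k :
  holomorphic_on Om phi -> gholo Om (fun z => phi z 0 k).
Proof. by move=> H q v s /H d; eexists; exact: differentiable_line. Qed.

(** Apply [disc_identity] for [nc s < 2] on the line from [q] to [z]: the coordinates of [z - q] are
    below [r / 4], so the line stays in [box p r], and for [nc s < eta / r] it stays in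
    [box q eta]. *)
Lemma gholo_box_identity n (p : 'rV[C]_n) (r : R) F (q : 'rV[C]_n) (eta : R) :
  0 < r -> 0 < eta -> gholo (box p r) F -> box p (r / 8) q ->
  (forall z, box q eta z -> F z = 0) -> forall z, box p (r / 8) z -> F z = 0.
Proof.
move=> r0 e0 FH pq Fq z pz.
have v0 j : nc ((z - q) 0 j) < r / 4.
  rewrite !mxE; have := ncB (z 0 j - p 0 j) (q 0 j - p 0 j).
  have -> : z 0 j - p 0 j - (q 0 j - p 0 j) = z 0 j - q 0 j by ring.
  by have := pz j; have := pq j; lra.
have r4 : 0 < r / 4 by lra.
have := @disc_identity R (fun t => F (q + t *: (z - q))) 0 1 2 (eta / r).
rewrite nc0 ComplexField.Normc.normc1 scale1r subrKC; apply => //.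
- exact: divr_gt0.
- by lra.
- move=> s s2; apply: FH; apply: box_le (box_line s pq v0 r4).
  suff : nc s * (r / 4) <= 2 * (r / 4) by lra.
  by rewrite ler_pM2r // ltW.
- move=> s; rewrite subr0 ltr_pdivlMr // => sr; apply: Fq => j.
  rewrite !mxE addrAC subrr add0r ncM.
  have := v0 j; rewrite !mxE => h; apply: le_lt_trans sr.
  by rewrite ler_wpM2l ?nc_ge0 //; lra.
Qed.

(** The points near which [F] vanishes form an open set, nonempty in [Om] and closed there by
    [gholo_box_identity]. *)
Theorem gholo_identity n (Om : set 'rV[C]_n) F (p : 'rV[C]_n) (r : R) :
  open Om -> connected Om -> gholo Om F -> Om p -> 0 < r ->
  (forall z, box p r z -> F z = 0) -> forall z, Om z -> F z = 0.
Proof.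
move=> oO cO FH Op r0 Fp.
pose Z := [set z | exists2 s : R, 0 < s & forall w, box z s w -> F w = 0].
have oZ : open Z.
  rewrite openE => z [s s0 H]; apply/nbhs_boxP; exists (s / 2); first lra.
  move=> w zw; exists (s / 2); first lra.
  by move=> u wu; apply: H; apply: box_sub zw _ _ wu; lra.
have key z : Om z -> closure Z z -> Z z.
  move=> Oz cz; have [s s0 sO] := open_boxP oO Oz.
  have [|q [[eta e0 Hq] zq]] := cz (box z (s / 8)).
    by apply/nbhs_boxP; exists (s / 8) => //; lra.
  exists (s / 8); first lra.
  exact: (@gholo_box_identity _ z s F q eta s0 e0 (gholo_sub sO FH) zq Hq).
have : Om `&` Z = Om.
  apply: cO.
  - by exists p; split => //; exists r.
  - by exists Z.
  - exists (closure Z); first exact: closed_closure.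
    apply/seteqP; split => z [Oz Zz]; split => //; first exact: subset_closure.
    exact: key.
move=> E z; rewrite -E => -[_ [s s0 H]]; apply: H; exact: box_center.
Qed.

(** Holomorphic in the first and antiholomorphic in the second variable, but tested only at
    conjugate parameters of a complex line, which is where polarization evaluates. *)
Definition sesq (V : lmodType C) (D : V -> Prop) (E : V -> V -> C) :=
  forall A B s, D (A + s *: B) -> D (A + s^* *: B) ->
  exists l, cder (fun t => E (A + t *: B) (A + t^* *: B)) s l.

(* [z] and [w] are the values at [s = i] of [A + s B] and [A + conj s B], where
   [A = (z + w) / 2] and [B = (z - w) / 2i]; for real [s] these points coincide. *)
Lemma polarization (V : lmodType C) (D : V -> Prop) (E : V -> V -> C) z w :
  (forall s : C, nc s < 2 -> D (2^-1 *: (z + w) + s *: ((2 * 'i)^-1 *: (z - w)))) ->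
  sesq D E -> (forall u, D u -> E u u = 0) -> E z w = 0.
Proof.
set A := 2^-1 *: _; set B := _ *: (z - w) => DAB HE E0.
have i2 : (2 * 'i : C) != 0.
  rewrite mulf_neq0 ?pnatr_eq0 //.
  by apply/eqP => /(congr1 (@complex.Im R)) /eqP; rewrite /= oner_eq0.
have := @real_identity R (fun s => E (A + s *: B) (A + s^* *: B)) 2.
move=> /(_ (ltr0n _ 2)) H.
have := H _ _ 'i; rewrite nci ltr1n => {}H.
have h2 : 'i / (2 * 'i) = 2^-1 :> C.
  have i0 : 'i != 0 :> C.
    by apply/eqP => /(congr1 (@complex.Im R)) /eqP; rewrite /= oner_eq0.
  by field; rewrite i0.
have dbl (u : V) : 2^-1 *: (u + u) = u.
  by rewrite scalerDr -scalerDl -[2^-1]mul1r -splitr scale1r.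
have e1 : A + 'i *: B = z.
  by rewrite /A /B scalerA h2 -scalerDr addrACA subrr addr0 dbl.
have e2 : A + 'i^* *: B = w.
  have -> : ('i : C)^* = - 'i by simpc.
  by rewrite scaleNr /A /B scalerA h2 -scalerBr opprB addrC addrA subrK dbl.
rewrite e1 e2 in H; apply: H => //.
- by move=> s s2; apply: HE; apply: DAB; rewrite ?ncJ.
- by move=> x x2; rewrite conjc_real; apply: E0; apply: DAB; rewrite ncC.
Qed.

Lemma sesqD (V : lmodType C) (D : V -> Prop) (E G : V -> V -> C) :
  sesq D E -> sesq D G -> sesq D (fun z w => E z w + G z w).
Proof.
move=> HE HG A B s h1 h2; have [l el] := HE A B s h1 h2; have [m gm] := HG A B s h1 h2.
by eexists; exact: cderD el gm.
Qed.

Lemma sesqM (V : lmodType C) (D : V -> Prop) (E G : V -> V -> C) :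
  sesq D E -> sesq D G -> sesq D (fun z w => E z w * G z w).
Proof.
by move=> HE HG A B s h1 h2; apply: ex_cderM; [exact: HE|exact: HG].
Qed.

Lemma sesqV (V : lmodType C) (D : V -> Prop) (E : V -> V -> C) :
  (forall z w, D z -> D w -> E z w != 0) ->
  sesq D E -> sesq D (fun z w => (E z w)^-1).
Proof.
move=> nE HE A B s h1 h2; have [l el] := HE A B s h1 h2.
by eexists; apply: cderV el; exact: nE.
Qed.

Lemma sesq_cst (V : lmodType C) (D : V -> Prop) (k : C) : sesq D (fun _ _ => k).
Proof. by move=> A B s _ _; exists 0; exact: cder_cst. Qed.

Lemma sesqX (V : lmodType C) (D : V -> Prop) (E : V -> V -> C) m :
  sesq D E -> sesq D (fun z w => E z w ^+ m).
Proof.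
by move=> HE A B s h1 h2; have [l el] := HE A B s h1 h2; eexists; exact: (cderX m el).
Qed.

Lemma sesq_sum (V : lmodType C) (D : V -> Prop) (I : Type) (s : seq I) (E : I -> V -> V -> C) :
  (forall i, sesq D (E i)) -> sesq D (fun z w => \sum_(i <- s) E i z w).
Proof.
move=> HE; elim: s => [|i s IH].
  have -> : (fun z w => \sum_(i <- [::]) E i z w) = (fun _ _ => 0).
    by apply: funext => z; apply: funext => w; rewrite big_nil.
  exact: sesq_cst.
have -> : (fun z w => \sum_(j <- i :: s) E j z w) =
    (fun z w => E i z w + \sum_(j <- s) E j z w).
  by apply: funext => z; apply: funext => w; rewrite big_cons.
exact: (sesqD (HE i) IH).
Qed.

Lemma sesq_left (V : lmodType C) (D : V -> Prop) (F : V -> C) :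
  (forall A B s, D (A + s *: B) -> exists l, cder (fun t => F (A + t *: B)) s l) ->
  sesq D (fun z _ => F z).
Proof. by move=> HF A B s h _; exact: HF. Qed.

Lemma sesq_right (V : lmodType C) (D : V -> Prop) (F : V -> C) :
  (forall A B s, D (A + s *: B) -> exists l, cder (fun t => F (A + t *: B)) s l) ->
  sesq D (fun _ w => (F w)^*).
Proof.
move=> HF A B s _ h; have [l fl] := HF A B _ h.
by exists l^*; exact: (@cder_conj R (fun t => F (A + t *: B))).
Qed.

End SeveralVariables.

(** * Rigidity of Hermitian kernels *)

Section KernelRigidity.
Variable R : realType.
Local Notation C := R[i].

Definition ip N (u v : 'rV[C]_N) : C := \sum_k u 0 k * (v 0 k)^*.

Definition kern (T : Type) N (phi : T -> 'rV[C]_N) (z w : T) : C := 1 + ip (phi z) (phi w).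

(* The mixed second derivative of [log (1 + |phi|^2)], where [u] and [v] are the
   values of [phi], and [u'] and [v'] those of its derivative, at two points. *)
Definition gform N (u u' v v' : 'rV[C]_N) : C :=
  ((1 + ip u v) * ip u' v' - ip u' v * ip u v') / (1 + ip u v) ^+ 2.

Lemma ipC N (u v : 'rV[C]_N) : (ip u v)^* = ip v u.
Proof.
rewrite /ip rmorph_sum; apply: eq_bigr => k _.
by rewrite rmorphM /= conjcK mulrC.
Qed.

Lemma kernC (T : Type) N (phi : T -> 'rV[C]_N) z w : (kern phi z w)^* = kern phi w z.
Proof. by rewrite /kern rmorphD rmorph1 /= ipC. Qed.

Lemma Re_mulJ_ge (u v : C) : - (nc (u - v) ^+ 2) / 4 <= complex.Re (u * v^*).
Proof.
case: u v => [a b] [c d]; simpc; rewrite /= sqr_sqrtr ?addr_ge0 ?sqr_ge0 //.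
have := sqr_ge0 (a + c); have := sqr_ge0 (b + d); lra.
Qed.

(** Each of the [N] products has real part at least [- 1 / (N + 1)], too little to cancel the 1.
    This licenses all quotients of kernels below. *)
Lemma kern_neq0 (T : Type) N (phi : T -> 'rV[C]_N) z w :
  (forall k, nc (phi z 0 k - phi w 0 k) <= (N.+1%:R)^-1) -> kern phi z w != 0.
Proof.
move=> H; suff : 0 < complex.Re (kern phi z w).
  by apply: contraTneq => ->; rewrite ltxx.
have -> : complex.Re (kern phi z w) = 1 + \sum_k complex.Re (phi z 0 k * (phi w 0 k)^*).
  by rewrite /kern /ip raddfD raddf_sum.
have : - (\sum_(k < N) (N.+1%:R : R)^-1) <= \sum_k complex.Re (phi z 0 k * (phi w 0 k)^*).
  rewrite -sumrN; apply: ler_sum => k _; apply: le_trans (Re_mulJ_ge _ _).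
  have h := H k; have h0 := nc_ge0 (phi z 0 k - phi w 0 k).
  have h1 : (N.+1%:R : R)^-1 <= 1 by rewrite invf_le1 ?ltr0n // ler1n.
  have h2 : nc (phi z 0 k - phi w 0 k) ^+ 2 <= nc (phi z 0 k - phi w 0 k).
    by rewrite expr2 ler_piMl // (le_trans h).
  by move: (nc _) (N.+1%:R^-1 : R) h h0 h2 => x q *; lra.
rewrite sumr_const card_ord.
have : (N.+1%:R : R)^-1 *+ N < 1.
  by rewrite -[_ *+ N]mulr_natl ltr_pdivrMr ?ltr0n // mul1r ltr_nat.
move: (_ *+ N) (\sum_k _) => q S h1 h2; lra.
Qed.

(** [l] is the logarithmic derivative of [g], expressed without choosing a branch of the
    logarithm. *)
Definition logd (g : C -> C) z l := cder g z (g z * l).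

Lemma logdM g h z l m : logd g z l -> logd h z m -> logd (fun w => g w * h w) z (l + m).
Proof.
move=> gl hm; rewrite /logd.
have -> : g z * h z * (l + m) = g z * (h z * m) + h z * (g z * l) by ring.
exact: cderM.
Qed.

Lemma logdV g z l : g z != 0 -> logd g z l -> logd (fun w => (g w)^-1) z (- l).
Proof.
move=> g0 gl; rewrite /logd.
have -> : (g z)^-1 * - l = - (g z)^-2 * (g z * l) by field.
exact: cderV.
Qed.

Lemma logdX g z l n : logd g z l -> logd (fun w => g w ^+ n) z (n%:R * l).
Proof.
move=> gl; elim: n => [|n IH].
  rewrite /logd mul0r mulr0; under [X in cder X]funext do rewrite expr0.
  exact: cder_cst.
under [X in logd X]funext do rewrite exprS.
by rewrite -natr1 mulrDl mul1r addrC; exact: (logdM gl IH).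
Qed.

Section OneVariable.
Variables (N : nat) (phi phi' : C -> 'rV[C]_N) (rho : R).
Hypothesis phiP : forall s k, nc s < rho -> cder (fun t => phi t 0 k) s (phi' s 0 k).
Hypothesis kern0 : forall s t, nc s < rho -> nc t < rho -> kern phi s t != 0.

Lemma cder_ipl u s : nc s < rho -> cder (fun t => ip (phi t) u) s (ip (phi' s) u).
Proof.
move=> sr; apply: (@cder_sum _ _ _ (fun k t => phi t 0 k * (u 0 k)^*) (fun k => phi' s 0 k * (u 0 k)^*)) => k.
by rewrite mulrC; under [X in cder X]funext do rewrite mulrC; exact: (cderZ (conjc (u 0 k)) (phiP k sr)).
Qed.

Lemma cder_ipr u s : nc s < rho -> cder (fun t => ip u (phi t^*)) s (ip u (phi' s^*)).
Proof.
move=> sr; apply: (@cder_sum _ _ _ (fun k t => u 0 k * (phi t^* 0 k)^*) (fun k => u 0 k * (phi' s^* 0 k)^*)) => k.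
by apply: cderZ; apply: (@cder_conj _ (fun t => phi t 0 k)); apply: phiP; rewrite ncJ.
Qed.

Lemma cder_kernl w s : nc s < rho -> cder (fun t => kern phi t w) s (ip (phi' s) (phi w)).
Proof.
move=> sr; have := cderD (cder_cst 1 s) (cder_ipl (phi w) sr).
by rewrite add0r.
Qed.

Lemma cder_kernr w s : nc s < rho -> cder (fun t => kern phi w t^*) s (ip (phi w) (phi' s^*)).
Proof.
move=> sr; have := cderD (cder_cst 1 s) (cder_ipr (phi w) sr).
by rewrite add0r.
Qed.

Lemma logd_kern w s : nc s < rho -> nc w < rho ->
  logd (fun t => kern phi t w) s (ip (phi' s) (phi w) / kern phi s w).
Proof.
move=> sr wr; rewrite /logd mulrCA mulfV ?mulr1; last exact: kern0.
exact: cder_kernl.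
Qed.

(** The origin of [gform]: the derivative of [log kern] in the first variable is differentiated in
    the conjugate of the second. *)
Lemma cder_logd s w : nc s < rho -> nc w < rho ->
  cder (fun t => ip (phi' s) (phi t^*) / kern phi s t^*) w
    (gform (phi s) (phi' s) (phi w^*) (phi' w^*)).
Proof.
move=> sr wr; have k0 : kern phi s w^* != 0 by apply: kern0; rewrite ?ncJ.
have := cderM (cder_ipr (phi' s) wr) (@cderV _ (fun t => kern phi s t^*) w _ k0 (cder_kernr s wr)).
congr (cder _ _ _); rewrite /gform -/(kern phi s w^*).
by field.
Qed.

(** As [gform] contains [phi'], polarizing it takes a second derivative of [phi]; here [cder_deriv]
    enters. *)
Let dphi' s k : nc s < rho -> exists l, cder (fun t => phi' t 0 k) s l.
Proof.
move=> sr; apply: (@cder_deriv _ (fun t => phi t 0 k) _ _ (rho - nc s)).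
  by rewrite subr_gt0.
move=> z; rewrite ltrBrDr => zs; apply: phiP; apply: le_lt_trans zs.
by rewrite -[X in nc X](subrK s); exact: ncD.
Qed.

Let D : C -> Prop := fun s => nc s < rho.

Let line_cder (F : C -> C) : (forall s, nc s < rho -> exists l, cder F s l) ->
  forall A B s : C, D (A + s *: B) -> exists l, cder (fun t : C => F (A + t *: B)) s l.
Proof.
move=> H A B s h; have [|l hl] := H (A + B * s); first by rewrite mulrC.
exists (B * l); have -> : (fun t : C => F (A + t *: B)) = (fun t => F (A + B * t)).
  by apply: funext => t; rewrite [in RHS]mulrC.
exact: cder_comp_affine.
Qed.

Let sesq_ip (u v : C -> 'rV[C]_N) :
  (forall s k, nc s < rho -> exists l, cder (fun t => u t 0 k) s l) ->
  (forall s k, nc s < rho -> exists l, cder (fun t => v t 0 k) s l) ->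
  @sesq R C D (fun z w => ip (u z) (v w)).
Proof.
move=> hu hv; apply: (@sesq_sum _ _ _ _ _ (fun k z w => u z 0 k * (v w 0 k)^*)) => k.
apply: (@sesqM _ C D (fun z _ => u z 0 k) (fun _ w => (v w 0 k)^*)).
- by apply: (@sesq_left _ C D (fun z : C => u z 0 k)); exact: (line_cder (fun s sr => hu s k sr)).
- by apply: (@sesq_right _ C D (fun z : C => v z 0 k)); exact: (line_cder (fun s sr => hv s k sr)).
Qed.

Lemma sesq_gform :
  @sesq R C D (fun z w => gform (phi z) (phi' z) (phi w) (phi' w)).
Proof.
have dphi s k : nc s < rho -> exists l, cder (fun t => phi t 0 k) s l.
  by move=> sr; eexists; exact: phiP.
have sk : @sesq R C D (fun z w => 1 + ip (phi z) (phi w)).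
  by apply: sesqD; [exact: sesq_cst|exact: sesq_ip].
apply: sesqM.
- have -> : (fun z w : C => (1 + ip (phi z) (phi w)) * ip (phi' z) (phi' w) -
      ip (phi' z) (phi w) * ip (phi z) (phi' w)) =
    (fun z w => (1 + ip (phi z) (phi w)) * ip (phi' z) (phi' w) +
      (-1) * (ip (phi' z) (phi w) * ip (phi z) (phi' w))).
    by apply: funext => z; apply: funext => w; rewrite mulN1r.
  by apply: sesqD; apply: sesqM; rewrite -?[sesq _ _]/(sesq _ _);
    [exact: sk|exact: sesq_ip|exact: sesq_cst|apply: sesqM; exact: sesq_ip].
- apply: (@sesqV _ _ D (fun z w => (1 + ip (phi z) (phi w)) ^+ 2)); last exact: sesqX.
  by move=> z w Dz Dw; rewrite expf_neq0 //; exact: kern0.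
Qed.

End OneVariable.

(* The polarized hypothesis says that the mixed second derivative of [log T]
   vanishes; integrate it in each variable. *)
Lemma one_variable_rigidity N1 N2 N3 (phi1 phi1' : C -> 'rV[C]_N1) (phi2 phi2' : C -> 'rV[C]_N2)
    (phi3 phi3' : C -> 'rV[C]_N3) (a b c : nat) (rho : R) :
  (forall s k, nc s < rho -> cder (fun t => phi1 t 0 k) s (phi1' s 0 k)) ->
  (forall s k, nc s < rho -> cder (fun t => phi2 t 0 k) s (phi2' s 0 k)) ->
  (forall s k, nc s < rho -> cder (fun t => phi3 t 0 k) s (phi3' s 0 k)) ->
  (forall s t, nc s < rho -> nc t < rho -> kern phi1 s t != 0) ->
  (forall s t, nc s < rho -> nc t < rho -> kern phi2 s t != 0) ->
  (forall s t, nc s < rho -> nc t < rho -> kern phi3 s t != 0) ->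
  (forall s, nc s < rho -> b%:R * gform (phi1 s) (phi1' s) (phi1 s) (phi1' s) +
     c%:R * gform (phi2 s) (phi2' s) (phi2 s) (phi2' s) =
     a%:R * gform (phi3 s) (phi3' s) (phi3 s) (phi3' s)) ->
  let T s t := kern phi1 s t ^+ b * kern phi2 s t ^+ c / kern phi3 s t ^+ a in
  forall s t, nc s < rho / 3 -> nc t < rho / 3 -> T s t * T 0 0 = T s 0 * T 0 t.
Proof.
move=> d1 d2 d3 n1 n2 n3 diag T s t sr tr.
have r0 : 0 < rho by have := le_lt_trans (nc_ge0 s) sr; lra.
have in3 (z : C) : nc z < rho / 3 -> nc z < rho by lra.
pose E (z w : C) := b%:R * gform (phi1 z) (phi1' z) (phi1 w) (phi1' w) +
  (c%:R * gform (phi2 z) (phi2' z) (phi2 w) (phi2' w) +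
   (- a%:R) * gform (phi3 z) (phi3' z) (phi3 w) (phi3' w)).
have sE : @sesq R C (fun z => nc z < rho) E.
  pose D (z : C) := nc z < rho.
  have g1 := sesqM (@sesq_cst _ C D b%:R) (sesq_gform d1 n1).
  have g2 := sesqM (@sesq_cst _ C D c%:R) (sesq_gform d2 n2).
  have g3 := sesqM (@sesq_cst _ C D (- a%:R)) (sesq_gform d3 n3).
  exact: (sesqD g1 (sesqD g2 g3)).
(* Polarization visits points of modulus below [nc (z + w) / 2 + nc (z - w)], or equal to it when
   [z = w]; this stays below [rho] if [z] and [w] are below [rho / 3]. *)
have E0 z w : nc z < rho / 3 -> nc w < rho / 3 -> E z w = 0.
  move=> zr wr; apply: (polarization _ sE) => [v v2|u ur]; last first.
    by rewrite /E addrA diag // -mulrDl addrN mul0r.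
  rewrite -[_ *: (z + w)]/(_ * _) -[_ *: (_ *: _)]/(_ * (_ * _)).
  apply: le_lt_trans (ncD _ _) _; rewrite !ncM !ncV ncM nci.
  have -> : nc (2 : C) = 2 by rewrite -(rmorph_nat (real_complex R)) ncC ger0_norm.
  have := ncD z w; have := ncB z w; have := nc_ge0 v; have := nc_ge0 (z - w); nra.
(* [Q] is the derivative of [log T] in the first variable; differentiating it in the conjugate of
   the second gives [E]. *)
pose Q (z w : C) := b%:R * (ip (phi1' z) (phi1 w) / kern phi1 z w) +
  (c%:R * (ip (phi2' z) (phi2 w) / kern phi2 z w) +
   (- a%:R) * (ip (phi3' z) (phi3 w) / kern phi3 z w)).
have Qc z w : nc z < rho / 3 -> nc w < rho / 3 -> Q z w = Q z 0.
  move=> zr wr.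
  have := @cder0_cst R (fun v => Q z v^*) (rho / 3) _ w^*; rewrite ncJ conjcK conjc0.
  apply=> // v vr.
  have -> : 0 = E z v^* by rewrite E0 // ncJ.
  apply: cderD; first by apply: cderZ; apply: (cder_logd d1 n1); exact: in3.
  by apply: cderD; apply: cderZ; [apply: (cder_logd d2 n2)|apply: (cder_logd d3 n3)]; exact: in3.
have T0 z w : nc z < rho / 3 -> nc w < rho / 3 -> T z w != 0.
  move=> /in3 zr /in3 wr; rewrite /T !mulf_neq0 ?invr_neq0 // expf_neq0 //;
  by [exact: n1|exact: n2|exact: n3].
have Td z w : nc z < rho / 3 -> nc w < rho / 3 -> logd (fun v => T v w) z (Q z w).
  move=> /in3 zr /in3 wr; rewrite /Q addrA mulNr; apply: logdM.
    apply: logdM; first by apply: logdX; exact: (logd_kern d1 n1).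
    by apply: logdX; exact: (logd_kern d2 n2).
  apply: logdV; first by rewrite expf_neq0 //; exact: n3.
  by apply: logdX; exact: (logd_kern d3 n3).
have z0 : nc (0 : C) < rho / 3 by rewrite nc0; lra.
(* The quotient [T v t / T v 0] has logarithmic derivative [Q v t - Q v 0 = 0]. *)
have dS v : nc v < rho / 3 -> cder (fun v => T v t * (T v 0)^-1) v 0.
  move=> vr; have := logdM (Td v t vr tr) (@logdV (fun v => T v 0) v _ (T0 v 0 vr z0) (Td v 0 vr z0)).
  by rewrite /logd Qc // subrr mulr0.
have := cder0_cst dS sr.
by move/eqP; rewrite eqr_div ?T0 // => /eqP ->; rewrite mulrC.
Qed.

End KernelRigidity.

(** * The Fubini-Study form *)

Section FubiniStudy.
Variable R : realType.
Local Notation C := R[i].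

(** By [sqn_line], [1 + sqn] is a quadratic polynomial on every real line, and its quadratic term
    does not contribute at 0. *)
Lemma derive1_ln_quadratic (s p q : R) : 0 < s ->
  derive1 (fun t : R => ln (s + t * p + t ^+ 2 * q)) 0 = p / s.
Proof.
move=> s0; rewrite derive1E.
have d1 : is_derive (0 : R) (1 : R) (fun t : R => s + t * p + t ^+ 2 * q) p.
  apply: is_derive_eq.
  by rewrite /GRing.scale /=; ring.
have d2 : is_derive (s + 0 * p + 0 ^+ 2 * q) (1 : R) (@ln R) s^-1.
  have -> : s + 0 * p + 0 ^+ 2 * q = s by ring.
  exact: is_derive1_ln.
pose g t : R := s + t * p + t ^+ 2 * q.
have [_ E] : is_derive (0 : R) (1 : R) (@ln R \o g) (p * s^-1).
  by rewrite mulrC; apply: is_derive1_comp.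
exact: E.
Qed.

Lemma derive1_quotient (x y s p q : R) : 0 < s ->
  derive1 (fun t : R => (x + t * y) / (s + t * p + t ^+ 2 * q)) 0 = (y * s - x * p) / s ^+ 2.
Proof.
move=> s0; rewrite derive1E.
have d1 : is_derive (0 : R) (1 : R) (fun t : R => s + t * p + t ^+ 2 * q) p.
  by apply: is_derive_eq; rewrite /GRing.scale /=; ring.
have d2 : is_derive (0 : R) (1 : R) (fun t : R => x + t * y) y.
  by apply: is_derive_eq; rewrite /GRing.scale /=; ring.
have n0 : (s + 0 * p + 0 ^+ 2 * q) != 0.
  have -> : s + 0 * p + 0 ^+ 2 * q = s by ring.
  by rewrite gt_eqF.
pose g t : R := s + t * p + t ^+ 2 * q.
have d3 : is_derive (0 : R) (1 : R) (fun t => (g t)^-1) (- (g 0) ^- 2 * p).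
  split; first by apply: derivableV.
  by rewrite deriveV //; case: d1 => _ ->.
have [_ E] := is_deriveM d2 d3.
rewrite [LHS]E /GRing.scale /= /g.
have -> : s + 0 * p + 0 ^+ 2 * q = s by ring.
by field; rewrite gt_eqF.
Qed.


Lemma nc_sqrE (z : C) : nc z ^+ 2 = complex.Re z ^+ 2 + complex.Im z ^+ 2.
Proof. by case: z => x y; rewrite /= sqr_sqrtr // addr_ge0 ?sqr_ge0. Qed.

Definition sqn N (w : 'rV[C]_N) : R := \sum_k nc (w 0 k) ^+ 2.

Lemma sqn_ge0 N (w : 'rV[C]_N) : 0 <= sqn w.
Proof. by apply: sumr_ge0 => k _; rewrite sqr_ge0. Qed.

Lemma ip_sqn N (w : 'rV[C]_N) : ip w w = (sqn w)%:C.
Proof.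
rewrite /ip /sqn rmorph_sum; apply: eq_bigr => k _ /=.
by rewrite rmorphXn -sqr_normc.
Qed.

Lemma sqn_line N (z v : 'rV[C]_N) (t : R) :
  sqn (z + t%:C *: v) = sqn z + t * (2 * complex.Re (ip v z)) + t ^+ 2 * sqn v.
Proof.
have -> : complex.Re (ip v z) = \sum_k complex.Re (v 0 k * (z 0 k)^*).
  by rewrite /ip raddf_sum.
rewrite /sqn !mulr_sumr -!big_split /=; apply: eq_bigr => k _.
rewrite !mxE !nc_sqrE; case: (z 0 k) => x y; case: (v 0 k) => p q; simpc => /=; ring.
Qed.

Lemma Re_divR (z : C) (s : R) : complex.Re (z / s%:C) = complex.Re z / s.
Proof.
by rewrite -fmorphV; case: z => x y; simpc.
Qed.

Lemma Im_divR (z : C) (s : R) : complex.Im (z / s%:C) = complex.Im z / s.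
Proof.
by rewrite -fmorphV; case: z => x y; simpc.
Qed.

Lemma real_dderiv_log N (z v : 'rV[C]_N) :
  real_dderiv (fun w => (ln (1 + sqn w))%:C) v z =
  (2 * complex.Re (ip v z) / (1 + sqn z))%:C.
Proof.
rewrite /real_dderiv /=; congr (_ +i* _); last by rewrite derive1_cst.
rewrite -(@derive1_ln_quadratic _ _ (sqn v)); last by rewrite ltr_pwDl ?sqn_ge0.
by congr (derive1 _ 0); apply: funext => t; rewrite sqn_line !addrA.
Qed.

Lemma ip_delta N (k : 'I_N) (c : C) (w : 'rV[C]_N) :
  ip (c *: delta_mx 0 k) w = c * (w 0 k)^*.
Proof.
rewrite /ip (bigD1 k) //= !mxE !eqxx mulr1 big1 ?addr0 // => j jk.
by rewrite !mxE (negPf jk) andbF mulr0 mul0r.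
Qed.

Lemma dzbar_log N (k : 'I_N) (w : 'rV[C]_N) :
  dzbar k (fun w => (ln (1 + sqn w))%:C) w = w 0 k / (1 + sqn w)%:C.
Proof.
have s0 : (1 + sqn w)%:C != 0 :> C.
  by rewrite fmorph_eq0 gt_eqF // ltr_pwDl ?sqn_ge0.
have E1 : complex.Re (w 0 k)^* = complex.Re (w 0 k) by case: (w 0 k).
have E2 : complex.Re ('i * (w 0 k)^*) = complex.Im (w 0 k).
  by case: (w 0 k) => x y; simpc.
rewrite /dzbar !real_dderiv_log -['e_k]scale1r scalerA mulr1 !ip_delta mul1r E1 E2.
rewrite !(rmorphM, fmorphV) /=.
rewrite rmorph_nat [X in _ = X / _](complexE (w 0 k)).
by rewrite complexiE; move: (_%:C) s0 => S s0; field.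
Qed.

Lemma real_dderiv_quot N (k : 'I_N) (z v : 'rV[C]_N) :
  real_dderiv (fun w => w 0 k / (1 + sqn w)%:C) v z =
  (v 0 k * (1 + sqn z)%:C - z 0 k * (2 * complex.Re (ip v z))%:C) / ((1 + sqn z)%:C) ^+ 2.
Proof.
have s0 : 0 < 1 + sqn z by rewrite ltr_pwDl ?sqn_ge0.
rewrite /real_dderiv -rmorphXn.
set B := 2 * complex.Re (ip v z).
have e (t : R) : 1 + sqn (z + t%:C *: v) = 1 + sqn z + t * B + t ^+ 2 * sqn v.
  by rewrite sqn_line !addrA.
have -> : (fun t : R => complex.Re ((z + t%:C *: v) 0 k / (1 + sqn (z + t%:C *: v))%:C)) =
    (fun t => (complex.Re (z 0 k) + t * complex.Re (v 0 k)) / (1 + sqn z + t * B + t ^+ 2 * sqn v)).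
  apply: funext => t; rewrite Re_divR e; congr (_ / _).
  by rewrite !mxE; case: (z 0 k) => x y; case: (v 0 k) => p q; simpc.
have -> : (fun t : R => complex.Im ((z + t%:C *: v) 0 k / (1 + sqn (z + t%:C *: v))%:C)) =
    (fun t => (complex.Im (z 0 k) + t * complex.Im (v 0 k)) / (1 + sqn z + t * B + t ^+ 2 * sqn v)).
  apply: funext => t; rewrite Im_divR e; congr (_ / _).
  by rewrite !mxE; case: (z 0 k) => x y; case: (v 0 k) => p q; simpc.
rewrite !derive1_quotient //; apply/eqP; rewrite eq_complex Re_divR Im_divR /=.
by case: (z 0 k) => x y; case: (v 0 k) => p q; simpc.
Qed.

Lemma fubini_studyE N (w : 'rV[C]_N) :
  fubini_study w = ('i / (2%:R * pi)%:C) *: \matrix_(j, k)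
    (((j == k)%:R * (1 + ip w w) - w 0 k * (w 0 j)^*) / (1 + ip w w) ^+ 2).
Proof.
rewrite /fubini_study; congr (_ *: _); apply/matrixP => j k; rewrite !mxE.
rewrite -/(sqn _) (funext (dzbar_log k)) /dz !real_dderiv_quot -['e_j]scale1r scalerA mulr1 !ip_delta mul1r.
rewrite ip_sqn -(rmorph1 (real_complex R)) -rmorphD.
have s0 : (1 + sqn w)%:C != 0 :> C.
  by rewrite fmorph_eq0 gt_eqF // ltr_pwDl ?sqn_ge0.
rewrite !mxE eqxx /= rmorph1 mul1r [k == j]eq_sym.
have -> : (2 * complex.Re (w 0 j)^*)%:C = w 0 j + (w 0 j)^* :> C.
  case: (w 0 j) => x y; simpc; congr (_ +i* _) => /=; ring.
have -> : (2 * complex.Re ('i * (w 0 j)^*))%:C = 'i * ((w 0 j)^* - w 0 j) :> C.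
  case: (w 0 j) => x y; simpc; congr (_ +i* _) => /=; ring.
have i2 : 'i * 'i = -1 :> C by simpc.
(* Pure algebra with ['i] abstracted: [d] is the Kronecker symbol, [x = w_k], [y = w_j], and [z] is
   the conjugate of [y]. *)
have key (S d x y z i : C) : S != 0 -> i * i = -1 ->
   ((d * S - x * (y + z)) / S ^+ 2 - i * ((i * d * S - x * (i * (z - y))) / S ^+ 2)) / 2 =
   (d * S - x * z) / S ^+ 2.
  move=> S0 ii.
  have -> : (d * S - x * (y + z)) / S ^+ 2 - i * ((i * d * S - x * (i * (z - y))) / S ^+ 2) =
    (d * S - x * (y + z) - (i * i) * (d * S - x * (z - y))) / S ^+ 2 by field.
  by rewrite ii; field.
exact: key.
Qed.

(** The contraction with [v] and its conjugate is what restriction to a complex line in direction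
    [v] sees of the form. *)
Lemma fubini_contract N (v w : 'rV[C]_N) :
  (v *m fubini_study w *m (map_mx conjc v)^T) 0 0 = ('i / (2%:R * pi)%:C) * gform w v w v.
Proof.
rewrite fubini_studyE -scalemxAr -scalemxAl mxE; congr (_ * _).
rewrite mxE /gform.
have s0 : 1 + ip w w != 0.
  by rewrite ip_sqn -(rmorph1 (real_complex R)) -rmorphD fmorph_eq0 gt_eqF // ltr_pwDl ?sqn_ge0.
have -> : \sum_j (v *m \matrix_(j0, k) (((j0 == k)%:R * (1 + ip w w) - w 0 k * (w 0 j0)^*) / (1 + ip w w) ^+ 2)) 0 j *
    ((map_mx conjc v)^T) j 0 =
  \sum_k (v 0 k * (1 + ip w w) - ip v w * w 0 k) / (1 + ip w w) ^+ 2 * (v 0 k)^*.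
  apply: eq_bigr => k _; rewrite !mxE; congr (_ * _).
  under eq_bigr => j _ do rewrite mxE mulrA.
  rewrite -mulr_suml; congr (_ / _).
  under eq_bigr => j _ do rewrite mulrBr.
  rewrite sumrB; congr (_ - _).
    rewrite (bigD1 k) //= eqxx mul1r big1 ?addr0 // => j /negPf jk.
    by rewrite jk mul0r mulr0.
  rewrite /ip mulr_suml; apply: eq_bigr => j _; ring.
transitivity ((\sum_k ((1 + ip w w) * (v 0 k * (v 0 k)^*) - ip v w * (w 0 k * (v 0 k)^*))) / (1 + ip w w) ^+ 2).
  rewrite mulr_suml; apply: eq_bigr => k _; ring.
by rewrite sumrB -!mulr_sumr.
Qed.

Lemma pullback_contract n N (phi : 'rV[C]_n -> 'rV[C]_N) (z v : 'rV[C]_n) :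
  (v *m pullback phi (@fubini_study R N) z *m (map_mx conjc v)^T) 0 0 =
  ('i / (2%:R * pi)%:C) * gform (phi z) ('d phi z v) (phi z) ('d phi z v).
Proof.
have E : 'd phi z v = v *m jacobian phi z by rewrite /jacobian mul_rV_lin1.
by rewrite E -fubini_contract /pullback map_mxM trmx_mul !mulmxA.
Qed.

(** The common factor [i / (2 pi)] and the denominator [b] cancel; the integer weights that remain
    become the exponents of the kernels. *)
Lemma metric_gform n d m (f : 'rV[C]_n -> 'rV[C]_d) (h : 'rV[C]_n -> 'rV[C]_m) (a b c : nat) z :
  (0 < b)%N ->
  fs_modification f (c%:R / b%:R) z = (a%:R / b%:R) *: pullback h (@fubini_study R m) z ->
  forall v, b%:R * gform z v z v + c%:R * gform (f z) ('d f z v) (f z) ('d f z v) =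
    a%:R * gform (h z) ('d h z v) (h z) ('d h z v).
Proof.
move=> b0 E v.
have sc (k : C) (M : 'M[C]_n) : (v *m (k *: M) *m (map_mx conjc v)^T) 0 0 =
    k * (v *m M *m (map_mx conjc v)^T) 0 0.
  by rewrite -scalemxAr -scalemxAl mxE.
have add (M M' : 'M[C]_n) : (v *m (M + M') *m (map_mx conjc v)^T) 0 0 =
    (v *m M *m (map_mx conjc v)^T) 0 0 + (v *m M' *m (map_mx conjc v)^T) 0 0.
  by rewrite mulmxDr mulmxDl mxE.
have lhs := etrans (add (fubini_study z) ((c%:R / b%:R)%:C *: pullback f (@fubini_study R d) z))
  (congr2 +%R (fubini_contract v z) (etrans (sc _ _) (congr1 ( *%R _) (pullback_contract f z v)))).
have rhs := etrans (sc (a%:R / b%:R) (pullback h (@fubini_study R m) z))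
  (congr1 ( *%R _) (pullback_contract h z v)).
have := congr1 (fun M => (v *m M *m (map_mx conjc v)^T) 0 0) E.
move=> /(etrans (esym lhs)) /esym /(etrans (esym rhs)) /esym {lhs rhs}.
have k0 : 'i / (2%:R * pi)%:C != 0 :> C.
  rewrite mulf_neq0 //; first by rewrite eq_complex /= oner_eq0 andbF.
  by rewrite invr_neq0 // fmorph_eq0 mulf_neq0 ?pnatr_eq0 // gt_eqF // pi_gt0.
have bn : b%:R != 0 :> C by rewrite pnatr_eq0 -lt0n.
have -> : (c%:R / b%:R)%:C = c%:R / b%:R :> C.
  by rewrite rmorphM fmorphV /= !rmorph_nat.
move=> H.
apply: (mulfI k0); apply: (mulIf (invr_neq0 bn)).
transitivity ('i / (2%:R * pi)%:C * gform z v z v +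
  c%:R / b%:R * ('i / (2%:R * pi)%:C * gform (f z) ('d f z v) (f z) ('d f z v))).
  by move: (_ / (_)%:C) => k; field.
rewrite H; move: (_ / (_)%:C) => k; ring.
Qed.

End FubiniStudy.

(** * From the metric identity to a factorization of kernels *)

Section KernelFactorization.
Variable R : realType.
Local Notation C := R[i].

Lemma differentiable_box n N (phi : 'rV[C]_n -> 'rV[C]_N) (p : 'rV[C]_n) (e : R) :
  differentiable phi p -> 0 < e ->
  exists2 r : R, 0 < r & forall z, box p r z -> box (phi p) e (phi z).
Proof.
move=> /differentiable_continuous cphi e0; apply/nbhs_boxP; apply: cphi.
by apply/nbhs_boxP; exists e.
Qed.

(** Both values are compared with [phi p], hence half of the tolerance [1 / (N + 1)]. *)
Lemma kern_neq0_near n N (phi : 'rV[C]_n -> 'rV[C]_N) (p : 'rV[C]_n) :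
  differentiable phi p ->
  exists2 r : R, 0 < r & forall z w, box p r z -> box p r w -> kern phi z w != 0.
Proof.
move=> dphi; pose e : R := (N.+1%:R)^-1 / 2.
have q0 : 0 < (N.+1%:R)^-1 :> R by rewrite invr_gt0 ltr0n.
have e0 : 0 < e by rewrite divr_gt0.
have [r r0 H] := differentiable_box dphi e0; exists r => // z w zp wp.
apply: kern_neq0 => k.
have -> : phi z 0 k - phi w 0 k = (phi z 0 k - phi p 0 k) - (phi w 0 k - phi p 0 k) by ring.
apply: le_trans (ncB _ _) _; rewrite [leRHS]splitr.
by apply: lerD; apply: ltW; exact: H.
Qed.

Lemma sesq_kern n N (Om : set 'rV[C]_n) (phi : 'rV[C]_n -> 'rV[C]_N) :
  (forall k, gholo Om (fun z => phi z 0 k)) -> sesq Om (kern phi).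
Proof.
move=> H; apply: (@sesqD _ _ _ (fun _ _ => 1) (fun z w => ip (phi z) (phi w))).
  exact: sesq_cst.
apply: (@sesq_sum _ _ _ _ _ (fun k z w => phi z 0 k * (phi w 0 k)^*)) => k.
exact: (sesqM (sesq_left (H k)) (sesq_right (H k))).
Qed.

Lemma sesq_kernl n N (Om : set 'rV[C]_n) (phi : 'rV[C]_n -> 'rV[C]_N) p :
  (forall k, gholo Om (fun z => phi z 0 k)) -> sesq Om (fun z _ => kern phi z p).
Proof.
move=> H; apply: (@sesqD _ _ _ (fun _ _ => 1) (fun z _ => ip (phi z) (phi p))).
  exact: sesq_cst.
apply: (@sesq_sum _ _ _ _ _ (fun k z _ => phi z 0 k * (phi p 0 k)^*)) => k.
exact: (sesqM (sesq_left (H k)) (sesq_cst (phi p 0 k)^*)).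
Qed.

Lemma sesq_kernr n N (Om : set 'rV[C]_n) (phi : 'rV[C]_n -> 'rV[C]_N) p :
  (forall k, gholo Om (fun z => phi z 0 k)) -> sesq Om (fun _ w => kern phi p w).
Proof.
move=> H; apply: (@sesqD _ _ _ (fun _ _ => 1) (fun _ w => ip (phi p) (phi w))).
  exact: sesq_cst.
apply: (@sesq_sum _ _ _ _ _ (fun k _ w => phi p 0 k * (phi w 0 k)^*)) => k.
exact: (sesqM (sesq_cst (phi p 0 k)) (sesq_right (H k))).
Qed.

(* On lines through [p], one-variable rigidity with [s = t] gives
   [T z z * T p p = T z p * T p z]; this is the diagonal case of the identity to
   be proved. *)
Lemma kernel_factorization n d m (Om : set 'rV[C]_n) (f : 'rV[C]_n -> 'rV[C]_d)
    (h : 'rV[C]_n -> 'rV[C]_m) (a b c : nat) (p : 'rV[C]_n) :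
  open Om -> Om p -> holomorphic_on Om f -> holomorphic_on Om h ->
  (forall z v, Om z -> b%:R * gform z v z v + c%:R * gform (f z) ('d f z v) (f z) ('d f z v) =
    a%:R * gform (h z) ('d h z v) (h z) ('d h z v)) ->
  exists2 s : R, 0 < s & box p s `<=` Om /\ exists (g : 'rV[C]_n -> C) (t : C),
    [/\ t != 0, forall z, box p s z -> g z != 0 &
     forall z w, box p s z -> box p s w ->
       kern id z w ^+ b * kern f z w ^+ c = t * (g z * (g w)^*) * kern h z w ^+ a].
Proof.
move=> oO Op fH hH metric.
have [r0 r00 rO] := open_boxP oO Op.
have [r1 r10 n1] : exists2 r : R, 0 < r & forall z w : 'rV[C]_n, box p r z -> box p r w -> kern id z w != 0.
  by apply: kern_neq0_near; exact: ex_diff.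
have [r2 r20 n2] := kern_neq0_near (fH p Op).
have [r3 r30 n3] := kern_neq0_near (hH p Op).
pose r := Num.min (Num.min r0 r1) (Num.min r2 r3).
have rp : 0 < r by rewrite !lt_min r00 r10 r20 r30.
have [l0 l1 l2 l3] : [/\ r <= r0, r <= r1, r <= r2 & r <= r3].
  by rewrite /r !ge_min !lexx ?orbT.
have {}rO : box p r `<=` Om by move=> z /(box_le l0); exact: rO.
have {}n1 z w : box p r z -> box p r w -> kern (@id 'rV[C]_n) z w != 0.
  by move=> /(box_le l1) ? /(box_le l1) ?; exact: n1.
have {}n2 z w : box p r z -> box p r w -> kern f z w != 0.
  by move=> /(box_le l2) ? /(box_le l2) ?; exact: n2.
have {}n3 z w : box p r z -> box p r w -> kern h z w != 0.
  by move=> /(box_le l3) ? /(box_le l3) ?; exact: n3.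
pose T z w := kern id z w ^+ b * kern f z w ^+ c / kern h z w ^+ a.
have T0 z w : box p r z -> box p r w -> T z w != 0.
  move=> zr wr; rewrite /T !mulf_neq0 ?invr_neq0 // expf_neq0 //;
  by [exact: n1|exact: n2|exact: n3].
have pr : box p r p by exact: box_center.
have diag z : box p (r / 4) z -> T z z * T p p = T z p * T p z.
  (* For [z] in [box p (r / 4)] the line may run over [nc t < 4], and one-variable rigidity on a
     third of this still reaches [t = 1]. *)
  move=> zr; pose l (t : C) := p + t *: (z - p).
  have lr t : nc t < 4 -> box p r (l t).
    move=> t4 j; rewrite /l !mxE addrAC subrr add0r ncM.
    have := zr j; have := nc_ge0 (z 0 j - p 0 j); have := nc_ge0 t; nra.
  have lz : l 1 = z by rewrite /l scale1r subrKC.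
  have lp : l 0 = p by rewrite /l scale0r addr0.
  suff : T (l 1) (l 1) * T (l 0) (l 0) = T (l 1) (l 0) * T (l 0) (l 1) by rewrite lz lp.
  have n11 : nc (1 : C) < 4 / 3 by rewrite ComplexField.Normc.normc1; lra.
  apply: (@one_variable_rigidity R n d m l (fun=> z - p) (f \o l) (fun t => 'd f (l t) (z - p))
    (h \o l) (fun t => 'd h (l t) (z - p)) a b c 4) => //.
  - move=> s k s4; rewrite /l.
    suff -> : (fun t : C => (p + t *: (z - p)) 0 k) = (fun t => p 0 k + (z - p) 0 k * t).
      exact: cder_affine.
    by apply: funext => t; rewrite mxE [X in _ + X]mxE mulrC.
  - by move=> s k s4; apply: differentiable_line; apply: fH; apply: rO; exact: lr.
  - by move=> s k s4; apply: differentiable_line; apply: hH; apply: rO; exact: lr.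
  - by move=> s t /lr sr /lr tr; exact: n1.
  - by move=> s t /lr sr /lr tr; exact: n2.
  - by move=> s t /lr sr /lr tr; exact: n3.
  - by move=> s /lr sr; apply: metric; exact: rO.
pose D := box p (r / 4).
have Dr : D `<=` box p r by apply: box_le; lra.
have D_Om : D `<=` Om by move=> z /Dr; exact: rO.
have idH k : gholo D (fun z => (id z : 'rV[C]_n) 0 k) by exact: gholo_coord.
have fD k : gholo D (fun z => f z 0 k) := gholo_sub D_Om (holo_gholo k fH).
have hD k : gholo D (fun z => h z 0 k) := gholo_sub D_Om (holo_gholo k hH).
have sT : sesq D T.
  apply: (sesqM (sesqM (sesqX b (sesq_kern idH)) (sesqX c (sesq_kern fD)))).
  apply: (@sesqV _ _ D (fun z w => kern h z w ^+ a)); last exact: (sesqX a (sesq_kern hD)).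
  by move=> z w /Dr zr /Dr wr; rewrite expf_neq0 //; exact: n3.
have sTl : sesq D (fun z _ => T z p).
  apply: (sesqM (sesqM (sesqX b (sesq_kernl p idH)) (sesqX c (sesq_kernl p fD)))).
  apply: (@sesqV _ _ D (fun z _ => kern h z p ^+ a)); last exact: (sesqX a (sesq_kernl p hD)).
  by move=> z w /Dr zr /Dr wr; rewrite expf_neq0 //; exact: n3.
have sTr : sesq D (fun _ w => T p w).
  apply: (sesqM (sesqM (sesqX b (sesq_kernr p idH)) (sesqX c (sesq_kernr p fD)))).
  apply: (@sesqV _ _ D (fun _ w => kern h p w ^+ a)); last exact: (sesqX a (sesq_kernr p hD)).
  by move=> z w /Dr zr /Dr wr; rewrite expf_neq0 //; exact: n3.
(* A third of [r / 4], since polarization again runs over [nc s < 2]. *)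
exists (r / 12); first lra; split.
  by apply: subset_trans rO; apply: box_le; lra.
(* What remains is [T z w = T z p * T p w / T p p], where [T p w] is the conjugate of [T w p]. *)
exists (fun z => T z p), (T p p)^-1.
have r12 z : box p (r / 12) z -> box p r z by apply: box_le; lra.
split; first by rewrite invr_neq0 // T0.
  by move=> z /r12 zr; exact: T0.
move=> z w zs ws.
have Tc : (T w p)^* = T p w.
  by rewrite /T rmorphM fmorphV rmorphM !rmorphXn /= !kernC.
have : T z w * T p p + (-1) * (T z p * T p w) = 0.
  pose E z w := T z w * T p p + (-1) * (T z p * T p w).
  apply: (@polarization R _ D E z w).
  - move=> s s2 j; rewrite !mxE.
    have -> : 2^-1 * (z 0 j + w 0 j) + s * ((2 * 'i)^-1 * (z 0 j - w 0 j)) - p 0 j =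
      2^-1 * ((z 0 j - p 0 j) + (w 0 j - p 0 j)) +
      s * ((2 * 'i)^-1 * ((z 0 j - p 0 j) - (w 0 j - p 0 j))).
      have -> : z 0 j - p 0 j - (w 0 j - p 0 j) = z 0 j - w 0 j by ring.
      by move: (s * _) => q; field.
    have := zs j; have := ws j; set u := z 0 j - p 0 j; set v := w 0 j - p 0 j => vs us.
    apply: le_lt_trans (ncD _ _) _; rewrite !ncM !ncV ncM nci.
    have -> : nc (2 : C) = 2 by rewrite -(rmorph_nat (real_complex R)) ncC ger0_norm.
    have := ncD u v; have := ncB u v; have := nc_ge0 s; have := nc_ge0 (u - v).
    move: (nc _) (nc _) (nc _) (nc _) (nc _) us vs s2 => x1 x2 x3 x4 x5 *; nra.
  - exact: (sesqD (sesqM sT (sesq_cst (T p p))) (sesqM (sesq_cst (-1)) (sesqM sTl sTr))).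
  - by move=> u /diag; rewrite /E mulN1r => ->; rewrite subrr.
move=> /eqP; rewrite mulN1r subr_eq0 => /eqP H.
have ha0 : kern h z w ^+ a != 0 by rewrite expf_neq0 //; apply: n3; apply: (r12).
have -> : kern id z w ^+ b * kern f z w ^+ c = T z w * kern h z w ^+ a.
  by rewrite /T mulfVK.
by congr (_ * _); rewrite Tc -H mulrC mulfK //; exact: T0.
Qed.

End KernelFactorization.

(** * Ranks of families of functions *)

Section PointRank.
Variables (K : fieldType) (T : Type).
Implicit Types (S : set T).

(** Relations among the columns reflect relations between functions; relations among the rows are
    those that Gram kernels detect. *)
Definition pts N (phi : T -> 'rV[K]_N) k (q : 'I_k -> T) : 'M[K]_(k, N) :=
  \matrix_(i, j) phi (q i) 0 j.

Lemma row_pts N (phi : T -> 'rV[K]_N) k (q : 'I_k -> T) i : row i (pts phi q) = phi (q i).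
Proof. by apply/rowP => j; rewrite !mxE. Qed.

Definition spanned N M S (phi : T -> 'rV[K]_N) (psi : T -> 'rV[K]_M) :=
  forall j, exists c : 'cV[K]_M, forall z, S z -> phi z 0 j = (psi z *m c) 0 0.

Lemma spannedP N M S (phi : T -> 'rV[K]_N) (psi : T -> 'rV[K]_M) :
  spanned S phi psi -> exists D : 'M[K]_(M, N), forall z, S z -> phi z = psi z *m D.
Proof.
move=> /choice[c cP]; exists (\matrix_(k, j) c j k 0) => z Sz.
apply/rowP => j; rewrite (cP j z Sz) !mxE; apply: eq_bigr => k _.
by rewrite !mxE.
Qed.

Lemma spanned_sub N M S S' (phi : T -> 'rV[K]_N) (psi : T -> 'rV[K]_M) :
  S' `<=` S -> spanned S phi psi -> spanned S' phi psi.
Proof. by move=> sub H j; have [c cP] := H j; exists c => z /sub; exact: cP. Qed.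

Lemma spanned_refl N S (phi : T -> 'rV[K]_N) : spanned S phi phi.
Proof.
by move=> j; exists (delta_mx j 0) => z _; rewrite -colE mxE.
Qed.

Lemma spanned_trans N M L S (phi : T -> 'rV[K]_N) (psi : T -> 'rV[K]_M) (chi : T -> 'rV[K]_L) :
  spanned S phi psi -> spanned S psi chi -> spanned S phi chi.
Proof.
move=> H /spannedP[D DP] j; have [c cP] := H j; exists (D *m c) => z Sz.
by rewrite (cP z Sz) (DP z Sz) mulmxA.
Qed.

Lemma rank_spanned N M S (phi : T -> 'rV[K]_N) (psi : T -> 'rV[K]_M) k (q : 'I_k -> T) :
  spanned S phi psi -> (forall i, S (q i)) -> (\rank (pts phi q) <= \rank (pts psi q))%N.
Proof.
move=> /spannedP[D DP] Sq; have -> : pts phi q = pts psi q *m D.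
  apply/row_matrixP => i; rewrite row_mul !row_pts; exact: DP.
exact: mxrankM_maxl.
Qed.

(** Take points for which the rank, bounded by [N], is maximal: a further point cannot raise it, so
    its row already lies in the row space. *)
Lemma exists_spanning_points N S (phi : T -> 'rV[K]_N) :
  exists k (q : 'I_k -> T), (forall i, S (q i)) /\ forall z, S z -> (phi z <= pts phi q)%MS.
Proof.
pose P r := `[< exists k (q : 'I_k -> T), (forall i, S (q i)) /\ \rank (pts phi q) = r >].
have exP : exists r, P r.
  exists 0%N; apply/asboolP; exists 0%N, (fun i : 'I_0 => match i with Ordinal k h => False_rect _ (notF h) end).
  by split=> [[]//|]; apply/eqP; rewrite -leqn0 rank_leq_row.
have bP r : P r -> (r <= N)%N.
  by move=> /asboolP[k [q [_ <-]]]; exact: rank_leq_col.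
case: (ex_maxnP exP bP) => r /asboolP[k [q [Sq rq]]] rmax.
exists k, q; split => // z Sz.
pose q' (i : 'I_(k + 1)) := if fintype.split i is inl i' then q i' else z.
have E : pts phi q' = col_mx (pts phi q) (phi z).
  apply/matrixP => i j; rewrite !mxE /q'; case: fintype.splitP => i' _ //; first by rewrite mxE.
  by rewrite (ord1 i').
have : (\rank (pts phi q') <= r)%N.
  apply: rmax; apply/asboolP; exists (k + 1)%N, q'; split => // i.
  by rewrite /q'; case: fintype.split.
rewrite E -rq => le1.
have : (pts phi q == col_mx (pts phi q) (phi z))%MS.
  have sub : (pts phi q <= col_mx (pts phi q) (phi z))%MS by rewrite -addsmxE addsmxSl.
  by rewrite -(mxrank_leqif_eq sub).2 eqn_leq le1 mxrankS.
move=> /andP[_]; apply: submx_trans; by rewrite -addsmxE addsmxSr.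
Qed.

(** A relation among the columns at spanning points holds on all of [S], so there is none. *)
Lemma comp_freeP N S (B : T -> 'rV[K]_N) :
  comp_free S B -> exists k (q : 'I_k -> T), (forall i, S (q i)) /\ \rank (pts B q) = N.
Proof.
move=> fB; have [k [q [Sq qP]]] := exists_spanning_points S B.
exists k, q; split => //; apply/eqP; rewrite -mxrank_tr -/(row_free _).
apply: inj_row_free => v v0; have : v^T = 0.
  apply: fB => z /qP /submxP[u ->].
  by rewrite -mulmxA -[pts B q]trmxK -trmx_mul v0 trmx0 mulmx0 mxE.
by move=> /(congr1 trmx); rewrite trmxK trmx0.
Qed.

(** A basis among the rows gives points at which [B] can be normalized to the Kronecker symbol. *)
Lemma comp_free_invertible N S (B : T -> 'rV[K]_N) :
  comp_free S B -> exists q : 'I_N -> T, (forall i, S (q i)) /\ pts B q \in unitmx.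
Proof.
move=> /comp_freeP[k [q [Sq rq]]].
have fq : row_full (pts B q) by apply/eqP.
exists (fun i => q (fullrankfun fq i)); split => //.
have -> : pts B (fun i => q (fullrankfun fq i)) = rowsub (fullrankfun fq) (pts B q).
  by apply/matrixP => i j; rewrite !mxE.
by rewrite -row_full_unit fullrowsub_full.
Qed.

(** The rank-one matrix [c *m c'^T] is the product of two linear forms, read as a form on the tensor
    product. *)
Lemma tensor_pairing p r (phi : T -> 'rV[K]_p) (psi : T -> 'rV[K]_r)
    (c : 'cV[K]_p) (c' : 'cV[K]_r) z :
  (tensor phi psi z *m (mxvec (c *m c'^T))^T) 0 0 = (phi z *m c) 0 0 * (psi z *m c') 0 0.
Proof.
rewrite /tensor; have -> : \matrix_(i, j) (phi z 0 i * psi z 0 j) = (phi z)^T *m psi z.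
  by apply/matrixP => i j; rewrite !mxE big_ord1 !mxE.
rewrite mxvec_dotmul mulmxA -mulmxA -[c'^T *m _]trmxK trmx_mul !trmxK.
by rewrite mxE big_ord1 [in X in _ * X]mxE.
Qed.

Lemma spanned_tensor p p' r r' S (phi : T -> 'rV[K]_p) (phi' : T -> 'rV[K]_p')
    (psi : T -> 'rV[K]_r) (psi' : T -> 'rV[K]_r') :
  spanned S phi phi' -> spanned S psi psi' -> spanned S (tensor phi psi) (tensor phi' psi').
Proof.
move=> H H' k; case/mxvec_indexP: k => i j; have [c cP] := H i; have [c' cP'] := H' j.
exists (mxvec (c *m c'^T))^T => z Sz.
by rewrite tensor_pairing /tensor mxvecE mxE (cP z Sz) (cP' z Sz).
Qed.

(** With 1 in the span of a factor, tensoring by this factor keeps the functions already present. *)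
Definition has_one S N (phi : T -> 'rV[K]_N) :=
  exists c : 'cV[K]_N, forall z, S z -> (phi z *m c) 0 0 = 1.

Lemma has_one_tensor S p r (phi : T -> 'rV[K]_p) (psi : T -> 'rV[K]_r) :
  has_one S phi -> has_one S psi -> has_one S (tensor phi psi).
Proof.
move=> [c cP] [c' cP']; exists (mxvec (c *m c'^T))^T => z Sz.
by rewrite tensor_pairing cP ?cP' ?mulr1.
Qed.

Lemma spanned_tensorl S p r (phi : T -> 'rV[K]_p) (psi : T -> 'rV[K]_r) :
  has_one S psi -> spanned S phi (tensor phi psi).
Proof.
move=> [c' cP'] j; have [c cP] := @spanned_refl _ S phi j.
exists (mxvec (c *m c'^T))^T => z Sz; by rewrite tensor_pairing cP' // mulr1; exact: cP.
Qed.

Lemma has_one_pow S p (phi : T -> 'rV[K]_p) k : has_one S phi -> has_one S (tensor_pow phi k).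
Proof.
move=> H; elim: k => [|[|k] IH] //; last exact: has_one_tensor.
by exists (const_mx 1) => z _; rewrite mxE big_ord1 !mxE mulr1.
Qed.

(** All factors beyond the first two are filled with 1. *)
Lemma spanned_pow2 S p (phi : T -> 'rV[K]_p) k : has_one S phi -> (1 < k)%N ->
  spanned S (tensor phi phi) (tensor_pow phi k).
Proof.
case: k => [|[|k]] // H _; apply: spanned_tensor; first exact: spanned_refl.
by case: k => [|k]; [exact: spanned_refl|exact: (spanned_tensorl _ (has_one_pow k.+1 H))].
Qed.

Lemma tensor_pow_pairing p (phi : T -> 'rV[K]_p) k (l : 'I_k -> 'cV[K]_p) :
  exists g : 'cV[K]_(p ^ k), forall z, (tensor_pow phi k z *m g) 0 0 = \prod_i (phi z *m l i) 0 0.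
Proof.
elim: k l => [|[|k] IH] l.
- by exists (const_mx 1) => z; rewrite big_ord0 mxE big_ord1 !mxE mulr1.
- by exists (l ord0) => z; rewrite big_ord1.
have [g gP] := IH (fun i => l (lift ord0 i)).
exists (mxvec (l ord0 *m g^T))^T => z.
by rewrite [tensor_pow _ _ _]/(tensor phi (tensor_pow phi k.+1) z) tensor_pairing gP [RHS]big_ord_recl.
Qed.

Lemma tensor_pow_comp p (phi : T -> 'rV[K]_p) k j :
  exists t : k.-tuple 'I_p, forall z, tensor_pow phi k z 0 j = \prod_(x <- t) phi z 0 x.
Proof.
elim: k j => [|[|k] IH] j.
- by exists [tuple] => z; rewrite big_nil mxE.
- by exists [tuple j] => z; rewrite big_seq1.
case/mxvec_indexP: j => i j; have [t tP] := IH j.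
exists [tuple of i :: t] => z; rewrite big_cons -tP.
by rewrite [tensor_pow _ _ _]/(tensor phi (tensor_pow phi k.+1) z) /tensor mxvecE mxE.
Qed.

(** The components are monomials, unchanged when the index tuple is sorted, and ['C(a + m, a)]
    counts the sorted [a]-tuples in [m + 1] letters. *)
Lemma rank_tensor_pow_le S m (phi : T -> 'rV[K]_m.+1) a k (q : 'I_k -> T) :
  (forall i, S (q i)) -> (\rank (pts (tensor_pow phi a) q) <= 'C(a + m, a))%N.
Proof.
move=> Sq; rewrite -card_sorted_tuples; set A := [set t | _]%SET.
pose mon z : 'rV[K]_#|A| := \row_i \prod_(x <- (enum_val i : a.-tuple 'I_m.+1)) phi z 0 x.
apply: leq_trans (rank_leq_col (pts mon q)); apply: rank_spanned Sq => j.
have [t tP] := tensor_pow_comp phi j.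
pose leI (x y : 'I_m.+1) := (x <= y)%N.
pose s := [tuple of sort leI t].
have sA : s \in A.
  rewrite inE /= sorted_map; apply: sort_sorted => x y; exact: leq_total.
exists (delta_mx (enum_rank_in sA s) 0) => z Sz.
rewrite tP -colE mxE.
rewrite mxE enum_rankK_in //; apply: perm_big; rewrite perm_sym; exact/permPl/perm_sort.
Qed.

(* Points are added one at a time.  The previous ones, at most [c d] in number,
   are split into [c] blocks of [d], each killed by some nonzero linear form; the
   new point is chosen off the zero set of the product of these forms. *)
Lemma rank_tensor_pow_ge S d (phi : T -> 'rV[K]_d.+1) c : (exists z, S z) ->
  (forall l : 'I_c -> 'cV[K]_d.+1, (forall i, l i != 0) ->
     exists2 z, S z & \prod_i (phi z *m l i) 0 0 != 0) ->
  exists q : 'I_(c * d).+1 -> T, (forall i, S (q i)) /\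
    \rank (pts (tensor_pow phi c) q) = (c * d).+1.
Proof.
move=> [z0 Sz0] dom.
suff H k : (k <= (c * d).+1)%N -> exists q : nat -> T, (forall i, S (q i)) /\
    row_free (pts (tensor_pow phi c) (fun i : 'I_k => q i)).
  have [q [Sq fq]] := H _ (leqnn _); exists (fun i => q i); split => //.
  exact/eqP.
elim: k => [_|k IH kcd].
  exists (fun=> z0); split => //; rewrite /row_free; apply/eqP/eqP.
  by rewrite -leqn0 rank_leq_row.
have [q [Sq fq]] := IH (ltnW kcd).
have exl (i : 'I_c) : exists l : 'cV[K]_d.+1, l != 0 /\
    forall r, (r < d)%N -> (phi (q (i * d + r)%N) *m l) 0 0 = 0.
  pose M := pts phi (fun r : 'I_d => q (i * d + r)%N).
  have : kermx M^T != 0.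
    by rewrite kermx_eq0 /row_free mxrank_tr; apply: contraTN (rank_leq_row M) => /eqP ->; rewrite ltnn.
  move=> /rowV0Pn[v /sub_kermxP vM v0]; exists v^T; split.
    by apply: contraNneq v0 => /(congr1 trmx); rewrite trmxK trmx0 => ->.
  move=> r rd; have : (M *m v^T) (Ordinal rd) 0 = 0.
    by rewrite -[M]trmxK -trmx_mul vM trmx0 mxE.
  by rewrite -[RHS]/(0 : K) => <-; rewrite !mxE; apply: eq_bigr => j _; rewrite !mxE.
have [l lP] := choice exl.
have [z Sz pz] := dom l (fun i => (lP i).1).
have [g gP] := tensor_pow_pairing phi l.
exists (fun i => if (i < k)%N then q i else z); split; first by move=> i; case: ifP.
apply: inj_row_free => v v0.
have gq (i : 'I_k) : (tensor_pow phi c (q i) *m g) 0 0 = 0.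
  (* For [d = 0] there is no previous point, so the existence of the index [i] excludes this
     case. *)
  have d0 : (0 < d)%N.
    have k0 : (0 < k)%N := leq_ltn_trans (leq0n i) (ltn_ord i).
    by rewrite lt0n; apply: contraTneq kcd => ->; rewrite muln0 ltnS -ltnNge.
  have ic : (i %/ d < c)%N.
    by rewrite ltn_divLR //; apply: leq_trans (ltn_ord i) _.
  rewrite gP (bigD1 (Ordinal ic)) //=.
  have -> : q i = q ((Ordinal ic : nat) * d + i %% d)%N by rewrite /= -divn_eq.
  by rewrite (lP (Ordinal ic)).2 ?mul0r // ltn_pmod.
(* Pairing with [g] kills the rows of the old points but not that of [z], which isolates the last
   coefficient. *)
have vlast : v 0 ord_max = 0.
  have : (v *m pts (tensor_pow phi c) (fun i : 'I_k.+1 => if (i < k)%N then q i else z) *m g) 0 0 = 0.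
    by rewrite v0 mul0mx mxE.
  rewrite -mulmxA mxE (bigD1 ord_max) //= big1 ?addr0.
    have -> : (pts (tensor_pow phi c) (fun i : 'I_k.+1 => if (i < k)%N then q i else z) *m g) ord_max 0 =
        (tensor_pow phi c z *m g) 0 0.
      by rewrite !mxE; apply: eq_bigr => j _; rewrite !mxE /= ltnn.
    by rewrite gP => /eqP; rewrite mulf_eq0 (negPf pz) orbF => /eqP.
  move=> i im; have ik : (i < k)%N.
    by have := ltn_ord i; rewrite ltnS leq_eqVlt => /orP[/eqP e|//]; case/eqP: im; exact: val_inj.
  have -> : (pts (tensor_pow phi c) (fun i : 'I_k.+1 => if (i < k)%N then q i else z) *m g) i 0 =
      (tensor_pow phi c (q (Ordinal ik)) *m g) 0 0.
    by rewrite !mxE; apply: eq_bigr => j _; rewrite !mxE /= ik.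
  by rewrite gq mulr0.
have : (\row_(i < k) v 0 (widen_ord (leqnSn k) i)) *m
    pts (tensor_pow phi c) (fun i : 'I_k => q i) = 0.
  rewrite -v0; apply/rowP => j; rewrite !mxE big_ord_recr /= vlast mul0r addr0.
  by apply: eq_bigr => i _; rewrite !mxE /= ltn_ord.
move=> /eqP; rewrite mulmx_free_eq0 // => /eqP E; apply/rowP => i; rewrite [RHS]mxE.
have := ltn_ord i; rewrite ltnS leq_eqVlt => /orP[/eqP ik|ik].
  by have -> : i = ord_max by exact: val_inj.
have := congr1 (fun u : 'rV_k => u 0 (Ordinal ik)) E; rewrite !mxE => <-.
by congr (v 0 _); exact: val_inj.
Qed.

End PointRank.

(** * Gram kernels and linear syzygies *)

Section RankComparison.
Variable R : realType.
Local Notation C := R[i].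

(** This makes products and powers of kernels the Gram kernels of tensor products and powers. *)
Lemma ip_tensor (T : Type) p r (phi : T -> 'rV[C]_p) (psi : T -> 'rV[C]_r) z w :
  ip (tensor phi psi z) (tensor phi psi w) = ip (phi z) (phi w) * ip (psi z) (psi w).
Proof.
rewrite /ip (reindex _ (curry_mxvec_bij _ _)) /=.
rewrite mulr_suml; under [RHS]eq_bigr do rewrite mulr_sumr.
rewrite pair_bigA; apply: eq_bigr => -[i j] _ /=.
by rewrite /tensor !mxvecE !mxE rmorphM /=; ring.
Qed.

Lemma ip_tensor_pow (T : Type) p (phi : T -> 'rV[C]_p) k z w :
  ip (tensor_pow phi k z) (tensor_pow phi k w) = ip (phi z) (phi w) ^+ k.
Proof.
elim: k => [|[|k] IH]; last by rewrite exprS -IH -ip_tensor.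
  by rewrite /ip big_ord1 !mxE rmorph1 mulr1.
by rewrite expr1.
Qed.

Lemma ip_with_one (T : Type) N (phi : T -> 'rV[C]_N) z w :
  ip (with_one phi z) (with_one phi w) = kern phi z w.
Proof.
rewrite /ip /kern /with_one big_split_ord big_ord1 !row_mxEl !mxE eqxx conjc1 mulr1.
by congr (_ + _); apply: eq_bigr => k _; rewrite !row_mxEr.
Qed.

Lemma ip_eq0 N (v : 'rV[C]_N) : ip v v = 0 -> v = 0.
Proof.
rewrite ip_sqn => /eqP; rewrite fmorph_eq0 => /eqP v0.
apply/rowP => j; rewrite mxE; apply/eqP; rewrite -nc_eq0 -sqrf_eq0.
move: v0; rewrite /sqn (bigD1 j) //= => /eqP.
rewrite paddr_eq0 ?sqr_ge0 //; first by case/andP.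
by apply: sumr_ge0 => k _; exact: sqr_ge0.
Qed.

Lemma ip_mulmx_pts (T : Type) N (phi : T -> 'rV[C]_N) k (q : 'I_k -> T) (x : 'rV[C]_k) :
  ip (x *m pts phi q) (x *m pts phi q) =
  \sum_i \sum_j x 0 i * (x 0 j)^* * ip (phi (q i)) (phi (q j)).
Proof.
rewrite /ip; transitivity (\sum_l \sum_i \sum_j
    (x 0 i * phi (q i) 0 l) * (x 0 j * phi (q j) 0 l)^*).
  apply: eq_bigr => l _; rewrite !mxE rmorph_sum mulr_suml; apply: eq_bigr => i _.
  rewrite mulr_sumr; apply: eq_bigr => j _; by rewrite !mxE.
rewrite exchange_big; apply: eq_bigr => i _; rewrite exchange_big; apply: eq_bigr => j _.
rewrite mulr_sumr; apply: eq_bigr => l _; rewrite rmorphM /=; ring.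
Qed.

(* The Gram matrices determine which combinations of the rows vanish. *)
Lemma rank_gram (T : Type) (S : set T) N M (P : T -> 'rV[C]_N) (H : T -> 'rV[C]_M)
    (g : T -> C) (t : C) k (q : 'I_k -> T) :
  t != 0 -> (forall z, S z -> g z != 0) ->
  (forall z w, S z -> S w -> ip (P z) (P w) = t * (g z * (g w)^*) * ip (H z) (H w)) ->
  (forall i, S (q i)) -> \rank (pts P q) = \rank (pts H q).
Proof.
move=> t0 g0 PH Sq.
pose D : 'M[C]_k := diag_mx (\row_i g (q i)).
have Du : D \in unitmx.
  rewrite unitmxE det_diag unitfE; apply/prodf_neq0 => i _; rewrite mxE; exact: g0.
have E (x : 'rV[C]_k) : ip (x *m pts P q) (x *m pts P q) =
    t * ip (x *m D *m pts H q) (x *m D *m pts H q).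
  rewrite !ip_mulmx_pts mulr_sumr; apply: eq_bigr => i _.
  rewrite mulr_sumr; apply: eq_bigr => j _.
  by rewrite PH // /D mul_mx_diag !mxE rmorphM /=; ring.
have kE : (kermx (pts P q) :=: kermx (D *m pts H q))%MS.
  apply/eqmxP/andP; split; apply/rV_subP => x /sub_kermxP x0; apply/sub_kermxP.
    apply: ip_eq0; rewrite mulmxA; apply/eqP.
    have /eqP := E x; rewrite x0 {1}/ip big1; last by move=> i _; rewrite !mxE mul0r.
    by rewrite eq_sym mulf_eq0 (negPf t0).
  apply: ip_eq0; rewrite E -mulmxA x0 /ip big1 ?mulr0 // => i _.
  by rewrite !mxE mul0r.
have : \rank (pts P q) = \rank (D *m pts H q).
  have := mxrank_ker (pts P q); rewrite kE mxrank_ker => /eqP.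
  have h1 := rank_leq_row (pts P q); have h2 := rank_leq_row (D *m pts H q).
  by move=> /eqP h; lia.
by move=> ->; rewrite (eqmxMfull _ _) // row_full_unit.
Qed.

End RankComparison.

Section Syzygies.
Variable R : realType.
Local Notation C := R[i].

(** Indexes the values [L_j(t_i)], [i < j], that determine a linear syzygy. *)
Definition below e : pred ('I_e.+1 * 'I_e.+1) := fun ij => (ij.1 < ij.2)%N.

Lemma card_below e : #|@below e| = 'C(e.+1, 2).
Proof.
rewrite -sum1_card /= (eq_bigl (fun ij : 'I_e.+1 * 'I_e.+1 => true && (ij.1 < ij.2)%N)) //.
rewrite -(pair_big_dep xpredT (fun i j : 'I_e.+1 => (i < j)%N) (fun _ _ => 1%N)) /=.
rewrite (exchange_big_dep xpredT) //= -bin2_sum big_mkord; apply: eq_bigr => j _.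
by rewrite -(big_ord_widen _ (fun=> 1%N) (ltnW (ltn_ord j))) sum1_card card_ord.
Qed.

(* With [L z = (1, z) A], the columns [L_0, L_1, ...] vanish successively: once
   those before [i] do, [L] vanishes at [t i], so that on a line through [t i] the
   relation reads [s * (l . Y) = 0] with [l] constant, and [l_i = 0] by continuity
   at [s = 0]. *)
Lemma syzygy_zero n e (S : set 'rV[C]_n) (Y : 'rV[C]_n -> 'rV[C]_e.+1)
    (t : 'I_e.+1 -> 'rV[C]_n) (A : 'M[C]_(1 + n, e.+1)) :
  open S -> (forall j, gholo S (fun z => Y z 0 j)) ->
  (forall i, S (t i)) -> (forall i, Y (t i) = delta_mx 0 i) ->
  (forall z, S z -> (with_one id z *m A *m (Y z)^T) 0 0 = 0) ->
  (forall i j : 'I_e.+1, (i < j)%N -> (with_one id (t i) *m A) 0 j = 0) -> A = 0.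
Proof.
move=> oS hY St Yt rel tri.
pose A1 := usubmx A; pose A2 := dsubmx A.
have LE z : with_one id z *m A = A1 + z *m A2.
  by rewrite -[A in LHS]vsubmxK /with_one mul_row_col mul1mx.
suff step (i : 'I_e.+1) : (forall j : 'I_e.+1, (j < i)%N -> forall k, A k j = 0) -> forall k, A k i = 0.
  apply/matrixP => k i; rewrite mxE; move: k.
  have [m] := ubnP (val i); elim: m i => // m IH i im; apply: step => j ji.
  by apply: IH; exact: leq_trans ji im.
move=> prev.
(* At [t i] the earlier entries of [L] vanish by induction, the later ones by [tri], and the [i]-th
   by the relation, as [Y (t i)] is the [i]-th unit vector. *)
have Li : A1 + t i *m A2 = 0.
  rewrite -LE; apply/rowP => j; rewrite [RHS]mxE; case: (ltngtP j i) => [ji|ij|/val_inj ->].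
  - by rewrite mxE big1 // => k _; rewrite prev // mulr0.
  - exact: tri.
  - by have := rel _ (St i); rewrite Yt trmx_delta -colE mxE.
have A2i k : A2 k i = 0.
  pose F s := \sum_j A2 k j * Y (t i + s *: delta_mx 0 k) 0 j.
  have [r r0 rS] := open_boxP oS (St i).
  have Fs s : nc s < r -> s != 0 -> F s = 0.
    move=> sr s0; have Sz : S (t i + s *: delta_mx 0 k).
      apply: rS => j; rewrite !mxE addrAC subrr add0r mulr_natr.
      by case: (_ && _); rewrite ?mulr1n // mulr0n nc0.
    have := rel _ Sz; rewrite LE [_ *m A2]mulmxDl addrA Li add0r -scalemxAl -rowE mxE => H.
    apply: (mulfI s0); rewrite mulr0 -H /F mulr_sumr; apply: eq_bigr => j _.
    by rewrite !mxE mulrA.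
  have [l Fl] : exists l, cder F 0 l.
    have : gholo S (fun z => \sum_j A2 k j * Y z 0 j).
      by apply: (@gholo_sum _ _ _ _ _ (fun j z => A2 k j * Y z 0 j)) => j;
        exact: (gholoM (@gholo_cst _ _ S (A2 k j)) (hY j)).
    by apply; rewrite scale0r addr0.
  have F0 : F 0 = A2 k i.
    transitivity ((A2 *m (delta_mx 0 i : 'rV_e.+1)^T) k 0); last by rewrite trmx_delta -colE mxE.
    by rewrite /F scale0r addr0 Yt mxE; apply: eq_bigr => j _; congr (_ * _); rewrite [RHS]mxE.
  rewrite -F0; apply/eqP/negPn/negP; rewrite -nc_gt0 => F00.
  have [d d0 H] := cder_cont Fl F00.
  pose s : R := Num.min (d / 2) (r / 2).
  have s0 : 0 < s by rewrite lt_min; lra.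
  have sd : s < d by apply: (@le_lt_trans _ _ (d / 2)); [rewrite ge_min lexx|lra].
  have sr : s < r by apply: (@le_lt_trans _ _ (r / 2)); [rewrite ge_min lexx orbT|lra].
  have := H s%:C; rewrite subr0 ncC gtr0_norm // => /(_ sd).
  rewrite Fs ?sub0r ?ncN ?ltxx // ?ncC ?gtr0_norm //.
  by rewrite fmorph_eq0 gt_eqF.
move=> k; rewrite -[A]vsubmxK; case: (split_ordP k) => k' ->.
  rewrite col_mxEu (ord1 k') -/A1; have := congr1 (fun M : 'rV_e.+1 => M 0 i) Li.
  by rewrite !mxE big1 ?addr0 // => j _; rewrite A2i mulr0.
by rewrite col_mxEd -/A2 A2i.
Qed.

(** At spanning points with value matrix [X], the syzygies are the kernel of [X^T], of codimension
    [\rank X]; the kernel of [ev] has codimension at most ['C(e.+1, 2)]. By [syzygy_zero] they meet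
    only in 0, so the codimensions sum to at least [(1 + n) * e.+1]. *)
Lemma rank_tensor_affine n e (S : set 'rV[C]_n) (Y : 'rV[C]_n -> 'rV[C]_e.+1) :
  open S -> (forall j, gholo S (fun z => Y z 0 j)) -> comp_free S Y ->
  exists k (q : 'I_k -> 'rV[C]_n), (forall i, S (q i)) /\
    ((1 + n) * e.+1 <= \rank (pts (tensor (with_one id) Y) q) + 'C(e.+1, 2))%N.
Proof.
move=> oS hY /comp_free_invertible[t [St tu]].
pose Y' z := Y z *m invmx (pts Y t).
have Yt i : Y' (t i) = delta_mx 0 i.
  by rewrite /Y' -row_pts -row_mul mulmxV // row1.
have hY' j : gholo S (fun z => Y' z 0 j) by exact: gholo_mulmx.
have sY : spanned S Y' Y.
  move=> j; exists (col j (invmx (pts Y t))) => z _.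
  by rewrite /Y' !mxE; apply: eq_bigr => k _; rewrite !mxE.
have [k [q [Sq qP]]] := exists_spanning_points S (tensor (with_one id) Y').
exists k, q; split => //.
have le1 : (\rank (pts (tensor (with_one id) Y') q) <= \rank (pts (tensor (with_one id) Y) q))%N.
  by apply: rank_spanned Sq; apply: spanned_tensor sY; exact: spanned_refl.
apply: leq_trans (leq_add le1 (leqnn _)); rewrite -card_below.
set X := pts _ q in qP *.
(* The linear map from [mxvec A] to the values [L_j(t_i)], [i < j], of [L z = (1, z) A]. *)
pose ev : 'M[C]_((1 + n) * e.+1, #|@below e|) := \matrix_(a, b)
  (with_one id (t (enum_val b).1) *m vec_mx (delta_mx 0 a)) 0 (enum_val b).2.
have evE (A : 'M[C]_(1 + n, e.+1)) b :
    (mxvec A *m ev) 0 b = (with_one id (t (enum_val b).1) *m A) 0 (enum_val b).2.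
  have {2}-> : A = \sum_a mxvec A 0 a *: vec_mx (delta_mx 0 a).
    rewrite -[LHS]mxvecK [X in vec_mx X = _]row_sum_delta linear_sum.
    by apply: eq_bigr => a _; rewrite linearZ.
  rewrite mulmx_sumr summxE mxE; apply: eq_bigr => a _.
  by rewrite -scalemxAr [ev _ _]mxE [RHS]mxE.
suff inj : (kermx X^T :&: kermx ev)%MS = 0.
  have := mxrank_sum_cap (kermx X^T) (kermx ev); rewrite inj mxrank0 addn0 !mxrank_ker mxrank_tr.
  have := rank_leq_col (kermx X^T + kermx ev)%MS; have := rank_leq_col ev.
  have := rank_leq_col X; lia.
apply/eqP; rewrite -submx0; apply/rV_subP => x; rewrite sub_capmx => /andP[/sub_kermxP xX /sub_kermxP xe].
rewrite submx0 -[x]vec_mxK; apply/eqP; rewrite (_ : vec_mx x = 0) ?linear0 //.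
apply: (syzygy_zero oS hY' St Yt).
  move=> z Sz; have /submxP[u uP] := qP z Sz.
  transitivity ((tensor (with_one id) Y' z *m x^T) 0 0).
    rewrite -[x in RHS]vec_mxK -mxvec_dotmul /tensor; congr ((mxvec _ *m _) 0 0).
    by apply/matrixP => i j; rewrite !mxE big_ord1 !mxE.
  transitivity ((u *m X *m x^T) 0 0); first by congr ((_ *m _) 0 0).
  by rewrite -mulmxA -[X]trmxK -trmx_mul xX trmx0 mulmx0 mxE.
move=> i j ij; pose b := enum_rank_in (ij : (i, j) \in @below e) (i, j).
have := evE (vec_mx x) b; rewrite vec_mxK xe mxE /b enum_rankK_in //=.
Qed.

End Syzygies.

(** * Proof of the theorem *)

Section Domain.
Variable R : realType.
Local Notation C := R[i].

(** On the line from [z0] to a nearby [z], [F] is nonzero close to [z0], so [G] vanishes there and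
    hence at [z]; [gholo_identity] spreads this over [Om]. *)
Lemma gholo_domain n (Om : set 'rV[C]_n) (F G : 'rV[C]_n -> C) z0 :
  open Om -> connected Om -> gholo Om F -> gholo Om G ->
  (forall z, Om z -> F z * G z = 0) -> Om z0 -> F z0 != 0 -> forall z, Om z -> G z = 0.
Proof.
move=> oO cO FH GH FG Oz0 Fz0; have [r r0 rO] := open_boxP oO Oz0.
have r2 : 0 < r / 2 by lra.
apply: (gholo_identity oO cO GH Oz0 r2) => z zr.
have lr t : nc t < 2 -> Om (z0 + t *: (z - z0)).
  move=> t2; apply: rO => j; rewrite !mxE addrAC subrr add0r ncM.
  have := zr j; have := nc_ge0 (z 0 j - z0 0 j); have := nc_ge0 t; nra.
have n0 : nc (0 : C) < 2 by rewrite nc0.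
have [l Fl] := FH z0 (z - z0) 0 (lr 0 n0).
have F00 : 0 < nc (F (z0 + 0 *: (z - z0))) by rewrite scale0r addr0 nc_gt0.
have [d d0 H] := cder_cont Fl F00.
have := @disc_identity R (fun t => G (z0 + t *: (z - z0))) 0 1 2 (Num.min d 2).
rewrite nc0 ComplexField.Normc.normc1 scale1r subrKC; apply => //.
- by rewrite lt_min d0 /=; lra.
- by lra.
- by move=> t /lr; exact: GH.
move=> t; rewrite subr0 lt_min => /andP[td /lr tO].
have := FG _ tO; have /(_ _)/= := H t; rewrite subr0 => /(_ td) h /eqP.
rewrite mulf_eq0 => /orP[/eqP F0|/eqP//].
by move: h; rewrite F0 sub0r ncN ltxx.
Qed.

(** If the product vanished on the polydisc it would vanish on [Om], where there are no zero
    divisors. *)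
Lemma gholo_prod_neq0 n (Om S : set 'rV[C]_n) c (F : 'I_c -> 'rV[C]_n -> C) p (r : R) :
  open Om -> connected Om -> Om p -> 0 < r -> box p r `<=` S ->
  (forall i, gholo Om (F i)) -> (forall i, exists2 z, Om z & F i z != 0) ->
  exists2 z, S z & \prod_i F i z != 0.
Proof.
move=> oO cO Op r0 pS FH F0; apply: contrapT => H.
have P0 z : Om z -> \prod_i F i z = 0.
  apply: (@gholo_identity R n Om (fun z => \prod_i F i z) p r) => //.
    exact: gholo_prod.
  by move=> {}z /pS Sz; apply/eqP/negPn/negP => h; apply: H; exists z.
(* Factors are cancelled one by one, down to the empty product, which would give [1 = 0] at [p]. *)
move: P0; elim: (index_enum _) => [/(_ p Op)/eqP|i s IH P0].
  by rewrite big_nil oner_eq0.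
have [z Oz Fz] := F0 i; apply: IH.
apply: (gholo_domain oO cO (FH i) (gholo_prod s FH) _ Oz Fz) => w Ow.
by rewrite -(P0 w Ow) big_cons.
Qed.

Lemma comp_free_box n (Om S : set 'rV[C]_n) N (phi : 'rV[C]_n -> 'rV[C]_N) p (r : R) :
  open Om -> connected Om -> Om p -> 0 < r -> box p r `<=` S ->
  (forall j, gholo Om (fun z => phi z 0 j)) -> comp_free Om phi -> comp_free S phi.
Proof.
move=> oO cO Op r0 pS hphi fphi c c0; apply: fphi.
apply: (@gholo_identity R n Om (fun z => (phi z *m c) 0 0) p r) => //.
  exact: gholo_mulmx.
by move=> z /pS; exact: c0.
Qed.

(** A nonzero [c] annihilating [(1, phi)] would place the image in its kernel, a proper subspace. *)
Lemma minimally_embedded_free (T : Type) N (Om : set T) (phi : T -> 'rV[C]_N) :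
  minimally_embedded Om phi -> comp_free Om (with_one phi).
Proof.
move=> phi_min c c0; apply: contrapT => /eqP cn0; apply: phi_min.
exists (lker (linfun (mulmxr c : 'rV[C]_(1 + N) -> 'rV[C]_1))); split; last first.
  move=> z Oz; rewrite memv_ker lfunE /=; apply/eqP/matrixP => i j.
  by rewrite (ord1 i) (ord1 j) c0 // mxE.
have /matrix0Pn[i [j cij]] := cn0.
apply: contraNneq cij => full.
have : (delta_mx 0 i : 'rV[C]_(1 + N)) \in lker (linfun (mulmxr c : 'rV[C]_(1 + N) -> 'rV[C]_1)).
  by rewrite full memvf.
rewrite memv_ker lfunE /= -rowE => /eqP /(congr1 (fun M : 'rV_1 => M 0 j)).
by rewrite !mxE => ->.
Qed.

Lemma gholo_with_one n (Om : set 'rV[C]_n) N (phi : 'rV[C]_n -> 'rV[C]_N) j :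
  (forall k, gholo Om (fun z => phi z 0 k)) -> gholo Om (fun z => with_one phi z 0 j).
Proof.
move=> H; rewrite /with_one; case: (split_ordP j) => k ->.
  by under [X in gholo _ X]funext do rewrite row_mxEl; exact: gholo_cst.
by under [X in gholo _ X]funext do rewrite row_mxEr; exact: H.
Qed.

Lemma gholo_tensor_pow n (Om : set 'rV[C]_n) N (phi : 'rV[C]_n -> 'rV[C]_N) k j :
  (forall k, gholo Om (fun z => phi z 0 k)) -> gholo Om (fun z => tensor_pow phi k z 0 j).
Proof.
move=> H; have [t tP] := tensor_pow_comp phi j.
by rewrite (funext tP); apply: (@gholo_prod _ _ _ _ _ (fun x z => phi z 0 x)).
Qed.

Lemma has_one_with_one (T : Type) (S : set T) N (phi : T -> 'rV[C]_N) :
  has_one S (with_one phi).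
Proof.
exists (delta_mx (lshift N 0) 0) => z _.
by rewrite -colE mxE /with_one row_mxEl mxE eqxx.
Qed.

Lemma comp_span_spanned (T : Type) (S : set T) N M (phi : T -> 'rV[C]_N) (psi : T -> 'rV[C]_M) :
  comp_span S phi `<=` comp_span S psi -> spanned S phi psi.
Proof. by move=> sub j; apply: (sub (fun z => phi z 0 j)); exact: spanned_refl. Qed.

Lemma rank_pow_with_one_ge n (Om S : set 'rV[C]_n) d (f : 'rV[C]_n -> 'rV[C]_d) c p (r : R) :
  open Om -> connected Om -> Om p -> 0 < r -> box p r `<=` S ->
  holomorphic_on Om f -> minimally_embedded Om f ->
  exists q : 'I_(c * d).+1 -> 'rV[C]_n, (forall i, S (q i)) /\
    \rank (pts (tensor_pow (with_one f) c) q) = (c * d).+1.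
Proof.
move=> oO cO Op r0 pS fH /minimally_embedded_free ff.
have Sp : S p by apply: pS; exact: box_center.
have hf j : gholo Om (fun z => with_one f z 0 j).
  by apply: gholo_with_one => k; exact: holo_gholo.
apply: (@rank_tensor_pow_ge _ _ S d (with_one f) c); first by exists p.
move=> l l0.
apply: (@gholo_prod_neq0 n Om S c (fun i z => (with_one f z *m l i) 0 0) p r) => // i.
  exact: gholo_mulmx.
apply: contrapT => H; move/negP: (l0 i); apply; apply/eqP; apply: ff => z Oz.
by apply/eqP/negPn/negP => h; apply: H; exists z.
Qed.

End Domain.

(** Hockey-stick identity; the successor accounts for [k = 0], the constant monomial. *)
Lemma sum_bin_upper m a :
  ((\sum_(1 <= k < a.+1) 'C(m + k - 1, k)).+1 = 'C(a + m, a))%N.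
Proof.
elim: a => [|a IH]; first by rewrite big_geq // bin0.
by rewrite big_nat_recr //= -addSn IH addSn binS addnC addnS subn1 /= [(m + a)%N]addnC.
Qed.

Section MainBounds.
Variable R : realType.
Local Notation C := R[i].

(** The syzygy bound with [e = n]: [(n + 1) ^ 2 - n (n + 1) / 2 = n (n + 3) / 2 + 1]. *)
Lemma rank_quadratic_ge n (S : set 'rV[C]_n) (Y : 'rV[C]_n -> 'rV[C]_n.+1) N
    (P : 'rV[C]_n -> 'rV[C]_N) s :
  open S -> (forall j, gholo S (fun z => Y z 0 j)) -> comp_free S Y ->
  spanned S (tensor (with_one id) Y) P ->
  (forall k (q : 'I_k -> 'rV[C]_n), (forall i, S (q i)) -> (\rank (pts P q) <= s.+1)%N) ->
  ((n * (n + 3)) %/ 2 <= s)%N.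
Proof.
move=> oS hY fY YP ub; have [k [q [Sq le1]]] := rank_tensor_affine oS hY fY.
have le2 := leq_trans (rank_spanned YP Sq) (ub k q Sq).
move: le1; rewrite binS bin1 => le1.
have h2 : ('C(n, 2) * 2 + n = n * n)%N.
  by rewrite bin2 muln2 halfK; case: (n) => [|n'] //=; rewrite oddM /= andNb subn0 mulSn; lia.
have -> : (n * (n + 3) = ('C(n, 2) + n * 2) * 2)%N by rewrite mulnDr -h2; lia.
rewrite mulnK //; nia.
Qed.

Lemma comp_free_affine n (p : 'rV[C]_n) (r : R) : 0 < r -> comp_free (box p r) (with_one id).
Proof.
move=> r0 c c0.
have E z : with_one id z *m c = usubmx c + z *m dsubmx c.
  by rewrite -[c in LHS]vsubmxK /with_one mul_row_col mul1mx.
have d0 : dsubmx c = 0.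
  apply/matrixP => k j; rewrite (ord1 j) [RHS]mxE.
  pose t : C := (r / 2)%:C.
  have tn0 : t != 0 by rewrite fmorph_eq0 gt_eqF //; lra.
  have pt : box p r (p + t *: delta_mx 0 k).
    move=> i; rewrite !mxE addrAC subrr add0r mulr_natr.
    case: (_ && _); rewrite ?mulr0n ?nc0 // mulr1n ncC gtr0_norm; lra.
  have := c0 _ pt; have := c0 p (box_center p r0).
  rewrite !E mulmxDl addrA -scalemxAl -rowE [in X in _ -> X -> _]mxE => -> /eqP.
  by rewrite add0r !mxE mulf_eq0 (negPf tn0) => /eqP.
have u0 : usubmx c = 0.
  apply/matrixP => k j; rewrite (ord1 j) (ord1 k) [RHS]mxE.
  by have := c0 p (box_center p r0); rewrite E d0 mulmx0 addr0.
by rewrite -[c]vsubmxK u0 d0 col_mx0.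
Qed.

End MainBounds.
Theorem theorem1p4 (R : realType) (n d m : nat)
    (n_gt0 : (0 < n)%N) (d_gt0 : (0 < d)%N) (m_gt0 : (0 < m)%N)
    (Omega : set 'rV[R[i]]_n)
    (Omega_open : open Omega) (Omega_connected : connected Omega)
    (Omega_nonempty : Omega !=set0)
    (f : 'rV[R[i]]_n -> 'rV[R[i]]_d)
    (f_holo : holomorphic_on Omega f) (f_min : minimally_embedded Omega f)
    (a b c : nat)
    (a_gt0 : (0 < a)%N) (b_gt0 : (0 < b)%N) (c_gt0 : (0 < c)%N)
    (abc_coprime : forall p : nat, prime p ->
       ~ [/\ (p %| a)%N, (p %| b)%N & (p %| c)%N])
    (h : 'rV[R[i]]_n -> 'rV[R[i]]_m)
    (h_holo : holomorphic_on Omega h) (h_min : minimally_embedded Omega h)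
    (h_metric : forall z, Omega z ->
       fs_modification f (c%:R / b%:R) z =
       (a%:R / b%:R) *: pullback h (@fubini_study R m) z)
    (e : nat)
    (e_rank : has_rank Omega (tensor_pow (with_one f) c) e.+1) :
  [/\ (c * d <= e <= \sum_(1 <= k < c.+1) 'C(d + k - 1, k))%N,
      (e <= n)%N -> b = 1%N ->
        (n * (e + 1) - (e * (e - 1)) %/ 2
           <= \sum_(1 <= k < a.+1) 'C(m + k - 1, k))%N
        /\ (a * m <= n * (e + 1) + e)%N
    & (n <= e)%N \/ (2 <= b)%N ->
        ((n * (n + 3)) %/ 2 <= \sum_(1 <= k < a.+1) 'C(m + k - 1, k))%N].
Proof.
have [p Op] := Omega_nonempty.
have metric z v : Omega z ->
    b%:R * gform z v z v + c%:R * gform (f z) ('d f z v) (f z) ('d f z v) =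
    a%:R * gform (h z) ('d h z v) (h z) ('d h z v).
  by move=> Oz; exact: metric_gform (h_metric z Oz) v.
have [s s0 [sO [g [t [t0 g0 KE]]]]] :=
  kernel_factorization Omega_open Op f_holo h_holo metric.
pose S := box p s.
have oS : open S by exact: open_box.
pose F := tensor_pow (with_one f) c.
pose P := tensor (tensor_pow (with_one id) b) F.
pose H := tensor_pow (with_one h) a.
have rankPH k (q : 'I_k -> 'rV[R[i]]_n) : (forall i, S (q i)) -> \rank (pts P q) = \rank (pts H q).
  move=> Sq; apply: (@rank_gram R _ S _ _ P H g t k q) => // z w Sz Sw.
  by rewrite /P /F /H ip_tensor !ip_tensor_pow !ip_with_one KE.
have [B [fB spanB]] := e_rank.
have BF : spanned Omega B F by apply: comp_span_spanned; rewrite spanB.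
have FB : spanned Omega F B by apply: comp_span_spanned; rewrite spanB.
have hF j : gholo Omega (fun z => F z 0 j).
  by apply: gholo_tensor_pow => k; apply: gholo_with_one => k'; exact: holo_gholo.
have upper k (q : 'I_k -> 'rV[R[i]]_n) : (forall i, S (q i)) ->
    (\rank (pts P q) <= (\sum_(1 <= k < a.+1) 'C(m + k - 1, k)).+1)%N.
  by move=> Sq; rewrite rankPH // sum_bin_upper; exact: rank_tensor_pow_le Sq.
have oneS N (phi : 'rV[R[i]]_n -> 'rV[R[i]]_N) : has_one S (with_one phi).
  exact: has_one_with_one.
have hid j : gholo S (fun z => with_one id z 0 j).
  by apply: gholo_with_one => k; exact: gholo_coord.
(* [Y] agrees with the basis [B] on [Omega]; as a fixed combination of the components of [F] it
   inherits differentiability along lines. *)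
have [D DP] := spannedP BF; pose Y z := F z *m D.
have hY' j : gholo Omega (fun z => Y z 0 j) by exact: gholo_mulmx.
have hY j : gholo S (fun z => Y z 0 j) := gholo_sub sO (hY' j).
have fY : comp_free S Y.
  apply: (comp_free_box Omega_open Omega_connected Op s0 (@subset_refl _ S) hY') => v v0.
  by apply: fB => z Oz; rewrite DP //; exact: v0.
have YF : spanned S Y F.
  move=> j; exists (col j D) => z _; rewrite /Y !mxE.
  by apply: eq_bigr => k _; rewrite !mxE.
split.
- apply/andP; split.
    have [q [Oq rq]] := rank_pow_with_one_ge c Omega_open Omega_connected Op s0 sO f_holo f_min.
    by have := leq_trans (rank_spanned FB Oq) (rank_leq_col _); rewrite rq ltnS.
  have [k [q [Oq rq]]] := comp_freeP fB.
  rewrite -ltnS sum_bin_upper -rq; apply: leq_trans (rank_spanned BF Oq) _.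
  exact: rank_tensor_pow_le Oq.
- move=> en b1; rewrite /P b1 in rankPH upper; split.
    have [k [q [Sq le1]]] := rank_tensor_affine oS hY fY.
    have := leq_trans le1 (leq_add (rank_spanned (spanned_tensor (spanned_refl _ _) YF) Sq) (leqnn _)).
    move=> /leq_trans /(_ (leq_add (upper k q Sq) (leqnn _))).
    rewrite binS bin1 bin2 divn2 subn1 addn1.
    move: (\sum_(1 <= k < a.+1) _)%N (e * e.-1)./2 => X Z; nia.
  have [q [Sq rq]] := rank_pow_with_one_ge a Omega_open Omega_connected Op s0 (@subset_refl _ S) h_holo h_min.
  (* At the points [q] the rank of [H] is [a m + 1], while [P] is spanned by the [(1 + n)(e + 1)]
     components of [(1, z) (x) B]. *)
  have : ((a * m).+1 <= (1 + n) * e.+1)%N.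
    rewrite -rq -rankPH //.
    apply: leq_trans (rank_leq_col (pts (tensor (with_one id) B) q)).
    by apply: rank_spanned Sq; exact: (spanned_tensor (spanned_refl _ _) (spanned_sub sO FB)).
  nia.
- have [b2 _|b1 nb] := ltnP 1 b.
    apply: (@rank_quadratic_ge R n S (with_one id) _ P) => //.
      exact: comp_free_affine.
    apply: spanned_trans (spanned_pow2 (oneS _ id) b2) _.
    by apply: spanned_tensorl; apply: has_one_pow; exact: oneS.
  have {}b1 : b = 1%N by apply/eqP; rewrite eqn_leq b1.
  have ne : (n.+1 <= e.+1)%N by case: nb => //; rewrite b1.
  rewrite /P b1 in upper.
  (* [J] keeps the first [n + 1] of the [e + 1] independent functions. *)
  pose J : 'M[R[i]]_(e.+1, n.+1) := pid_mx n.+1.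
  apply: (@rank_quadratic_ge R n S (fun z => Y z *m J) _ _ _ oS _ _ _ upper).
  + by move=> j; exact: gholo_mulmx.
  + move=> v v0; have : J *m v = 0.
      by apply: fY => z Sz; rewrite mulmxA; exact: v0.
    move=> /(congr1 (mulmx (pid_mx n.+1 : 'M_(n.+1, e.+1)))).
    by rewrite mulmxA pid_mx_id // pid_mx_1 mul1mx mulmx0.
  + apply: spanned_tensor; first exact: spanned_refl.
    apply: spanned_trans YF => j; exists (col j J) => z _.
    by rewrite !mxE; apply: eq_bigr => k _; rewrite !mxE.
Qed.
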